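(* Let $d=2$ or $d=3$. For any $C_1>0$ there exists $C>0$ such that for all $B_e\in\mathrm{Lipsch}(\mathbb{T}^d)$ with $\|B_e\|_{\mathrm{Lipsch}(\mathbb{T}^d)}\le C_1$ and for all $u\in\mathcal{S}(\mathbb{T}^d\times\mathbb{R}^d)$, the operator $$K=v\cdot\nabla_x-(v\wedge B_e)\cdot\nabla_v-\Delta_v+\frac{v^2}{4}-\frac d2$$ satisfies the maximal estimate $$\big\|\big(v\cdot\nabla_x-(v\wedge B_e)\cdot\nabla_v\big)u\big\|+\|u\|_{\tilde B^2}\le C\big(\|Ku\|+\|u\|\big),$$ where $\|\cdot\|$ is the $L^2(\mathbb{T}^d\times\mathbb{R}^d)$ norm.
   Context: Here $\mathbb{T}^d=\mathbb{R}^d/\mathbb{Z}^d$, $x\in\mathbb{T}^d$ is the space variable, $v\in\mathbb{R}^d$ is the velocity variable, and $v^2=|v|^2$. The magnetic field $B_e:\mathbb{T}^d\to\mathbb{R}^{d(d-1)/2}$ is $B_e=b$ (scalar) if $d=2$ and $B_e=(b_1,b_2,b_3)$ if $d=3$; it depends only on $x$. The notation $(v\wedge B_e)\cdot\nabla_v$ means $$(v\wedge B_e)\cdot\nabla_v=b(x)\,(v_1\partial_{v_2}-v_2\partial_{v_1})\quad\text{if } d=2,$$ $$(v\wedge B_e)\cdot\nabla_v=b_1(x)(v_2\partial_{v_3}-v_3\partial_{v_2})+b_2(x)(v_3\partial_{v_1}-v_1\partial_{v_3})+b_3(x)(v_1\partial_{v_2}-v_2\partial_{v_1})\quad\text{if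 } d=3.$$ $\mathcal{S}(\mathbb{T}^d\times\mathbb{R}^d)$ is the Schwartz space: smooth functions on $\mathbb{T}^d\times\mathbb{R}^d$ all of whose derivatives decay faster than any power of $|v|$, uniformly in $x$. $\tilde B^2(\mathbb{T}^d\times\mathbb{R}^d)=L^2(\mathbb{T}^d_x,B^2_v(\mathbb{R}^d))$, where $B^2_v(\mathbb{R}^d)=\{u\in L^2(\mathbb{R}^d): v^\alpha\partial_v^\beta u\in L^2(\mathbb{R}^d)\ \text{for all } (\alpha,\beta)\in\mathbb{N}^{2d},\ |\alpha|+|\beta|\le 2\}$, with norm $$\|u\|_{\tilde B^2}=\Big(\sum_{|\alpha|+|\beta|\le 2}\|v^\alpha\partial_v^\beta u\|^2\Big)^{1/2},$$ $\|\cdot\|$ being the $L^2(\mathbb{T}^d\times\mathbb{R}^d)$ norm. $\mathrm{Lipsch}(\mathbb{T}^d)$ is the space of Lipschitz functions from $\mathbb{T}^d$ to $\mathbb{R}^{d(d-1)/2}$ with norm $$\|w\|_{\mathrm{Lipsch}(\mathbb{T}^d)}=\|w\|_{L^\infty(\mathbb{T}^d,\mathbb{R}^{d(d-1)/2})}+\sup_{x,y\in\mathbb{T}^d,\ x\ne y}\frac{|w(x)-w(y)|}{\mathrm{dist}(x,y)},$$ where $\mathrm{dist}$ is the natural distance on $\mathbb{T}^d$ and $|\cdot|$ the Euclidean norm. *)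

(* Defs.v *)
From HB Require Import structures.
From mathcomp Require Import all_boot all_order all_algebra.
From mathcomp Require Import all_classical all_reals all_analysis.
From mathcomp Require Import complex.

Set Implicit Arguments.
Unset Strict Implicit.
Unset Printing Implicit Defensive.

Import Order.TTheory GRing.Theory Num.Theory.
Import numFieldNormedType.Exports.

Local Open Scope classical_set_scope.
Local Open Scope ring_scope.

(* Product measures on n-tuples: mpow m n.+1 is the image of m \x mpow m n
   under (t, s) |-> t :: s. *)
Section mpow.
Context dsp (T : measurableType dsp) (R : realType).
Variable m : {sigma_finite_measure set T -> \bar R}.

Definition tcons n (p : T * n.-tuple T) : n.+1.-tuple T :=
  [tuple of p.1 :: p.2].

Lemma measurable_tcons n : measurable_fun [set: T * n.-tuple T] (@tcons n).
Proof. exact: measurable_cons. Qed.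

Section step.
Variables (n : nat) (mu : {sigma_finite_measure set (n.-tuple T) -> \bar R}).

Definition mpow_step : set (n.+1.-tuple T) -> \bar R :=
  pushforward (m \x mu)%E (@tcons n).

Let mpow_step0 : mpow_step set0 = 0%E.
Proof. by rewrite /mpow_step /pushforward preimage_set0 measure0. Qed.

Let mpow_step_ge0 A : (0 <= mpow_step A)%E.
Proof. by rewrite /mpow_step /pushforward measure_ge0. Qed.

Let mpow_step_sigma_additive : semi_sigma_additive mpow_step.
Proof.
move=> F mF tF mUF; rewrite /mpow_step /pushforward preimage_bigcup.
apply: measure_semi_sigma_additive.
- by move=> i; rewrite -[X in measurable X]setTI; exact: measurable_tcons.
- apply/trivIsetP => /= i j _ _ ij; rewrite -preimage_setI.
  by move/trivIsetP : tF => /(_ _ _ _ _ ij) ->//; rewrite preimage_set0.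
- by rewrite -preimage_bigcup -[X in measurable X]setTI; exact: measurable_tcons.
Qed.

HB.instance Definition _ := isMeasure.Build _ _ _ mpow_step
  mpow_step0 mpow_step_ge0 mpow_step_sigma_additive.

Lemma mpow_step_sigma_finite : sigma_finite setT mpow_step.
Proof.
have /sigma_finiteP[F [TF ndF Foo]] := sigma_finiteT m.
have /sigma_finiteP[G [TG ndG Goo]] := sigma_finiteT mu.
pose g (t : n.+1.-tuple T) : T * n.-tuple T := (thead t, [tuple of behead t]).
have mg : measurable_fun setT g.
  apply/measurable_fun_pairP; split => /=.
  - exact: measurable_tnth.
  - exact: measurable_behead.
exists (fun i => g @^-1` (F i `*` G i)).
  apply/esym; rewrite -subTset => t _.
  have [i _ Fi] : (\bigcup_i F i) (g t).1 by rewrite -TF.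
  have [j _ Gj] : (\bigcup_i G i) (g t).2 by rewrite -TG.
  exists (maxn i j) => //; split.
  - by move: Fi; exact/subsetPset/ndF/leq_maxl.
  - by move: Gj; exact/subsetPset/ndG/leq_maxr.
move=> i; have [mFi Fi] := Foo i; have [mGi Gi] := Goo i; split.
  by rewrite -[X in measurable X]setTI; apply: mg => //; exact: measurableX.
rewrite /mpow_step /pushforward -comp_preimage.
rewrite (_ : g \o _ = id); last first.
  by apply/funext => -[t s] /=; rewrite /g theadE; congr (_, _); exact/val_inj.
by rewrite preimage_id product_measure1E// lte_mul_pinfty// ge0_fin_numE.
Qed.

HB.instance Definition _ :=
  Measure_isSigmaFinite.Build _ _ _ mpow_step mpow_step_sigma_finite.

End step.

Fixpoint mpow n : {sigma_finite_measure set (n.-tuple T) -> \bar R} :=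
  match n with
  | 0 => \d_([tuple] : 0.-tuple T)
  | n'.+1 => mpow_step (mpow n')
  end.

End mpow.

Section torus.
Context {R : realType}.

Lemma measurable_unit_interval : measurable (`[0, 1]%classic : set (measurableTypeR R)).
Proof. exact: measurable_itv. Qed.

Lemma lebesgue_unit_interval_lty :
  (lebesgue_measure (`[0%R, 1%R]%classic : set (measurableTypeR R)) < +oo)%E.
Proof. by rewrite lebesgue_measure_itv /= lte01 sube0 ltry. Qed.

(* A function on the torus is a function on R^d that is invariant under the
   translations by Z^d; it is integrated over the cube [0, 1]^d. *)
Definition torus_measure d :
    {sigma_finite_measure set (d.-tuple (measurableTypeR R)) -> \bar R} :=
  mpow (mfrestr measurable_unit_interval lebesgue_unit_interval_lty) d.

Definition velocity_measure d :
    {sigma_finite_measure set (d.-tuple (measurableTypeR R)) -> \bar R} :=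
  mpow (@lebesgue_measure R) d.

Definition vec d (t : d.-tuple R) : 'rV[R]_d := \row_i tnth t i.

(* The library's norm on 'rV is the sup norm. *)
Definition enorm n (w : 'rV[R]_n) : R := Num.sqrt (\sum_i w 0 i ^+ 2).

Definition intvec d (k : 'rV[int]_d) : 'rV[R]_d := map_mx intr k.

Definition torus_dist d (x y : 'rV[R]_d) : R :=
  inf [set enorm (x - y + intvec k) | k in [set: 'rV[int]_d]].

Definition torus_neq d (x y : 'rV[R]_d) : Prop :=
  forall k : 'rV[int]_d, x - y <> intvec k.

Definition lipsch d n (w : 'rV[R]_d -> 'rV[R]_n) : Prop :=
  (forall (k : 'rV[int]_d) x, w (x + intvec k) = w x) /\
  exists K : R, forall x y, enorm (w x - w y) <= K * torus_dist x y.

Definition lipsch_norm d n (w : 'rV[R]_d -> 'rV[R]_n) : \bar R :=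
  ('N[torus_measure d]_+oo [(fun t => (enorm (w (vec t)))%:E)] +
   ereal_sup [set e | exists x y, torus_neq x y /\
                e = (enorm (w x - w y) / torus_dist x y)%:E])%E.

End torus.

Section phase_space.
Context {R : realType} (d : nat).

Local Notation phase := ('rV[R]_d * 'rV[R]_d)%type.
Local Notation fct := (phase -> R[i]).

(* inl i and inr i index the i-th position and the i-th velocity variable. *)
Definition dir (i : 'I_d + 'I_d) : phase :=
  match i with
  | inl j => (delta_mx 0 j, 0)
  | inr j => (0, delta_mx 0 j)
  end.

(* R[i] is not a normed module over R in the library, so derivatives of
   complex-valued functions are taken componentwise. *)
Definition pd (i : 'I_d + 'I_d) (u : fct) : fct := fun z =>
  ('D_(dir i) (@complex.Re R \o u) z +i* 'D_(dir i) (@complex.Im R \o u) z)%C.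

Definition pds (s : seq ('I_d + 'I_d)) (u : fct) : fct := foldr pd u s.

Definition smooth (u : fct) : Prop := forall s,
  [/\ continuous (@complex.Re R \o pds s u),
      continuous (@complex.Im R \o pds s u) &
      forall i z, derivable (@complex.Re R \o pds s u) z (dir i) /\
                  derivable (@complex.Im R \o pds s u) z (dir i)].

Definition schwartz (u : fct) : Prop :=
  [/\ forall (k : 'rV[int]_d) x v, u (x + intvec k, v) = u (x, v),
      smooth u &
      forall s n, exists M : R, forall z,
        enorm z.2 ^+ n * Normc.normc (pds s u z) <= M].

Definition L2norm (u : fct) : \bar R :=
  'N[(torus_measure d \x velocity_measure d)%E]_2%:E
    [(fun p => (Normc.normc (u (vec p.1, vec p.2)))%:E)]%E.

Definition vmon (a : {ffun 'I_d -> 'I_3}) (v : 'rV[R]_d) : R :=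
  \prod_i v 0 i ^+ a i.

Definition dvs (b : {ffun 'I_d -> 'I_3}) (u : fct) : fct :=
  foldr (fun i => iter (b i) (pd (inr i))) u (enum 'I_d).

(* Entries of the multi-indices are at most 2 since |a| + |b| <= 2. *)
Definition B2norm (u : fct) : \bar R :=
  ((\sum_(ab : {ffun 'I_d -> 'I_3} * {ffun 'I_d -> 'I_3} |
          (\sum_i ab.1 i + \sum_i ab.2 i <= 2)%N)
      L2norm (fun z => ((vmon ab.1 z.2)%:C)%C * dvs ab.2 u z)%R ^+ 2)
   `^ 2^-1)%E.

End phase_space.

Section operators.
Context {R : realType}.

Local Notation fct d := ('rV[R]_d * 'rV[R]_d -> R[i]).

Definition wedge_grad2 (B : 'rV[R]_2 -> 'rV[R]_1) (u : fct 2) : fct 2 :=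
  fun z => let b := B z.1 0 0 in let v i := z.2 0 i in
  let dv i := pd (inr i) u z in
  ((b * v 0)%:C * dv 1 - (b * v 1)%:C * dv 0)%C.

Definition wedge_grad3 (B : 'rV[R]_3 -> 'rV[R]_3) (u : fct 3) : fct 3 :=
  fun z => let b i := B z.1 0 i in let v i := z.2 0 i in
  let dv i := pd (inr i) u z in
  ((b 0)%:C * ((v 1)%:C * dv 2%:R - (v 2%:R)%:C * dv 1) +
   (b 1)%:C * ((v 2%:R)%:C * dv 0 - (v 0)%:C * dv 2%:R) +
   (b 2%:R)%:C * ((v 0)%:C * dv 1 - (v 1)%:C * dv 0))%C.

Definition magnetic_field d : Type := 'rV[R]_d -> 'rV[R]_((d * (d - 1))./2).

(* (v /\ B) . grad_v; the value outside d = 2, 3 is a dummy. *)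
Definition wedge_grad d : magnetic_field d -> fct d -> fct d :=
  match d with
  | 2 => wedge_grad2
  | 3 => wedge_grad3
  | _ => fun _ _ _ => 0
  end.

Definition transport d (B : magnetic_field d) (u : fct d) : fct d := fun z =>
  \sum_i ((z.2 0 i)%:C)%C * pd (inl i) u z - wedge_grad B u z.

Definition fokker_planck d (B : magnetic_field d) (u : fct d) : fct d := fun z =>
  transport B u z - \sum_i pd (inr i) (pd (inr i) u) z
  + ((enorm z.2 ^+ 2 / 4 - d%:R / 2)%:C)%C * u z.

End operators.

(* Main.v *)
From HB Require Import structures.
From mathcomp Require Import all_boot all_order all_algebra.
From mathcomp Require Import all_classical all_reals all_analysis.
From mathcomp Require Import measurable_realfun ess_sup_inf.
From mathcomp Require Import complex ring lra zify.
Require Import Defs.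

(* Write K = X - W + H - d/2 with X = v.grad_x, W the magnetic rotation, H the harmonic
   oscillator, and put f = (X - W + H) u, k = ||f|| + ||u||, N = ||H u|| + k.  W commutes with H
   and is skew, so ||(X - W) u||^2 + ||H u||^2 = ||f||^2 - 2 sum_i (d_{x_i} u, d_{v_i} u), and
   it suffices to absorb the cross terms.

   Let D_j be the difference in direction x_i with step 2^-j, q^3 = 2, and
   a^2 = sum_j q^(4j) ||D_j u||^2, e^2 = sum_j q^(2j) ||D_j d_{v_i} u||^2, which stand for
   1/3 + 1/3 of an x-derivative of u and 1/3 of an x-derivative of d_v u.
   - Telescoping the dyadic difference quotients gives |(d_{x_i} u, d_{v_i} u)| <= a e / 2 + o(1).
   - e^2 <= c k (a + N): test the equation differenced at step 2^-j with D_j u.  As B is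
     Lipschitz, the commutator of D_j with W costs only 2^-j.
   - a^2 <= c N e + o(1): use [d_{v_i}, X] = d_{x_i} on dyadic averages of u.
   Hence N^2 <= c k^2 + c sum_i a_i e_i forces N <= C k.  The second-order norms follow from
   the exact identity for ||H u||^2, and complex u reduce to real ones since K is real.

   The norm of B bounds it everywhere, not only almost everywhere: |B| <= C1 at some point, and
   the torus has diameter at most sqrt d. *)

Set Implicit Arguments.
Unset Strict Implicit.
Unset Printing Implicit Defensive.

Import Order.TTheory GRing.Theory Num.Theory.

Local Open Scope ring_scope.

(** * Semi-inner products and averages along a flow *)

(** The obstacle is that the field is only Lipschitz: [W u] need not be differentiable in x, even
    for smooth u. Hence two spaces, [S] of smooth functions and [V] of continuous ones, with [W]
    mapping [S] to [V] and its commutation with the oscillator expressed weakly, inside the inner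
    product. Finite differences replace fractional powers of the x-Laplacian for the same reason:
    they never differentiate the field. The exponents are those of kinetic scaling: control of two
    v-derivatives and of one transport derivative is worth 2/3 of an x-derivative. Cauchy-Schwarz
    scale by scale would lose a factor growing with the number of scales, since the differences of f
    are bounded but not square summable against the weights; almost orthogonality of the scales
    removes this loss. Absorption succeeds because the two bounds combine to a e <= c k^(3/4)
    N^(5/4), which is subquadratic in N. The o(1) terms depend on second x-derivatives of u, but the
    step tends to 0 at fixed u, so they never enter the constant. *)

Record semi_inner (R : rcfType) (V : lmodType R) := SemiInner {
  ip :> V -> V -> R;
  ipC : forall u w, ip u w = ip w u;
  ipDl : forall u v w, ip (u + v) w = ip u w + ip v w;
  ipZl : forall a u w, ip (a *: u) w = a * ip u w;
  ip_ge0 : forall u, 0 <= ip u u }.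

Section semi_inner_theory.
Context (R : rcfType) (V : lmodType R) (dot : semi_inner V).
Implicit Types u v w : V.

Lemma ipDr u v w : dot u (v + w) = dot u v + dot u w.
Proof. by rewrite ipC ipDl !(ipC _ u). Qed.

Lemma ipZr a u w : dot u (a *: w) = a * dot u w.
Proof. by rewrite ipC ipZl ipC. Qed.

Lemma ipNl u w : dot (- u) w = - dot u w.
Proof. by rewrite -scaleN1r ipZl mulN1r. Qed.

Lemma ipNr u w : dot u (- w) = - dot u w.
Proof. by rewrite ipC ipNl ipC. Qed.

Lemma ipBl u v w : dot (u - v) w = dot u w - dot v w.
Proof. by rewrite ipDl ipNl. Qed.

Lemma ipBr u v w : dot u (v - w) = dot u v - dot u w.
Proof. by rewrite ipDr ipNr. Qed.

Lemma ip0l u : dot 0 u = 0.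
Proof. by rewrite -(scale0r 0) ipZl mul0r. Qed.

Lemma ip_suml (I : Type) (r : seq I) (P : pred I) (F : I -> V) w :
  dot (\sum_(i <- r | P i) F i) w = \sum_(i <- r | P i) dot (F i) w.
Proof.
by elim/big_rec2: _ => [|i y x _ <-]; rewrite ?ip0l ?ipDl.
Qed.

Lemma ip_sumr (I : Type) (r : seq I) (P : pred I) (F : I -> V) w :
  dot w (\sum_(i <- r | P i) F i) = \sum_(i <- r | P i) dot w (F i).
Proof. by rewrite ipC ip_suml; apply: eq_bigr => i _; rewrite ipC. Qed.

Definition nrm u := Num.sqrt (dot u u).

Lemma nrm_ge0 u : 0 <= nrm u.
Proof. exact: sqrtr_ge0. Qed.

Lemma sqr_nrm u : nrm u ^+ 2 = dot u u.
Proof. by rewrite sqr_sqrtr// ip_ge0. Qed.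

Lemma nrmZ a u : nrm (a *: u) = `|a| * nrm u.
Proof.
by rewrite /nrm ipZl ipZr mulrA -expr2 sqrtrM ?sqr_ge0// sqrtr_sqr.
Qed.

Lemma nrmN u : nrm (- u) = nrm u.
Proof. by rewrite /nrm ipNl ipNr opprK. Qed.

Lemma nrm0 : nrm 0 = 0.
Proof. by rewrite /nrm ip0l sqrtr0. Qed.

Lemma cauchy_schwarz u w : `|dot u w| <= nrm u * nrm w.
Proof.
rewrite /nrm -sqrtrM ?ip_ge0// -sqrtr_sqr ler_wsqrtr//.
have ge0 s t : 0 <= s ^+ 2 * dot u u + s * t * dot u w *+ 2 + t ^+ 2 * dot w w.
  have := ip_ge0 dot (s *: u + t *: w).
  rewrite !ipDl !ipDr !ipZl !ipZr (ipC _ w u) => h.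
  by rewrite (le_trans h)// le_eqVlt; apply/orP; left; apply/eqP; ring.
have [u0|u0] := eqVneq (dot u u) 0.
  have [->|uw0] := eqVneq (dot u w) 0; first by rewrite expr0n/= mulr_ge0 ?ip_ge0.
  (* When [dot u u = 0] the form is affine in [s]; this [s] gives it the negative value
     [- dot w w - 2]. *)
  have := ge0 (- (dot w w + 1) / (dot u w)) 1.
  rewrite u0 mulr0 add0r mulr1 divfK// expr1n mul1r => h.
  by have := ip_ge0 dot w; lra.
have {u0}up : 0 < dot u u by rewrite lt_def u0 ip_ge0.
have := ge0 (- dot u w) (dot u u).
have -> : (- dot u w) ^+ 2 * dot u u + - dot u w * dot u u * dot u w *+ 2 +
  dot u u ^+ 2 * dot w w = dot u u * (dot u u * dot w w - dot u w ^+ 2) by ring.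
by rewrite pmulr_rge0// subr_ge0.
Qed.

Lemma ip_le u w : dot u w <= nrm u * nrm w.
Proof. exact: le_trans (ler_norm _) (cauchy_schwarz _ _). Qed.

Lemma ler_nrmD u w : nrm (u + w) <= nrm u + nrm w.
Proof.
rewrite -(@ler_pXn2r _ 2)// ?nnegrE ?addr_ge0 ?nrm_ge0//.
rewrite sqr_nrm ipDl !ipDr (ipC _ w u) sqrrD !sqr_nrm.
by have := ip_le u w; lra.
Qed.

Lemma ler_nrmB u w : nrm (u - w) <= nrm u + nrm w.
Proof. by rewrite (le_trans (ler_nrmD _ _))// nrmN. Qed.

Lemma ler_nrm_sum (I : Type) (r : seq I) (P : pred I) (F : I -> V) :
  nrm (\sum_(i <- r | P i) F i) <= \sum_(i <- r | P i) nrm (F i).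
Proof.
elim/big_rec2: _ => [|i y x _ xy]; first by rewrite nrm0.
by rewrite (le_trans (ler_nrmD _ _))// lerD2l.
Qed.

End semi_inner_theory.

Lemma sum_cauchy_schwarz (R : rcfType) n (a b : 'I_n -> R) :
  \sum_(k < n) a k * b k <=
  Num.sqrt (\sum_(k < n) a k ^+ 2) * Num.sqrt (\sum_(k < n) b k ^+ 2).
Proof.
pose f (u v : 'rV[R]_n) := \sum_(k < n) u 0 k * v 0 k.
have fC u v : f u v = f v u by apply: eq_bigr => k _; rewrite mulrC.
have fD u v w : f (u + v) w = f u w + f v w.
  by rewrite -big_split; apply: eq_bigr => k _; rewrite mxE mulrDl.
have fZ c u w : f (c *: u) w = c * f u w.
  by rewrite mulr_sumr; apply: eq_bigr => k _; rewrite mxE mulrA.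
have f0 u : 0 <= f u u by rewrite sumr_ge0// => k _; rewrite -expr2 sqr_ge0.
have fE x y : f (\row_k x k) (\row_k y k) = \sum_k x k * y k.
  by apply: eq_bigr => k _; rewrite !mxE.
have := ip_le (SemiInner fC fD fZ f0) (\row_k a k) (\row_k b k).
by rewrite /nrm /= !fE.
Qed.

(** * Almost orthogonal families indexed by dyadic scales *)

Section almost_orthogonality.
Context (R : rcfType).

Lemma geometric_le (r : R) n : 0 <= r < 1 -> \sum_(l < n) r ^+ l <= (1 - r)^-1.
Proof.
move=> /andP[r0 r1]; rewrite -[leRHS]mul1r ler_pdivlMr ?subr_gt0//.
rewrite mulrC -opprB mulNr -subrX1 opprB gerBl exprn_ge0//.
Qed.

(** This is |k - l|: subtraction on [nat] is truncated, so one of the summands is 0. *)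
Definition dist (k l : nat) : nat := (k - l) + (l - k).

(** The indices l >= k and l < k contribute one geometric series each; the induction on k moves the
    term l = 0 into the second one. *)
Lemma two_sided_geometric_le (r : R) k n : 0 <= r < 1 ->
  \sum_(l < n) r ^+ dist k l <= 2 / (1 - r).
Proof.
move=> /[dup] r01 /andP[r0 r1].
suff : \sum_(l < n) r ^+ dist k l <=
    (1 - r)^-1 + \sum_(l < k) r ^+ l.
  by move/le_trans; apply; rewrite mulrDl mul1r lerD2l geometric_le.
elim: k n => [|k IH] n.
  rewrite big_ord0 addr0; under eq_bigr do rewrite /dist sub0n add0n subn0.
  exact: geometric_le.
case: n => [|n].
  by rewrite big_ord0 addr_ge0 ?sumr_ge0 ?invr_ge0 ?subr_ge0 ?ltW// => i _; rewrite exprn_ge0.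
rewrite big_ord_recl big_ord_recr/= addrA addrC lerD//.
rewrite /dist /= subn0 sub0n addn0 exprS ler_piMl ?exprn_ge0// ltW//.
exact: IH.
Qed.

(** A Cotlar-Stein argument in the form of Schur's test: in the expanded square each row of r^|k -
    l| sums to at most 2 / (1 - r), and every [c k] is met once through its row and once through its
    column, whence the 4. *)
Lemma almost_orthogonal (V : lmodType R) (dot : semi_inner V) n
    (y : nat -> V) (c : nat -> R) (r : R) :
  0 <= r < 1 -> (forall k, 0 <= c k) ->
  (forall k l, (k <= l < n)%N ->
     `|dot (y k) (y l)| <= r ^+ (l - k) * (c k + c l)) ->
  nrm dot (\sum_(k < n) y k) <= Num.sqrt (4 / (1 - r) * \sum_(k < n) c k).
Proof.
move=> r01 c0 H; rewrite ler_wsqrtr// ip_suml.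
have {}H k l : (k < n)%N -> (l < n)%N ->
    dot (y k) (y l) <= r ^+ dist k l * (c k + c l).
  move=> kn ln; case: (leqP k l) => kl.
    rewrite (le_trans (ler_norm _))// (le_trans (H _ _ _)) ?kl//.
    by rewrite /dist (eqP kl).
  rewrite ipC (le_trans (ler_norm _))// (le_trans (H l k _)) ?(ltnW kl) ?kn//.
  by rewrite /dist (eqP (ltnW kl)) addn0 addrC.
apply: (@le_trans _ _ (\sum_(k < n) \sum_(l < n) r ^+ dist k l * (c k + c l))).
  by apply: ler_sum => k _; rewrite ip_sumr ler_sum// => l _; exact: H.
have -> : \sum_(k < n) \sum_(l < n) r ^+ dist k l * (c k + c l) =
    2 * \sum_(k < n) c k * \sum_(l < n) r ^+ dist k l.
  rewrite (_ : 2 * _ = \sum_(k < n) \sum_(l < n) c k * r ^+ dist k l +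
    \sum_(k < n) \sum_(l < n) c l * r ^+ dist k l); last first.
    rewrite [X in _ = _ + X]exchange_big/= mulr_natl mulr2n.
    congr (_ + _); apply: eq_bigr => k _; rewrite mulr_sumr//.
    by apply: eq_bigr => l _; rewrite /dist addnC.
  rewrite -big_split; apply: eq_bigr => k _ /=.
  by rewrite -big_split; apply: eq_bigr => l _ /=; rewrite mulrDr !(mulrC (r ^+ _)).
have -> : 4 / (1 - r) * \sum_(k < n) c k = 2 * \sum_(k < n) c k * (2 / (1 - r)).
  by rewrite -mulr_suml; ring.
rewrite ler_pM2l// ler_sum// => k _.
by rewrite ler_wpM2l// two_sided_geometric_le.
Qed.

End almost_orthogonality.

Record flow (R : rcfType) (V : lmodType R) (dot : semi_inner V) := Flow {
  fl :> R -> {linear V -> V};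
  flD : forall s t u, fl (s + t) u = fl s (fl t u);
  fl0 : forall u, fl 0 u = u;
  fl_iso : forall s u w, dot (fl s u) (fl s w) = dot u w }.

(** * Dyadic differences along a group of isometries *)

Section dyadic_differences.
Context (R : rcfType) (V : lmodType R) (dot : semi_inner V) (T : flow dot).
Implicit Types u w g : V.

Lemma flC s t u : T s (T t u) = T t (T s u).
Proof. by rewrite -!flD addrC. Qed.

Lemma fl_adj s u w : dot (T s u) w = dot u (T (- s) w).
Proof. by rewrite -[w in LHS](fl0 T) -(subrr s) flD fl_iso. Qed.

Lemma nrm_fl s u : nrm dot (T s u) = nrm dot u.
Proof. by rewrite /nrm fl_iso. Qed.

Definition hs (k : nat) : R := 2 ^- k.

Lemma hsS k : hs k = hs k.+1 + hs k.+1.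
Proof. by rewrite /hs exprS; field; rewrite expf_neq0// pnatr_eq0. Qed.

Definition dl k u := T (hs k) u - u.
Definition dla k u := T (- hs k) u - u.

Lemma dlD k u w : dl k (u + w) = dl k u + dl k w.
Proof. by rewrite /dl linearD opprD addrACA. Qed.

Lemma dlZ k a u : dl k (a *: u) = a *: dl k u.
Proof. by rewrite /dl linearZ scalerBr. Qed.

Lemma dlB k u w : dl k (u - w) = dl k u - dl k w.
Proof. by rewrite dlD -scaleN1r dlZ scaleN1r. Qed.

Lemma dl_adj k u w : dot (dl k u) w = dot u (dla k w).
Proof. by rewrite /dl /dla ipBl ipBr fl_adj. Qed.

Lemma fl_dl s k u : T s (dl k u) = dl k (T s u).
Proof. by rewrite /dl linearB/= flC. Qed.

Lemma fl_dla s k u : T s (dla k u) = dla k (T s u).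
Proof. by rewrite /dla linearB/= flC. Qed.

Lemma dlaB k u w : dla k (u - w) = dla k u - dla k w.
Proof. by rewrite /dla linearB !opprD addrACA. Qed.

Lemma dlC k l u : dl k (dl l u) = dl l (dl k u).
Proof.
transitivity (dl l (T (hs k) u) - dl l u); first by rewrite -fl_dl.
by rewrite -dlB.
Qed.

Lemma dl_dlaC k l u : dl k (dla l u) = dla l (dl k u).
Proof. by rewrite [LHS]/dl fl_dla -dlaB. Qed.

(** T_2h - 1 = (1 + T_h)(T_h - 1): both ways of passing between scales, averaging and telescoping,
    rest on this factorisation. *)
Lemma dl_half k u : dl k u = dl k.+1 u + T (hs k.+1) (dl k.+1 u).
Proof. by rewrite /dl linearB/= -flD -hsS [RHS]addrC addrA subrK. Qed.

Lemma nrm_dl_le k u : nrm dot (dl k u) <= 2 * nrm dot u.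
Proof. by rewrite (le_trans (ler_nrmB _ _ _))// nrm_fl mulr_natl mulr2n. Qed.

Lemma nrm_dla k u : nrm dot (dla k u) = nrm dot (dl k u).
Proof.
by rewrite -[RHS](nrm_fl (- hs k)) /dl linearB/= -flD addNr fl0 -nrmN opprB.
Qed.

End dyadic_differences.

(** * Dyadic averages and square functions *)

Section dyadic_averages.
Context (R : rcfType).

(* avg n j averages over the 2^j translates by multiples of 2^-n, that is over
   the dyadic interval of length 2^-(n-j). *)
Fixpoint avg (V : lmodType R) (T : R -> {linear V -> V}) n j u : V :=
  if j is j'.+1 then
    2^-1 *: (avg T n j' u + T (hs R (n - j')) (avg T n j' u))
  else u.

Lemma avg_intertwine (V W : lmodType R) (T : R -> {linear V -> V})
    (S : R -> {linear W -> W}) (phi : {linear V -> W}) n j u :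
  (forall s v, phi (T s v) = S s (phi v)) ->
  phi (avg T n j u) = avg S n j (phi u).
Proof.
by move=> H; elim: j => //= j IH; rewrite linearZ/= linearD/= H IH.
Qed.

Context (V : lmodType R) (dot : semi_inner V) (T : flow dot).

Lemma fl_avg s n j u : T s (avg T n j u) = avg T n j (T s u).
Proof. by apply: avg_intertwine => t v; rewrite flC. Qed.

Lemma nrm_avg n j u : nrm dot (avg T n j u) <= nrm dot u.
Proof.
elim: j => //= j IH; rewrite nrmZ ger0_norm ?invr_ge0//.
rewrite ler_pdivrMl// (le_trans (ler_nrmD _ _ _))// nrm_fl.
by rewrite [leRHS]mulr_natl mulr2n lerD.
Qed.

Definition avga := avg (fun s => T (- s)).

Lemma fl_avga s n j u : T s (avga n j u) = avga n j (T s u).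
Proof. by apply: avg_intertwine => t v; rewrite flC. Qed.

Lemma avg_adj n j u w : dot (avg T n j u) w = dot u (avga n j w).
Proof.
elim: j u w => //= j IH u w.
by rewrite ipZl ipZr ipDl ipDr fl_adj !IH -fl_avga.
Qed.

(** By [dl_half], the outermost averaging factor (1 + T_h) / 2 meets T_h - 1 and turns it into half
    of T_2h - 1. Each of the i outermost factors is thus spent on one doubling of the step: a fine
    difference of a mean is a small multiple of a coarse difference. *)
Lemma dl_avg n k j i u : (k + j)%N = n -> (i <= j)%N ->
  dl T (k + i) (avg T n j u) = 2 ^- i *: dl T k (avg T n (j - i) u).
Proof.
elim: i k j => [|i IH] k j kj ij; first by rewrite addn0 subn0 invr1 scale1r.
case: j kj ij => // j kj ij /=.
have -> : (n - j = k.+1)%N by lia.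
rewrite subSS addnS -addSn.
rewrite dlZ dlD -fl_dl IH; [|lia|lia].
by rewrite linearZ/= -scalerDr scalerA -dl_half exprS invfM.
Qed.

Lemma avg_dl n j k u : avg T n j (dl T k u) = dl T k (avg T n j u).
Proof. by elim: j => //= j IH; rewrite IH dlZ dlD fl_dl. Qed.

Lemma avg_difference_quotient n k u : (k <= n)%N ->
  2 ^+ n *: dl T n (avg T n (n - k) u) = 2 ^+ k *: dl T k u.
Proof.
move=> kn; have := @dl_avg n k (n - k) (n - k) u (subnKC kn) (leqnn _).
rewrite subnn subnKC//= => ->; rewrite scalerA; congr (_ *: _).
by rewrite -{1}(subnKC kn) exprD mulfK// expf_neq0// pnatr_eq0.
Qed.

(* The square functions of order 2/3 and 1/3 in x; q stands for 2^(1/3). *)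
Definition sqf (q : R) (m n : nat) u : R :=
  Num.sqrt (\sum_(k < n) q ^+ (m * k) * nrm dot (dl T k u) ^+ 2).

Lemma sqf_ge0 q m n u : 0 <= sqf q m n u.
Proof. exact: sqrtr_ge0. Qed.

Section bounds.
Variable q : R.
Hypotheses (q1 : 1 < q) (q3 : q ^+ 3 = 2).

Let q0 : 0 < q. Proof. exact: lt_trans q1. Qed.

Let r01 : 0 <= q ^- 2 < 1.
Proof.
by rewrite invr_ge0 exprn_ge0 ?ltW//= invf_lt1 ?exprn_gt0// exprn_egt1.
Qed.

Let qX_ge0 (m : nat) : 0 <= q ^+ m. Proof. by rewrite exprn_ge0// ltW. Qed.

Let expqV (m : nat) : q ^- 2 ^+ m * q ^+ (2 * m) = 1 :> R.
Proof. by rewrite exprM -exprMn mulVf ?expr1n// expf_neq0// gt_eqF. Qed.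

(** All differences are moved onto u. For k <= l, the two fine differences are split between the two
    sides and each coarse one costs a factor 2, so the pairing of [y k] and [y l] is at most q^(2k +
    2l) times 4 times the squared norm of [dl T l u], which is q^(-2(l - k)) times the l-th term of
    the square function of order 4. *)
Lemma sum_dl_dl_le n f u :
  \sum_(k < n) q ^+ (2 * k) * dot (dl T k f) (dl T k u) <=
  nrm dot f * (Num.sqrt (16 / (1 - q ^- 2)) * sqf q 4 n u).
Proof.
pose y k := q ^+ (2 * k) *: dla T k (dl T k u).
have -> : \sum_(k < n) q ^+ (2 * k) * dot (dl T k f) (dl T k u) =
    dot f (\sum_(k < n) y k).
  by rewrite ip_sumr; apply: eq_bigr => k _; rewrite ipZr dl_adj.
rewrite (le_trans (ip_le _ _ _))// ler_wpM2l ?nrm_ge0//.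
rewrite /sqf -sqrtrM; last by rewrite divr_ge0// subr_ge0 ltW//; case/andP: r01.
have -> : 16 / (1 - q ^- 2) * \sum_(k < n) q ^+ (4 * k) * nrm dot (dl T k u) ^+ 2 =
    4 / (1 - q ^- 2) * \sum_(k < n) 4 * (q ^+ (4 * k) * nrm dot (dl T k u) ^+ 2).
  by rewrite -mulr_sumr; ring.
pose b k := 4 * (q ^+ (4 * k) * nrm dot (dl T k u) ^+ 2).
have b0 k : 0 <= b k by rewrite mulr_ge0// mulr_ge0 ?sqr_ge0 ?qX_ge0.
apply: (@almost_orthogonal _ _ dot n y b (q ^- 2)) => // k l /andP[kl _].
rewrite (@le_trans _ _ (q ^- 2 ^+ (l - k) * b l))//; last first.
  by rewrite ler_wpM2l ?lerDr// exprn_ge0//; case/andP: r01.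
rewrite -(subnKC kl); set m := (l - k)%N; rewrite addKn.
rewrite /y ipZl ipZr mulrA normrM -exprD ger0_norm ?qX_ge0//.
have -> : q ^- 2 ^+ m * b (k + m)%N =
    q ^+ (2 * k + 2 * (k + m)) * (4 * nrm dot (dl T (k + m) u) ^+ 2).
  have -> : b (k + m)%N = q ^+ (2 * m) *
      (q ^+ (2 * k + 2 * (k + m)) * (4 * nrm dot (dl T (k + m) u) ^+ 2)).
    by rewrite [RHS]mulrA -exprD /b mulrCA; congr (q ^+ _ * _); lia.
  by rewrite [LHS]mulrA expqV mul1r.
rewrite ler_wpM2l ?qX_ge0//.
rewrite -dl_adj dl_dlaC (dlC T (k + m)) (le_trans (cauchy_schwarz _ _ _))//.
rewrite expr2 mulrA ler_wpM2r ?nrm_ge0// nrm_dla.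
rewrite (le_trans (nrm_dl_le _ _ _))//.
rewrite (_ : 4 = 2 * 2) -?mulrA ?ler_pM2l ?nrm_dl_le//; lra.
Qed.

Lemma avgD n j u w : avg T n j (u + w) = avg T n j u + avg T n j w.
Proof. by elim: j => //= j ->; rewrite [T _ _]linearD -scalerDr addrACA. Qed.

Lemma avgZ n j a u : avg T n j (a *: u) = a *: avg T n j u.
Proof.
by elim: j => //= j ->; rewrite [T _ _]linearZ -scalerDr !scalerA mulrC.
Qed.

Lemma avg_avgaC n j m i u : avg T n j (avga m i u) = avga m i (avg T n j u).
Proof. by elim: i => //= i IH; rewrite avgZ avgD -fl_avg IH. Qed.

(** Here the decay comes from the averages. For k <= l = k + m, the mean over length 2^-k reduces
    the difference at scale l to 2^-m times one at scale k ([dl_avg]); with the weight q^(k + l) and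
    2^-m = q^(-3m), what remains is q^(-2m) times the k-th term of the square function. *)
Lemma sum_avg_dl_le n g w :
  \sum_(k < n.+1) q ^+ k * dot (avg T n (n - k) g) (dl T k w) <=
  nrm dot g * (Num.sqrt (4 / (1 - q ^- 2)) * sqf q 2 n.+1 w).
Proof.
pose y k := q ^+ k *: avga n (n - k) (dl T k w).
have -> : \sum_(k < n.+1) q ^+ k * dot (avg T n (n - k) g) (dl T k w) =
    dot g (\sum_(k < n.+1) y k).
  by rewrite ip_sumr; apply: eq_bigr => k _; rewrite ipZr avg_adj.
rewrite (le_trans (ip_le _ _ _))// ler_wpM2l ?nrm_ge0//.
rewrite /sqf -sqrtrM; last by rewrite divr_ge0// subr_ge0 ltW//; case/andP: r01.
pose b k := q ^+ (2 * k) * nrm dot (dl T k w) ^+ 2.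
have b0 k : 0 <= b k by rewrite mulr_ge0 ?sqr_ge0 ?qX_ge0.
apply: (@almost_orthogonal _ _ dot n.+1 y b (q ^- 2)) => // k l /andP[kl ln].
rewrite (@le_trans _ _ (q ^- 2 ^+ (l - k) * b k))//; last first.
  by rewrite ler_wpM2l ?lerDl// exprn_ge0//; case/andP: r01.
rewrite -(subnKC kl); set m := (l - k)%N; rewrite addKn.
rewrite /y ipZl ipZr mulrA normrM -exprD ger0_norm ?qX_ge0//.
have -> : q ^- 2 ^+ m * b k = q ^+ (k + (k + m)) * (2 ^- m * nrm dot (dl T k w) ^+ 2).
  have -> : 2 ^- m = q ^- 2 ^+ m * q ^- m :> R.
    by rewrite -q3 -exprM -!exprVn -exprM -exprD; congr (_ ^+ _); lia.
  rewrite /b (_ : k + (k + m) = 2 * k + m)%N; last by lia.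
  rewrite exprD; field; rewrite !expf_neq0 ?gt_eqF//.
rewrite ler_wpM2l ?qX_ge0//.
have kmn : (k + m <= n)%N by rewrite subnKC.
rewrite -avg_adj avg_avgaC ipC -avg_adj !avg_dl (@dl_avg n k (n - k) m) ?ipZl;
  [|lia|lia].
rewrite -subnDA normrM ger0_norm ?invr_ge0 ?exprn_ge0// ler_wpM2l ?invr_ge0 ?exprn_ge0//.
rewrite (le_trans (cauchy_schwarz _ _ _))// -avg_dl -expr2.
by rewrite lerXn2r ?nnegrE ?nrm_ge0 ?nrm_avg.
Qed.

(** By [dl_half], passing from scale n to n + 1 changes the difference quotient by - 2^n times the
    second difference at scale n + 1, one factor of which moves onto w. The telescoping starts from
    0 because u has period 1. The weight 2^k = q^(2k) q^k is then shared between u and w by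
    Cauchy-Schwarz. *)
Lemma dl_telescope n u w : T 1 u = u ->
  `|dot (2 ^+ n *: dl T n u) w| <= 2^-1 * (sqf q 4 n.+1 u * sqf q 2 n.+1 w).
Proof.
move=> T1; have dl0 : dl T 0 u = 0 by rewrite /dl /hs expr0 invr1 T1 subrr.
suff H : `|dot (2 ^+ n *: dl T n u) w| <=
    2^-1 * \sum_(k < n.+1) 2 ^+ k * (nrm dot (dl T k u) * nrm dot (dl T k w)).
  rewrite (le_trans H)// ler_pM2l ?invr_gt0//.
  pose a (k : 'I_n.+1) := q ^+ (2 * k) * nrm dot (dl T k u).
  pose b (k : 'I_n.+1) := q ^+ k * nrm dot (dl T k w).
  have := sum_cauchy_schwarz a b; rewrite /sqf.
  have -> : \sum_(k < n.+1) a k * b k =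
    \sum_(k < n.+1) 2 ^+ k * (nrm dot (dl T k u) * nrm dot (dl T k w)).
    apply: eq_bigr => k _; rewrite /a /b mulrACA -exprD -q3 -exprM.
    by congr (q ^+ _ * _); lia.
  move/le_trans; apply; rewrite le_eqVlt; apply/orP; left; apply/eqP.
  congr (Num.sqrt _ * Num.sqrt _); apply: eq_bigr => k _.
    by rewrite exprMn -exprM; congr (q ^+ _ * _); lia.
  by rewrite exprMn -exprM; congr (q ^+ _ * _); lia.
elim: n => [|n IH].
  by rewrite dl0 scaler0 ip0l normr0 mulr_ge0 ?invr_ge0// sumr_ge0// => k _;
    rewrite !mulr_ge0 ?nrm_ge0 ?exprn_ge0.
rewrite big_ord_recr/= mulrDr.
have -> : 2 ^+ n.+1 *: dl T n.+1 u =
    2 ^+ n *: dl T n u - 2 ^+ n *: dl T n.+1 (dl T n.+1 u).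
  rewrite -scalerBr (dl_half T n u) [dl T n.+1 (dl T n.+1 u)]/dl opprB.
  by rewrite addrACA subrr addr0 -mulr2n -scaler_nat scalerA exprSr.
rewrite ipBl (le_trans (ler_normB _ _))// lerD//.
rewrite ipZl normrM ger0_norm ?exprn_ge0// [leRHS]mulrA exprS mulKf ?pnatr_eq0//.
rewrite ler_wpM2l ?exprn_ge0//.
by rewrite dl_adj -(nrm_dla T n.+1 w) cauchy_schwarz.
Qed.

End bounds.
End dyadic_averages.

(** * The abstract kinetic estimate *)

Ltac nonneg := repeat first [assumption | by [] | (apply: ltW; assumption)
  | apply: sqr_ge0 | apply: exprn_ge0 | apply: mulr_ge0 | apply: addr_ge0
  | rewrite invr_ge0 | lra].

Section pullback.
Context (R : rcfType) (S V : lmodType R) (dot : semi_inner V) (f : {linear S -> V}).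

Let pdot u w := dot (f u) (f w).

Let pdotC u w : pdot u w = pdot w u. Proof. exact: ipC. Qed.

Let pdotDl u v w : pdot (u + v) w = pdot u w + pdot v w.
Proof. by rewrite /pdot linearD ipDl. Qed.

Let pdotZl a u w : pdot (a *: u) w = a * pdot u w.
Proof. by rewrite /pdot linearZ ipZl. Qed.

Let pdot_ge0 u : 0 <= pdot u u. Proof. exact: ip_ge0. Qed.

Definition pullback : semi_inner S := SemiInner pdotC pdotDl pdotZl pdot_ge0.

End pullback.

Arguments pullback : simpl never.

(** * Numerical inequalities that absorb the cross terms *)

Section closing.
Context (R : rcfType).

(** The first bound inserted in the square of the second gives a^4 <= c N^2 K (a + N). This forces a
    <= c N, hence e^2 <= c K N and a^4 <= c K N^3. The lone K^2 is the room kept for the errors of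
    the limit. *)
Lemma interpolation_bound (L K N a e : R) : 1 <= L -> 0 < K <= N ->
  0 <= a -> 0 <= e -> e ^+ 2 <= L * (K * (a + N)) ->
  a ^+ 2 <= L * (N * e) + K ^+ 2 ->
  (a * e) ^+ 4 <= 108 * L ^+ 8 * (K ^+ 3 * N ^+ 5).
Proof.
move=> L1 /andP[K0 KN] a0 e0 he ha.
have N0 : 0 < N by exact: lt_le_trans KN.
have L0 : 0 < L by lra.
have a4 : a ^+ 4 <= 4 * L ^+ 3 * N ^+ 2 * K * (a + N).
  have h1 : a ^+ 4 <= (L * (N * e) + K ^+ 2) ^+ 2.
    have -> : a ^+ 4 = (a ^+ 2) ^+ 2 by ring.
    by rewrite lerXn2r ?nnegrE ?sqr_ge0// (le_trans _ ha)// sqr_ge0.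
  have h2 : (L * (N * e) + K ^+ 2) ^+ 2 <= 2 * L ^+ 2 * N ^+ 2 * e ^+ 2 + 2 * K ^+ 4.
    by rewrite -subr_ge0 (_ : _ - _ = (L * (N * e) - K ^+ 2) ^+ 2) ?sqr_ge0//; ring.
  have h3 : 2 * L ^+ 2 * N ^+ 2 * e ^+ 2 <= 2 * L ^+ 3 * N ^+ 2 * K * (a + N).
    have -> : 2 * L ^+ 3 * N ^+ 2 * K * (a + N) = 2 * L ^+ 2 * N ^+ 2 * (L * (K * (a + N))) by ring.
    by apply: ler_wpM2l => //; nonneg.
  have h4 : 2 * K ^+ 4 <= 2 * L ^+ 3 * N ^+ 2 * K * (a + N).
    have -> : 2 * K ^+ 4 = 2 * 1 * K ^+ 2 * K * K by ring.
    apply: ler_pM; [nonneg|nonneg| |lra].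
    apply: ler_wpM2r; first nonneg.
    apply: ler_pM; [nonneg|nonneg| |by rewrite lerXn2r ?nnegrE// ltW].
    by rewrite ler_pM2l// exprn_ege1.
  by lra.
(* If a > 2 L N then N < a / 2, and a^3 <= 6 L^3 N^3 contradicts a^3 >= 8 L^3 N^3. *)
have a2 : a <= 2 * L * N.
  rewrite leNgt; apply/negP => la.
  have ap : 0 < a by apply: le_lt_trans la; nonneg.
  have h : a ^+ 3 <= 6 * L ^+ 3 * N ^+ 2 * K.
    rewrite -(ler_pM2r ap) -exprSr (le_trans a4)//.
    rewrite (_ : 6 * _ * _ * _ * a = 4 * L ^+ 3 * N ^+ 2 * K * (a + a / 2)); last by field.
    apply: ler_wpM2l; first nonneg.
    by rewrite lerD2l; nra.
  have h2 : 6 * L ^+ 3 * N ^+ 2 * K <= 6 * L ^+ 3 * N ^+ 3.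
    by rewrite (exprSr N 2) mulrA; apply: ler_wpM2l => //; nonneg.
  have h3 : (2 * L * N) ^+ 3 <= a ^+ 3.
    by apply: lerXn2r; rewrite ?nnegrE; [nonneg|nonneg|exact: ltW].
  have h4 : 0 < L ^+ 3 * N ^+ 3 by rewrite mulr_gt0// exprn_gt0.
  have h5 : (2 * L * N) ^+ 3 = 8 * (L ^+ 3 * N ^+ 3) by ring.
  by lra.
have e2 : e ^+ 2 <= 3 * L ^+ 2 * K * N.
  rewrite (le_trans he)// (_ : 3 * _ * _ * _ = L * (K * (2 * L * N + L * N))); last by ring.
  by rewrite !ler_pM2l// lerD// ler_pMl.
have a4' : a ^+ 4 <= 12 * L ^+ 4 * K * N ^+ 3.
  rewrite (le_trans a4)// (_ : 12 * _ * _ * _ = 4 * L ^+ 3 * N ^+ 2 * K * (2 * L * N + L * N)); last by ring.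
  apply: ler_wpM2l; first nonneg.
  by rewrite lerD// ler_pMl.
rewrite exprMn (_ : 108 * _ * _ = 12 * L ^+ 4 * K * N ^+ 3 * (3 * L ^+ 2 * K * N) ^+ 2); last by ring.
apply: ler_pM; [nonneg|nonneg|exact: a4'|].
have -> : e ^+ 4 = (e ^+ 2) ^+ 2 by ring.
rewrite lerXn2r ?nnegrE ?sqr_ge0//.
by rewrite (le_trans _ e2)// sqr_ge0.
Qed.

(** Young's inequality for K^(3/4) N^(5/4) without roots: either N <= L K and the whole is a
    multiple of K^2, or N > L K and the choice L = P / eta^4 gives P K^3 <= eta^4 N^3. *)
Lemma young_bound (P K N p eta : R) : 1 <= P -> 0 < K <= N -> 0 < eta <= 1 -> 0 <= p ->
  p ^+ 4 <= P * (K ^+ 3 * N ^+ 5) ->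
  p <= eta * N ^+ 2 + P * (P / eta ^+ 4) ^+ 5 * K ^+ 2.
Proof.
move=> P1 /andP[K0 KN] /andP[eta0 eta1] p0 hp; set L := P / eta ^+ 4.
have N0 : 0 < N by exact: lt_le_trans KN.
have e4 : 0 < eta ^+ 4 by rewrite exprn_gt0.
have P0 : 0 < P by lra.
have L1 : 1 <= L.
  rewrite ler_pdivlMr// mul1r (le_trans _ P1)//.
  by apply: exprn_ile1 => //; exact: ltW.
have L0 : 0 < L by exact: lt_le_trans L1.
have PE : P = eta ^+ 4 * L by rewrite /L mulrC divfK// gt_eqF.
clearbody L.
have [NL|NL] := leP N (L * K).
  rewrite (@le_trans _ _ (P * L ^+ 5 * K ^+ 2))//; last first.
    by rewrite lerDr; nonneg.
  rewrite -(@ler_pXn2r _ 4) ?nnegrE//; last by nonneg.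
  rewrite (le_trans hp)//.
  rewrite (@le_trans _ _ (P * L ^+ 5 * K ^+ 8))//.
    rewrite (_ : P * L ^+ 5 * K ^+ 8 = P * (K ^+ 3 * (L * K) ^+ 5)); last by ring.
    apply: ler_wpM2l; first nonneg.
    apply: ler_wpM2l; first nonneg.
    by apply: lerXn2r; rewrite ?nnegrE; nonneg.
  rewrite exprMn -exprM ler_wpM2r ?exprn_ge0 ?(ltW K0)//.
  have h : 1 <= P * L ^+ 5 by rewrite mulr_ege1// exprn_ege1.
  by rewrite ler_eXnr.
rewrite (@le_trans _ _ (eta * N ^+ 2))//; last first.
  by rewrite lerDl; nonneg.
rewrite -(@ler_pXn2r _ 4) ?nnegrE//; last by nonneg.
rewrite (le_trans hp)// exprMn -exprM.
have h : P * K ^+ 3 <= eta ^+ 4 * N ^+ 3.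
  rewrite PE -mulrA ler_pM2l// (@le_trans _ _ ((L * K) ^+ 3))//.
    rewrite exprMn ler_wpM2r ?exprn_ge0 ?(ltW K0)//.
    by rewrite ler_eXnr.
  by apply: lerXn2r; rewrite ?nnegrE; nonneg.
have -> : eta ^+ 4 * N ^+ (2 * 4) = eta ^+ 4 * N ^+ 3 * N ^+ 5 by ring.
by rewrite mulrA; apply: ler_wpM2r => //; nonneg.
Qed.

Lemma closing_bound (d : nat) (L : R) : 1 <= L ->
  exists2 C, 0 < C & forall (h K : R) (a e : 'I_d -> R), 0 <= h -> 0 < K ->
    (forall i, [/\ 0 <= a i, 0 <= e i,
       e i ^+ 2 <= L * (K * (a i + (h + K))) &
       a i ^+ 2 <= L * ((h + K) * e i) + K ^+ 2]) ->
    h ^+ 2 <= (1 + 2 * d%:R) * K ^+ 2 + \sum_i a i * e i ->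
    h + K <= C * K.
Proof.
move=> L1; have d0 : 0 <= d%:R :> R by [].
(* [P] is the constant of [interpolation_bound]; with this [eta] the d absorbed terms cost at most
   N^2 / 4 together. *)
pose P : R := 108 * L ^+ 8; pose eta : R := (4 * (d%:R + 1))^-1.
have P1 : 1 <= P by rewrite /P mulr_ege1 ?ler1n// exprn_ege1.
have eta1 : 0 < eta <= 1 by rewrite invr_gt0 invf_le1; nra.
have de : d%:R * eta <= 4^-1.
  have : eta * (4 * (d%:R + 1)) = 1 by rewrite mulVf// gt_eqF//; lra.
  by case/andP: eta1 => e0 _; clearbody eta; lra.
pose Q := P * (P / eta ^+ 4) ^+ 5.
have Q0 : 0 <= Q.
  rewrite /Q; move: P1 eta1 => P1 /andP[e0 _].
  have P0 : 0 <= P by lra.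
  by apply: mulr_ge0 => //; apply: exprn_ge0; apply: divr_ge0 => //; rewrite exprn_ge0// ltW.
(* N^2 <= 2 h^2 + 2 K^2 and the bound on h^2 leave N^2 / 2 <= (4 + 4 d + 2 d Q) K^2 after
   absorption. *)
pose C := 8 + 8 * d%:R + 4 * d%:R * Q.
have C1 : 1 <= C by rewrite /C; have := mulr_ge0 d0 Q0; lra.
exists C; first by lra.
move=> h K a e h0 K0 H hE; set N := h + K.
have KN : 0 < K <= N by rewrite K0/= lerDr.
have pN i : a i * e i <= eta * N ^+ 2 + Q * K ^+ 2.
  have [a0 e0 he ha] := H i.
  apply: young_bound => //; first exact: mulr_ge0.
  exact: interpolation_bound.
have sN : \sum_i a i * e i <= d%:R * (eta * N ^+ 2 + Q * K ^+ 2).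
  apply: (@le_trans _ _ (\sum_(i < d) (eta * N ^+ 2 + Q * K ^+ 2))); first exact: ler_sum.
  by rewrite sumr_const card_ord mulr_natl.
have N2 : 0 <= N ^+ 2 by rewrite sqr_ge0.
have deN : d%:R * eta * N ^+ 2 <= 4^-1 * N ^+ 2 by rewrite ler_wpM2r.
have hN : N ^+ 2 <= 2 * h ^+ 2 + 2 * K ^+ 2.
  by rewrite -subr_ge0 (_ : _ - _ = (h - K) ^+ 2) ?sqr_ge0// /N; ring.
have NC : N ^+ 2 <= C * K ^+ 2 by rewrite /C; clearbody N Q eta; nra.
rewrite -(@ler_pXn2r _ 2) ?nnegrE//; [|lra|by apply: mulr_ge0; lra].
rewrite (le_trans NC)// exprMn ler_wpM2r ?sqr_ge0//.
by rewrite ler_eXnr.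
Qed.

End closing.

(** One factor d for each index of the products M_i D_j u, and (d + 2) N for the norm of each
    product. *)
Definition rotation_cst (R : rcfType) (d : nat) : R := d%:R * (d%:R * (d%:R + 2)).

(** The sum of the constants of [sqf_D_bound] and [sqf_bound], so that one number at least 1 serves
    in both. *)
Definition direction_cst (R : rcfType) (d : nat) (B0 q : R) : R :=
  1 + Num.sqrt (16 / (1 - q ^- 2)) + 2 * B0 * rotation_cst R d / (1 - q^-1) +
  2 * (2 + B0 * rotation_cst R d) * Num.sqrt (4 / (1 - q ^- 2)).

Lemma eq_oppr0 (R : numDomainType) (x : R) : x = - x -> x = 0.
Proof. by move/eqP; rewrite -addr_eq0 -mulr2n mulrn_eq0/= => /eqP. Qed.

(** * The kinetic estimate from commutation relations *)

Section kinetic.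
Context (R : rcfType) (d : nat) (S V : lmodType R) (dot : semi_inner V).
Context (dotS : semi_inner S) (inj : {linear S -> V}).

Hypothesis dotSE : forall u w, dotS u w = dot (inj u) (inj w).
Variables X D M : 'I_d -> {linear S -> S}.
Variables (T : 'I_d -> flow dot) (TS : 'I_d -> flow dotS).
Variable b : 'I_d -> 'I_d -> {linear V -> V}.
Variable B0 : R.

Hypothesis inj_fl : forall i s u, inj (TS i s u) = T i s (inj u).
Hypothesis DM : forall i j u, D i (M j u) = M j (D i u) + (i == j)%:R *: u.
Hypothesis MMC : forall i j u, M i (M j u) = M j (M i u).
Hypothesis DDC : forall i j u, D i (D j u) = D j (D i u).
Hypothesis DXC : forall i j u, D i (X j u) = X j (D i u).
Hypothesis XMC : forall i j u, X i (M j u) = M j (X i u).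
Hypothesis D_adj : forall i u w, dotS (D i u) w = - dotS u (D i w).
Hypothesis X_adj : forall i u w, dotS (X i u) w = - dotS u (X i w).
Hypothesis M_adj : forall i u w, dotS (M i u) w = dotS u (M i w).
Hypothesis TD : forall i s j u, TS i s (D j u) = D j (TS i s u).
Hypothesis TX : forall i s j u, TS i s (X j u) = X j (TS i s u).
Hypothesis TM : forall i s j u, TS i s (M j u) = M j (TS i s u).
Hypothesis b_anti : forall i j f, b j i f = - b i j f.
Hypothesis b_adj : forall i j f g, dot (b i j f) g = dot f (b i j g).
Hypothesis bD : forall i j k u w,
  dot (b i j (inj (D k u))) (inj w) = - dot (b i j (inj u)) (inj (D k w)).
Hypothesis bM : forall i j k u w,
  dot (b i j (inj (M k u))) (inj w) = dot (b i j (inj u)) (inj (M k w)).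
Hypothesis B0_ge0 : 0 <= B0.
Hypothesis b_bd : forall i j f, nrm dot (b i j f) <= B0 * nrm dot f.
Hypothesis b_lip : forall k s i j f, 0 <= s <= 1 ->
  nrm dot (T k s (b i j f) - b i j (T k s f)) <= B0 * s * nrm dot f.
Hypothesis T_per : forall i u, T i 1 u = u.
Hypothesis X_quot : forall i u, exists c, forall n,
  nrm dotS (2 ^+ n *: dl (TS i) n u - X i u) <= c * 2 ^- n.

Implicit Types u w : S.

Definition free_transport u : S := \sum_i M i (X i u).
Definition rotation u : V := \sum_i \sum_j b i j (inj (M i (D j u))).
Definition oscillator u : S :=
  - (\sum_i D i (D i u)) + 4^-1 *: \sum_i M i (M i u).
(** The f of the overview: the shift - d / 2 is left out, so that the remaining oscillator is
    nonnegative by [dot_oscillator]. It is restored in [real_fp]. *)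
Definition kinetic u : V :=
  inj (free_transport u) - rotation u + inj (oscillator u).

Local Notation Xo := free_transport.
Local Notation W := rotation.
Local Notation H := oscillator.
Local Notation nS := (nrm dotS).

Lemma nrmSE u : nS u = nrm dot (inj u).
Proof. by rewrite /nrm dotSE. Qed.

Lemma dot_free_transport u : dotS (Xo u) u = 0.
Proof.
rewrite ip_suml big1// => i _; apply: eq_oppr0.
by rewrite {1}M_adj X_adj XMC ipC.
Qed.

Lemma b_diag i f : b i i f = 0.
Proof.
have /eqP := b_anti i i f; rewrite -addr_eq0 -mulr2n -scaler_nat scaler_eq0.
by rewrite pnatr_eq0/= => /eqP.
Qed.

(** Carrying [M i] and [D j] across the product creates the commutator term only for i = j, where
    [b i i] vanishes by antisymmetry: the rotation is divergence free in v. *)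
Lemma dot_b_rot i j u w :
  dot (b i j (inj (M i (D j u)))) (inj w) =
  - dot (b i j (inj u)) (inj (M i (D j w))).
Proof.
rewrite bM bD DM; have [<-|ij] := eqVneq j i.
  by rewrite !b_diag !ip0l oppr0.
by rewrite scale0r addr0.
Qed.

Lemma dot_rotationE u w : dot (W u) (inj w) =
  \sum_i \sum_j dot (b i j (inj (M i (D j u)))) (inj w).
Proof. by rewrite ip_suml; apply: eq_bigr => i _; rewrite ip_suml. Qed.

Lemma sum_delta (k : 'I_d) (F : 'I_d -> R) : \sum_i (i == k)%:R * F i = F k.
Proof.
rewrite (bigD1 k)//= eqxx mul1r big1 ?addr0// => i /negPf ->.
by rewrite mul0r.
Qed.

Lemma dot_rotation u : dot (W u) (inj u) = 0.
Proof.
rewrite ip_suml big1// => i _; rewrite ip_suml big1// => j _.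
by apply: eq_oppr0; rewrite {1}dot_b_rot b_adj ipC.
Qed.

Lemma dot_oscillator u :
  dotS (H u) u = \sum_i nS (D i u) ^+ 2 + 4^-1 * \sum_i nS (M i u) ^+ 2.
Proof.
rewrite /oscillator ipDl ipNl ipZl !ip_suml -sumrN; congr (_ + _ * _).
  by apply: eq_bigr => i _; rewrite D_adj opprK sqr_nrm.
by apply: eq_bigr => i _; rewrite M_adj sqr_nrm.
Qed.

(** Expansion of the square of - P + Q / 4. The mixed term - (P, Q) / 2 is half the sum of the
    squares of M_j D_i u, up to the commutators of D with M, which add up to the multiple of the
    norm of u on the right. *)
Lemma second_order_identity u :
  \sum_i \sum_j nS (D i (D j u)) ^+ 2 +
  16^-1 * \sum_i \sum_j nS (M i (M j u)) ^+ 2 +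
  2^-1 * \sum_i \sum_j nS (M j (D i u)) ^+ 2 =
  nS (H u) ^+ 2 + d%:R / 2 * nS u ^+ 2.
Proof.
set P := \sum_i D i (D i u); set Q := \sum_i M i (M i u).
have PP : dotS P P = \sum_i \sum_j nS (D i (D j u)) ^+ 2.
  rewrite ip_suml; apply: eq_bigr => i _; rewrite ip_sumr; apply: eq_bigr => j _.
  by rewrite D_adj (DDC i j (D j u)) -D_adj (DDC j i) sqr_nrm.
have QQ : dotS Q Q = \sum_i \sum_j nS (M i (M j u)) ^+ 2.
  rewrite ip_suml; apply: eq_bigr => i _; rewrite ip_sumr; apply: eq_bigr => j _.
  by rewrite M_adj (MMC i j (M j u)) -M_adj (MMC j i) sqr_nrm.
have PQ : dotS P Q = - \sum_i \sum_j nS (M j (D i u)) ^+ 2 + d%:R * nS u ^+ 2.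
  rewrite ip_suml (_ : _ * _ = \sum_(i < d) nS u ^+ 2); last first.
    by rewrite sumr_const card_ord mulr_natl.
  rewrite -sumrN -big_split; apply: eq_bigr => i _ /=.
  rewrite D_adj /Q linear_sum/= ip_sumr.
  rewrite (eq_bigr (fun j => nS (M j (D i u)) ^+ 2 +
     (i == j)%:R * (2 * dotS (D i u) (M j u)))); last first.
    move=> j _; rewrite DM DM linearD/= linearZ/= -addrA -scalerDl.
    by rewrite ipDr -M_adj sqr_nrm ipZr; ring.
  rewrite big_split/= [X in _ + X](bigD1 i)//= eqxx mul1r [X in _ + (_ + X)]big1 => [|j ji]; last first.
    by rewrite eq_sym (negPf ji) mul0r.
  (* Skewness of [D i] together with [D_i, M_i] = 1 gives 2 (D_i u, M_i u) = - |u|^2. *)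
  have := D_adj i u (M i u); rewrite DM eqxx scale1r ipDr -(M_adj i u (D i u)).
  by rewrite (ipC _ (M i u)) (sqr_nrm _ u); lra.
rewrite [in RHS]sqr_nrm /oscillator -/P -/Q ipDl !ipDr !ipNl !ipNr !ipZl !ipZr.
by rewrite (ipC _ Q P) PP QQ PQ; field.
Qed.

(** The hypoelliptic commutator [D_k, Xo] = X_k, from which all regularity in x is drawn. *)
Lemma D_free_transport k u : D k (Xo u) = Xo (D k u) + X k u.
Proof.
rewrite /free_transport linear_sum/=.
rewrite (eq_bigr (fun i => M i (X i (D k u)) + (k == i)%:R *: X i u)) => [|i _].
  rewrite big_split/= [X in _ + X](bigD1 k)//= eqxx scale1r.
  rewrite [X in _ + (_ + X)]big1 ?addr0// => i ik.
  by rewrite eq_sym (negPf ik) scale0r.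
by rewrite DM DXC.
Qed.

Lemma M_free_transport k u : M k (Xo u) = Xo (M k u).
Proof.
by rewrite /free_transport linear_sum/=; apply: eq_bigr => i _; rewrite XMC MMC.
Qed.

(** [Xo] is skew and commutes with every [M k], so the potential contributes nothing, while each
    [D k] leaves its commutator [X k]. These are the cross terms to be absorbed. *)
Lemma dot_free_transport_oscillator u :
  dotS (Xo u) (H u) = \sum_i dotS (X i u) (D i u).
Proof.
rewrite /oscillator ipDr ipNr ipZr !ip_sumr [X in _ * X]big1 => [|k _]; last first.
  by rewrite -M_adj M_free_transport dot_free_transport.
rewrite mulr0 addr0 -sumrN; apply: eq_bigr => k _.
by rewrite -D_adj D_free_transport ipDl dot_free_transport add0r.
Qed.

Lemma sum_antisym (F : 'I_d -> 'I_d -> R) :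
  (forall i j, F i j = - F j i) -> \sum_i \sum_j F i j = 0.
Proof.
move=> FE; apply: eq_oppr0; rewrite {1}exchange_big/= -sumrN.
by apply: eq_bigr => i _; rewrite -sumrN; apply: eq_bigr => j _.
Qed.

(** Commuting [W] with [M k] leaves pairings of [b i k (M i u)] with [M k u], and similarly for
    [D k]; both double sums vanish since b is antisymmetric. As [W u] lies only in [V], one factor
    [M k] or [D k] is carried across the product by [bM] or [bD]. *)
Lemma dot_rotation_oscillator u : dot (W u) (inj (H u)) = 0.
Proof.
have -> : inj (H u) = - (\sum_k inj (D k (D k u))) + 4^-1 *: \sum_k inj (M k (M k u)).
  by rewrite /oscillator linearD linearN linearZ/= !(linear_sum inj).
rewrite ipDr ipNr ipZr !ip_sumr.
have -> : \sum_k dot (W u) (inj (M k (M k u))) = 0.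
  rewrite -[RHS]oppr0 -[in RHS](@sum_antisym (fun k i =>
    dot (b i k (inj (M i u))) (inj (M k u)))); last first.
    by move=> i k; rewrite b_anti ipNl b_adj ipC.
  rewrite -sumrN; apply: eq_bigr => k _.
  transitivity (dot (W (M k u)) (inj (M k u)) -
    \sum_i dot (b i k (inj (M i u))) (inj (M k u))); last first.
    by rewrite dot_rotation add0r.
  rewrite !dot_rotationE -sumrB; apply: eq_bigr => i _.
  rewrite -(sum_delta k (fun j => dot (b i j (inj (M i u))) (inj (M k u)))) -sumrB.
  apply: eq_bigr => j _; rewrite -bM MMC DM linearD linearZ/= linearD linearZ/=.
  by rewrite linearD linearZ/= ipDl ipZl addrK.
have -> : \sum_k dot (W u) (inj (D k (D k u))) = 0; last by rewrite mulr0 oppr0 addr0.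
rewrite -[RHS]oppr0 -[in RHS](@sum_antisym (fun k j =>
  dot (b k j (inj (D j u))) (inj (D k u)))); last first.
  by move=> k j; rewrite b_anti ipNl b_adj ipC.
rewrite -sumrN; apply: eq_bigr => k _.
transitivity (- (dot (W (D k u)) (inj (D k u)) +
    \sum_j dot (b k j (inj (D j u))) (inj (D k u)))); last first.
  by rewrite dot_rotation add0r.
rewrite -[LHS]opprK; congr (- _).
rewrite !dot_rotationE -!sumrN.
rewrite -(sum_delta k (fun i => \sum_j dot (b i j (inj (D j u))) (inj (D k u)))).
rewrite -big_split; apply: eq_bigr => i _ /=; rewrite mulr_sumr -!sumrN -big_split.
apply: eq_bigr => j _ /=; rewrite -bD DM (DDC k j) (eq_sym i k).
by rewrite linearD linearZ/= linearD linearZ/= ipDl ipZl.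
Qed.

Lemma energy_identity u :
  nrm dot (inj (Xo u) - W u) ^+ 2 + nS (H u) ^+ 2 =
  nrm dot (kinetic u) ^+ 2 - 2 * \sum_i dotS (X i u) (D i u).
Proof.
rewrite !sqr_nrm /kinetic; set A := inj (Xo u) - W u.
have <- : dot A (inj (H u)) = \sum_i dotS (X i u) (D i u).
  by rewrite ipBl dot_rotation_oscillator -dotSE dot_free_transport_oscillator subr0.
by rewrite dotSE; clearbody A; rewrite ipDl !ipDr (ipC _ (inj (H u)) A); ring.
Qed.

Lemma inj_dl i k u : inj (dl (TS i) k u) = dl (T i) k (inj u).
Proof. by rewrite /dl linearB/= inj_fl. Qed.

Lemma hs_le1 k : 0 <= hs R k <= 1.
Proof. by rewrite invr_ge0 exprn_ge0//= invf_le1 ?exprn_gt0// exprn_ege1// ler1n. Qed.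

Lemma rotation_commutator k n u :
  nrm dot (dl (T k) n (W u) - W (dl (TS k) n u)) <=
  B0 * hs R n * \sum_i \sum_j nS (M i (D j u)).
Proof.
have -> : dl (T k) n (W u) - W (dl (TS k) n u) =
    \sum_i \sum_j (T k (hs R n) (b i j (inj (M i (D j u)))) -
                   b i j (T k (hs R n) (inj (M i (D j u))))).
  rewrite /rotation /dl linear_sum/= -!sumrB; apply: eq_bigr => i _.
  rewrite linear_sum/= -!sumrB; apply: eq_bigr => j _.
  by rewrite !linearB/= -TD -TM inj_fl opprK addrACA addNr addr0.
rewrite (le_trans (ler_nrm_sum _ _ _ _))// mulr_sumr ler_sum// => i _.
rewrite (le_trans (ler_nrm_sum _ _ _ _))// mulr_sumr ler_sum// => j _.
by rewrite nrmSE b_lip// hs_le1.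
Qed.

Lemma free_transport_dl i k u : Xo (dl (TS i) k u) = dl (TS i) k (Xo u).
Proof.
rewrite /dl /free_transport linear_sum/= -sumrB; apply: eq_bigr => j _.
by rewrite !linearB/= -TX -TM.
Qed.

Lemma free_transport_avg i n k u : Xo (avg (TS i) n k u) = avg (TS i) n k (Xo u).
Proof.
elim: k => //= k IH; rewrite -IH /free_transport linear_sum/= -big_split scaler_sumr.
by apply: eq_bigr => j _; rewrite /= linearZ/= linearZ/= 2!linearD/= -TX -TM.
Qed.

Lemma oscillator_dl i k u : H (dl (TS i) k u) = dl (TS i) k (H u).
Proof.
have HB v w : H (v - w) = H v - H w.
  rewrite /oscillator opprD addrACA -opprD -scalerBr -!sumrB; congr (- _ + _ *: _).
    by apply: eq_bigr => j _; rewrite !linearB.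
  by apply: eq_bigr => j _; rewrite !linearB.
rewrite /dl HB; congr (_ - _); rewrite /oscillator linearD linearN linearZ/= !(linear_sum (TS i (hs R k)))/=.
by congr (- _ + _ *: _); apply: eq_bigr => j _; rewrite ?TD ?TM.
Qed.

Lemma ler_sum1 (I : finType) (F : I -> R) i : (forall i, 0 <= F i) ->
  F i <= \sum_i F i.
Proof. by move=> F0; rewrite (bigD1 i)//= lerDl sumr_ge0. Qed.

Lemma sum_ord_le n (F : 'I_n -> R) c : (forall i, F i <= c) ->
  \sum_i F i <= n%:R * c.
Proof.
move=> Fc; apply: (@le_trans _ _ (\sum_(i < n) c)); first exact: ler_sum.
by rewrite sumr_const card_ord mulr_natl.
Qed.

Section estimates.
Variables (u : S) (K : R).
Hypothesis K0 : 0 < K.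
Hypothesis uK : nrm dot (kinetic u) + nS u <= K.

(** [K] stands for any positive majorant of the k of the overview: positivity leaves room [K ^+ 2]
    for the vanishing errors, even when u is 0. *)
Let N := nS (H u) + K.

Let N0 : 0 < N. Proof. by rewrite ltr_wpDl// nrm_ge0. Qed.
Let KN : K <= N. Proof. by rewrite lerDr nrm_ge0. Qed.
Let HN : nS (H u) <= N. Proof. by rewrite lerDl ltW. Qed.
Let uK' : nS u <= K. Proof. by apply: le_trans uK; rewrite lerDr nrm_ge0. Qed.
Let fK : nrm dot (kinetic u) <= K.
Proof. by apply: le_trans uK; rewrite lerDl nrm_ge0. Qed.

(** The constant is half a square because the terms M_j D_i u carry the coefficient 1/2 in
    [second_order_identity]; each then has norm at most (d + 2) N. *)
Lemma second_order_le : nS (H u) ^+ 2 + d%:R / 2 * nS u ^+ 2 <= (d%:R + 2) ^+ 2 / 2 * N ^+ 2.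
Proof.
have h1 : nS (H u) ^+ 2 <= N ^+ 2 by rewrite lerXn2r ?nnegrE ?nrm_ge0 ?(ltW N0).
have h2 : d%:R / 2 * nS u ^+ 2 <= d%:R / 2 * N ^+ 2.
  rewrite ler_wpM2l ?divr_ge0// lerXn2r ?nnegrE ?nrm_ge0 ?(ltW N0)//.
  exact: le_trans KN.
have d0 : 0 <= d%:R :> R by [].
have N2 : 0 <= N ^+ 2 by rewrite sqr_ge0.
by nra.
Qed.

Lemma nrm_MD_le i j : nS (M i (D j u)) <= (d%:R + 2) * N.
Proof.
have dN : 0 <= (d%:R + 2) * N by apply: mulr_ge0; [exact: addr_ge0|exact: ltW].
rewrite -(@ler_pXn2r _ 2) ?nnegrE ?nrm_ge0//.
have := second_order_identity u.
have h1 : nS (M i (D j u)) ^+ 2 <= \sum_i \sum_j nS (M j (D i u)) ^+ 2.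
  apply: le_trans (ler_sum1 (F := fun i => \sum_j nS (M j (D i u)) ^+ 2) j _).
    by apply: (ler_sum1 (F := fun i => nS (M i (D j u)) ^+ 2)) => k; rewrite sqr_ge0.
  by move=> k; rewrite sumr_ge0// => l _; rewrite sqr_ge0.
have h2 : 0 <= \sum_i \sum_j nS (D i (D j u)) ^+ 2.
  by rewrite sumr_ge0// => k _; rewrite sumr_ge0// => l _; rewrite sqr_ge0.
have h3 : 0 <= \sum_i \sum_j nS (M i (M j u)) ^+ 2.
  by rewrite sumr_ge0// => k _; rewrite sumr_ge0// => l _; rewrite sqr_ge0.
by have := second_order_le; rewrite exprMn; lra.
Qed.

Let c1 : R := rotation_cst R d.

Let c1_ge0 : 0 <= c1. Proof. by rewrite /c1 /rotation_cst !mulr_ge0// addr_ge0. Qed.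

Lemma sum_nrm_MD_le : \sum_i \sum_j nS (M i (D j u)) <= c1 * N.
Proof.
rewrite /c1 /rotation_cst -!mulrA; apply: sum_ord_le => i; apply: sum_ord_le => j.
exact: nrm_MD_le.
Qed.

Lemma nrm_rotation_le : nrm dot (W u) <= B0 * c1 * N.
Proof.
rewrite -mulrA; apply: le_trans (ler_wpM2l B0_ge0 sum_nrm_MD_le).
rewrite (le_trans (ler_nrm_sum _ _ _ _))// mulr_sumr ler_sum// => i _.
rewrite (le_trans (ler_nrm_sum _ _ _ _))// mulr_sumr ler_sum// => j _.
by rewrite nrmSE b_bd.
Qed.

Lemma nrm_free_transport_le : nS (Xo u) <= (2 + B0 * c1) * N.
Proof.
have -> : nS (Xo u) = nrm dot (kinetic u + W u - inj (H u)).
  by rewrite nrmSE /kinetic [X in X - _]addrAC subrK addrK.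
rewrite (le_trans (ler_nrmB _ _ _))// (le_trans (lerD (ler_nrmD _ _ _) (lexx _)))//.
by have := nrm_rotation_le; rewrite -nrmSE; move: fK HN KN; clearbody N c1; lra.
Qed.

Section direction.
Variable i : 'I_d.
Variable q : R.
Hypotheses (q1 : 1 < q) (q3 : q ^+ 3 = 2).

Local Notation A n := (sqf (T i) q 4 n (inj u)).
Local Notation E n := (sqf (T i) q 2 n (inj (D i u))).

Lemma sqr_sqf m n v : sqf (T i) q m n v ^+ 2 =
  \sum_(k < n) q ^+ (m * k) * nrm dot (dl (T i) k v) ^+ 2.
Proof.
rewrite sqr_sqrtr// sumr_ge0// => k _; rewrite mulr_ge0 ?sqr_ge0// exprn_ge0//.
by rewrite ltW// (lt_trans _ q1).
Qed.

(* The rotation commutator at scale k is of size 2^-k = q^-(3k); against the weight q^(2k) it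
   leaves the summable q^-k. *)
Lemma sqf_D_bound n : E n ^+ 2 <=
  K * (Num.sqrt (16 / (1 - q ^- 2)) * A n) + 2 * B0 * c1 / (1 - q^-1) * (N * K).
Proof.
have q0 : 0 < q by exact: lt_trans q1.
rewrite sqr_sqf.
apply: (@le_trans _ _ (\sum_(k < n) (q ^+ (2 * k) *
    dot (dl (T i) k (kinetic u)) (dl (T i) k (inj u)) + q^-1 ^+ k * (2 * B0 * c1 * (N * K))))).
  apply: ler_sum => k _; set y := dl (TS i) k u.
  have -> : q^-1 ^+ k * (2 * B0 * c1 * (N * K)) =
      q ^+ (2 * k) * (B0 * hs R k * (c1 * N) * (2 * K)).
    have -> : q^-1 ^+ k = q ^+ (2 * k) * hs R k.
      rewrite /hs -q3 -exprM -[3%N]/(2 + 1)%N mulnDl exprD mul1n invfM mulrA.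
      by rewrite mulfV ?mul1r ?exprVn// expf_neq0// gt_eqF.
    by ring.
  rewrite -mulrDr ler_wpM2l ?exprn_ge0 ?(ltW q0)//.
  rewrite -inj_dl -nrmSE.
  have -> : dl (TS i) k (D i u) = D i y by rewrite /y /dl linearB/= TD.
  have h1 : nS (D i y) ^+ 2 <= dotS (H y) y.
    rewrite dot_oscillator.
    have := ler_sum1 (F := fun j => nS (D j y) ^+ 2) i (fun j => sqr_ge0 _).
    have : 0 <= \sum_j nS (M j y) ^+ 2 by rewrite sumr_ge0// => j _; rewrite sqr_ge0.
    lra.
  (* The equation differenced at scale k is tested with [y]. As [Xo] and [W] are skew, only the
     oscillator and the commutator of the difference with [W] remain. *)
  have h2 : dotS (H y) y = dot (dl (T i) k (kinetic u)) (inj y) +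
      dot (dl (T i) k (W u) - W y) (inj y).
    rewrite -ipDl; transitivity (dot (kinetic y) (inj y)).
      rewrite /kinetic [RHS]ipDl [X in _ = X + _]ipBl -dotSE dot_free_transport.
      by rewrite dot_rotation subr0 add0r dotSE.
    congr (dot _ _); rewrite /kinetic dlD dlB -!inj_dl -free_transport_dl -oscillator_dl -/y.
    by rewrite [X in _ = X + _]addrAC [RHS]addrA subrK [RHS]addrAC.
  have h3 : dot (dl (T i) k (W u) - W y) (inj y) <= B0 * hs R k * (c1 * N) * (2 * K).
    rewrite (le_trans (ip_le _ _ _))// ler_pM ?nrm_ge0//.
      rewrite (le_trans (rotation_commutator _ _ _))// ler_wpM2l ?sum_nrm_MD_le//.
      by rewrite mulr_ge0//; case/andP: (hs_le1 k).
    rewrite -nrmSE /y (le_trans (nrm_dl_le _ _ _))// ler_pM2l//.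
  by rewrite -/y in h2 *; rewrite /y inj_dl in h2 h3 *; lra.
rewrite big_split/= lerD//.
  rewrite (le_trans (sum_dl_dl_le _ q1 _ _ _))// ler_wpM2r// mulr_ge0 ?sqf_ge0// sqrtr_ge0//.
rewrite -mulr_suml mulrC [in leRHS]mulrAC ler_wpM2l//.
  by repeat apply: mulr_ge0 => //; exact: ltW.
by apply: geometric_le; rewrite invr_ge0 ltW//= invf_lt1.
Qed.

Lemma free_transport_adj v w : dotS (Xo v) w = - dotS v (Xo w).
Proof.
rewrite ip_suml ip_sumr -sumrN; apply: eq_bigr => j _.
by rewrite M_adj X_adj XMC.
Qed.

(** Write X_i = [D_i, Xo] and move every operator off [Xo w]. In the term with [Xo y] the difference
    quotient passes to [D i w] through its adjoint, and T_(-h) - 1 = - T_(-h) (T_h - 1) makes it a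
    translate of [D i y]. The right side involves only [Xo w], controlled by N, and quotients of
    [D i w]. *)
Lemma dot_X_quotient n (w : S) (y := 2 ^+ n *: dl (TS i) n w) :
  dotS (X i w) y = - dotS (Xo w) (D i y + TS i (- hs R n) (D i y)).
Proof.
have -> : X i w = D i (Xo w) - Xo (D i w) by rewrite D_free_transport addrC addKr.
rewrite ipBl D_adj (free_transport_adj (D i w)) opprK ipDr opprD; congr (_ + _).
have -> : Xo y = 2 ^+ n *: dl (TS i) n (Xo w).
  rewrite /y -free_transport_dl /free_transport scaler_sumr.
  by apply: eq_bigr => j _; rewrite !linearZ.
rewrite ipZr [in LHS]ipC dl_adj -ipZr -ipNr; congr (dotS _ _).
rewrite /y linearZ/= linearZ/= -scalerN; congr (_ *: _).
by rewrite /dla /dl !linearB/= -TD -flD addNr fl0 opprK addrC.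
Qed.

Lemma sqf_double n : sqf (TS i) q 2 n.+1 (D i u + TS i (- hs R n) (D i u)) <= 2 * E n.+1.
Proof.
have q0 : 0 <= q by rewrite ltW// (lt_trans _ q1).
rewrite -(@ler_pXn2r _ 2) ?nnegrE ?mulr_ge0 ?sqf_ge0// exprMn !sqr_sqf mulr_sumr.
rewrite /sqf sqr_sqrtr; last first.
  by rewrite sumr_ge0// => k _; rewrite mulr_ge0 ?sqr_ge0// exprn_ge0.
apply: ler_sum => k _; rewrite [leRHS]mulrCA ler_wpM2l ?exprn_ge0// -exprMn.
rewrite lerXn2r ?nnegrE ?mulr_ge0 ?nrm_ge0// dlD -fl_dl.
rewrite (le_trans (ler_nrmD _ _ _))// nrm_fl [leRHS]mulr_natl mulr2n.
by rewrite nrmSE inj_dl.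
Qed.

Let two_expn k : 2 ^+ k = q ^+ (3 * k). Proof. by rewrite exprM q3. Qed.

(* [2 ^+ n *: dl n (avg n (n - k) u) = 2 ^+ k *: dl k u]: the dyadic average of [u] lets
   [X_i = [D_i, Xo]], known only as a limit of difference quotients, be used at scale k. *)
Lemma sqf_bound : exists c, forall n, A n.+1 ^+ 2 <=
  2 * (2 + B0 * c1) * Num.sqrt (4 / (1 - q ^- 2)) * (N * E n.+1) + c * (q / 2) ^+ n.
Proof.
have q0 : 0 < q by exact: lt_trans q1.
have [c hc] := X_quot i u.
have c0 : 0 <= c.
  have := hc 0; rewrite expr0 invr1 mulr1; apply: le_trans; exact: nrm_ge0.
(* Replacing the quotient by [X i w] costs c 2^-n |y| at scale k, where |y| <= 2^k 2 K; after the
   weight q^(-2k) this is 2 c K 2^-n q^k, and the q^k with k <= n sum to at most q^(n+1) / (q -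
   1). *)
exists (2 * c * K * q / (q - 1)) => n; rewrite sqr_sqf.
pose w' := D i u + TS i (- hs R n) (D i u).
apply: (@le_trans _ _ (\sum_(k < n.+1) (q ^+ k *
    dotS (avg (TS i) n (n - k) (- Xo u)) (dl (TS i) k w') + (2 * c * K / 2 ^+ n) * q ^+ k))).
  apply: ler_sum => k _.
  have kn : (k <= n)%N by rewrite -ltnS.
  pose w := avg (TS i) n (n - k) u; pose y := 2 ^+ n *: dl (TS i) n w.
  have yE : y = 2 ^+ k *: dl (TS i) k u by rewrite /y /w avg_difference_quotient.
  have qk : 0 <= q ^- (2 * k) by rewrite invr_ge0 exprn_ge0// ltW.
  have q2k : q ^- (2 * k) * 2 ^+ k = q ^+ k.
    by rewrite two_expn (mulnDl 2 1 k) mul1n exprD mulKf// expf_neq0// gt_eqF.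
  have -> : q ^+ (4 * k) * nrm dot (dl (T i) k (inj u)) ^+ 2 = q ^- (2 * k) * nS y ^+ 2.
    rewrite -inj_dl -nrmSE yE nrmZ ger0_norm ?exprn_ge0// exprMn [RHS]mulrA; congr (_ * _).
    by rewrite expr2 mulrA q2k two_expn -exprD -[X in (X + _)%N]mul1n -mulnDl.
  have -> : q ^+ k * dotS (avg (TS i) n (n - k) (- Xo u)) (dl (TS i) k w') +
      2 * c * K / 2 ^+ n * q ^+ k = q ^- (2 * k) *
      (2 ^+ k * dotS (avg (TS i) n (n - k) (- Xo u)) (dl (TS i) k w') +
       c * 2 ^- n * (2 ^+ k * (2 * K))).
    by rewrite -q2k; ring.
  rewrite ler_wpM2l// sqr_nrm.
  (* One factor [y] becomes [X i w], to which the commutator identity applies. The remainder is an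
     average of the error in [X_quot], hence no larger than it. *)
  have -> : dotS y y = dotS (X i w) y + dotS (y - X i w) y.
    by rewrite -ipDl addrC subrK.
  rewrite lerD//.
    rewrite dot_X_quotient -/y.
    have -> : D i y + TS i (- hs R n) (D i y) = 2 ^+ k *: dl (TS i) k w'.
      have -> : D i y = 2 ^+ k *: dl (TS i) k (D i u).
        by rewrite yE linearZ/= /dl linearB/= -TD.
      by rewrite linearZ/= -scalerDr fl_dl -dlD.
    have -> : dotS (avg (TS i) n (n - k) (- Xo u)) (dl (TS i) k w') =
        - dotS (avg (TS i) n (n - k) (Xo u)) (dl (TS i) k w').
      by rewrite -scaleN1r avgZ scaleN1r ipNl.
    by rewrite /w free_transport_avg ipZr mulrN.
  rewrite (le_trans (ip_le _ _ _))// ler_pM ?nrm_ge0//.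
    have -> : y - X i w = avg (TS i) n (n - k) (2 ^+ n *: dl (TS i) n u - X i u).
      rewrite -[X in avg _ _ _ (_ + X)]scaleN1r avgD !avgZ scaleN1r avg_dl; congr (_ - _).
      by rewrite /w (avg_intertwine (S := TS i) (phi := X i))// => s v; rewrite TX.
    by rewrite (le_trans (nrm_avg _ _ _ _))// invrK.
  rewrite yE nrmZ ger0_norm ?exprn_ge0// ler_wpM2l ?exprn_ge0//.
  by rewrite (le_trans (nrm_dl_le _ _ _))// ler_wpM2l.
rewrite big_split/= lerD//.
  rewrite (le_trans (sum_avg_dl_le _ q1 q3 _ _ _))//.
  have nX : nS (- Xo u) <= (2 + B0 * c1) * N by rewrite nrmN nrm_free_transport_le.
  have s0 : 0 <= Num.sqrt (4 / (1 - q ^- 2)) by exact: sqrtr_ge0.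
  apply: (@le_trans _ _ ((2 + B0 * c1) * N * (Num.sqrt (4 / (1 - q ^- 2)) * (2 * E n.+1)))).
    by apply: ler_pM => //; [exact: nrm_ge0|rewrite mulr_ge0 ?sqf_ge0|rewrite ler_wpM2l ?sqf_double].
  by rewrite le_eqVlt; apply/orP; left; apply/eqP; ring.
have -> : \sum_(k < n.+1) 2 * c * K / 2 ^+ n * q ^+ k = 2 * c * K / 2 ^+ n * ((q ^+ n.+1 - 1) / (q - 1)).
  by rewrite -mulr_sumr subrX1 [(q - 1) * _]mulrC mulfK// gt_eqF// subr_gt0.
have -> : 2 * c * K * q / (q - 1) * (q / 2) ^+ n = 2 * c * K / 2 ^+ n * (q ^+ n.+1 / (q - 1)).
  by rewrite expr_div_n exprS; ring.
apply: ler_wpM2l.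
  by apply: divr_ge0; [apply: mulr_ge0; [exact: mulr_ge0|exact: ltW]|exact: exprn_ge0].
by rewrite ler_wpM2r ?invr_ge0 ?subr_ge0 ?(ltW q1)// gerBl.
Qed.

(** [X i u] is its difference quotient at step 2^-n, to which [dl_telescope] applies, up to c 2^-n.
    This error is relaxed to (q / 2)^n to have the shape of the one in [sqf_bound]. *)
Lemma dot_XD_bound : exists c, forall n,
  `|dotS (X i u) (D i u)| <= 2^-1 * (A n.+1 * E n.+1) + c * (q / 2) ^+ n.
Proof.
have [c hc] := X_quot i u; exists (c * nS (D i u)) => n.
have -> : X i u = 2 ^+ n *: dl (TS i) n u - (2 ^+ n *: dl (TS i) n u - X i u).
  by rewrite opprB addrC subrK.
rewrite ipBl (le_trans (ler_normB _ _))// lerD//.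
  rewrite dotSE linearZ/= inj_dl; apply: dl_telescope => //.
rewrite (le_trans (cauchy_schwarz _ _ _))// mulrAC ler_wpM2r ?nrm_ge0//.
rewrite (le_trans (hc n))//.
have c0 : 0 <= c.
  have := hc 0; rewrite expr0 invr1 mulr1; apply: le_trans; exact: nrm_ge0.
rewrite ler_wpM2l// expr_div_n ler_peMl ?invr_ge0 ?exprn_ge0// exprn_ege1// ltW//.
Qed.

(** n is chosen after u, making both errors at most [K ^+ 2], while the main constants do not
    involve n. Since a real closed field need not be archimedean, the decay of (q / 2)^n enters as a
    hypothesis. *)
Lemma direction_bound : (forall e : R, 0 < e -> exists n, (q / 2) ^+ n <= e) ->
  exists a e, [/\ 0 <= a, 0 <= e,
    e ^+ 2 <= direction_cst d B0 q * (K * (a + N)),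
    a ^+ 2 <= direction_cst d B0 q * (N * e) + K ^+ 2 &
    `|dotS (X i u) (D i u)| <= 2^-1 * (a * e) + K ^+ 2].
Proof.
move=> arch.
have [c ha] := sqf_bound; have [c' hx] := dot_XD_bound.
have K2 : 0 < K ^+ 2 by rewrite exprn_gt0.
have cc : 0 < `|c| + `|c'| + 1 by rewrite ltr_wpDl ?addr_ge0.
have [n hn] := arch (K ^+ 2 / (`|c| + `|c'| + 1)) (divr_gt0 K2 cc).
have q0 : 0 < q by exact: lt_trans q1.
have err x : `|x| <= `|c| + `|c'| + 1 -> x * (q / 2) ^+ n <= K ^+ 2.
  move=> xc; have qn : 0 <= (q / 2) ^+ n by rewrite exprn_ge0// divr_ge0// ltW.
  apply: (le_trans (ler_wpM2r qn (ler_norm x))).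
  apply: (le_trans (ler_wpM2r qn xc)); by rewrite mulrC -ler_pdivlMr.
have c0 := normr_ge0 c; have c'0 := normr_ge0 c'.
have e1 := err c ltac:(lra); have e2 := err c' ltac:(lra).
have qi : 0 <= (1 - q^-1)^-1 by rewrite invr_ge0 subr_ge0 invf_le1// ltW.
pose s1 := Num.sqrt (16 / (1 - q ^- 2)); pose s2 := Num.sqrt (4 / (1 - q ^- 2)).
have s10 : 0 <= s1 by exact: sqrtr_ge0.
have s20 : 0 <= s2 by exact: sqrtr_ge0.
pose t1 := 2 * B0 * c1 / (1 - q^-1); pose t2 := 2 * (2 + B0 * c1) * s2.
have t10 : 0 <= t1 by repeat apply: mulr_ge0 => //.
have t20 : 0 <= t2 by repeat apply: mulr_ge0 => //; apply: addr_ge0 => //; exact: mulr_ge0.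
have -> : direction_cst d B0 q = 1 + s1 + t1 + t2 by [].
exists (A n.+1), (E n.+1).
have A0 : 0 <= A n.+1 by exact: sqf_ge0.
have E0 : 0 <= E n.+1 by exact: sqf_ge0.
split => //.
- apply: (le_trans (sqf_D_bound n.+1)); rewrite -/s1 -/t1.
  have KA : 0 <= K * A n.+1 by rewrite mulr_ge0// ltW.
  have KNN : 0 <= N * K by rewrite mulr_ge0// ltW.
  have := mulr_ge0 (addr_ge0 t10 t20) KA; have := mulr_ge0 (addr_ge0 s10 t20) KNN.
  clearbody N s1 t1 t2; lra.
- apply: (le_trans (ha n)); rewrite lerD// -/s2 -/t2 ler_wpM2r ?mulr_ge0 ?(ltW N0)//.
  by clearbody s1 t1 t2; lra.
- by apply: (le_trans (hx n)); rewrite lerD2l.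
Qed.

End direction.

(** The conclusion of [closing_bound] appears as a hypothesis so that C is fixed before u. The
    factor 2 of the cross terms in [energy_identity] cancels the 2^-1 of [direction_bound] and makes
    the error 2 d K^2. *)
Lemma oscillator_bound q (C : R) : 1 < q -> q ^+ 3 = 2 ->
  (forall e : R, 0 < e -> exists n, (q / 2) ^+ n <= e) ->
  (forall (h K : R) (a e : 'I_d -> R), 0 <= h -> 0 < K ->
    (forall i, [/\ 0 <= a i, 0 <= e i,
       e i ^+ 2 <= direction_cst d B0 q * (K * (a i + (h + K))) &
       a i ^+ 2 <= direction_cst d B0 q * ((h + K) * e i) + K ^+ 2]) ->
    h ^+ 2 <= (1 + 2 * d%:R) * K ^+ 2 + \sum_i a i * e i ->
    h + K <= C * K) ->
  N <= C * K.
Proof.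
move=> q1 q3 arch close.
have /choice[f hf] : forall i, exists ae : R * R, [/\ 0 <= ae.1, 0 <= ae.2,
    ae.2 ^+ 2 <= direction_cst d B0 q * (K * (ae.1 + N)),
    ae.1 ^+ 2 <= direction_cst d B0 q * (N * ae.2) + K ^+ 2 &
    `|dotS (X i u) (D i u)| <= 2^-1 * (ae.1 * ae.2) + K ^+ 2].
  by move=> i; have [a [e h]] := direction_bound i q1 q3 arch; exists (a, e).
apply: (close _ _ (fun i => (f i).1) (fun i => (f i).2)) => //.
- exact: nrm_ge0.
- by move=> i; have [? ? ? ? _] := hf i; split.
have := energy_identity u.
have : - \sum_i dotS (X i u) (D i u) <= \sum_i (2^-1 * ((f i).1 * (f i).2) + K ^+ 2).
  rewrite -sumrN ler_sum// => i _; have [_ _ _ _] := hf i; apply: le_trans.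
  by rewrite -normrN ler_norm.
rewrite big_split/= -mulr_sumr sumr_const card_ord -mulr_natl => h1 h2.
have h3 : nrm dot (kinetic u) ^+ 2 <= K ^+ 2 by rewrite lerXn2r ?nnegrE ?nrm_ge0// ltW.
have h4 : 0 <= nrm dot (inj (Xo u) - W u) ^+ 2 by rewrite sqr_ge0.
lra.
Qed.

Lemma nrm_transport_le : nrm dot (inj (Xo u) - W u) <= N.
Proof.
have -> : inj (Xo u) - W u = kinetic u - inj (H u) by rewrite /kinetic addrK.
by rewrite (le_trans (ler_nrmB _ _ _))// -nrmSE addrC lerD.
Qed.

End estimates.
End kinetic.

(** * Integration on phase space *)

Import numFieldNormedType.Exports.

Local Open Scope classical_set_scope.

Section measurability.
Context {R : realType} (n : nat).

Definition lattice (k : nat) (z : 'rV[int]_n) : 'rV[R]_n :=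
  \row_j ((z 0 j)%:~R / k.+1%:R).

Definition lattice_floor (k : nat) (x : 'rV[R]_n) : 'rV[int]_n :=
  \row_j Num.floor (x 0 j * k.+1%:R).

Lemma lattice_floor_dist k x :
  `|lattice k (lattice_floor k x) - x| <= k.+1%:R^-1.
Proof.
rewrite [leLHS]mx_normrE; apply: bigmax_le; first by rewrite invr_ge0.
move=> [i j] _ /=; rewrite !mxE ord1 distrC.
have k0 : 0 < k.+1%:R :> R by rewrite ltr0n.
have -> : x 0 j - (Num.floor (x 0 j * k.+1%:R))%:~R / k.+1%:R =
  (x 0 j * k.+1%:R - (Num.floor (x 0 j * k.+1%:R))%:~R) / k.+1%:R.
  by rewrite mulrBl mulfK// gt_eqF.
rewrite normrM [X in _ * X]ger0_norm ?invr_ge0 ?ler0n// -[leRHS]mul1r ler_wpM2r ?invr_ge0//.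
have /andP[h1 h2] := floor_itv (x 0 j * k.+1%:R).
rewrite ger0_norm ?subr_ge0// lerBlDl.
by rewrite intrD in h2; exact: ltW.
Qed.

Lemma lattice_floor_cvg x : lattice k (lattice_floor k x) @[k --> \oo] --> x.
Proof.
apply/cvgrPdist_le => e e0.
near=> k; rewrite distrC (le_trans (lattice_floor_dist k x))//.
by apply/ltW; near: k; exact: (near_infty_natSinv_lt (PosNum e0)).
Unshelve. all: by end_near. Qed.

(* f (X, Y) is the limit of its roundings to the lattice of mesh 1/(k+1), which take countably
   many values. *)
Lemma measurable_fun_continuous_phase d (T : measurableType d)
    (X Y : T -> 'rV[R]_n) (f : 'rV[R]_n * 'rV[R]_n -> R) :
  (forall j, measurable_fun setT (fun w => X w 0 j)) ->
  (forall j, measurable_fun setT (fun w => Y w 0 j)) ->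
  continuous f -> measurable_fun setT (fun w => f (X w, Y w)).
Proof.
move=> mX mY cf.
pose g k w := f (lattice k (lattice_floor k (X w)), lattice k (lattice_floor k (Y w))).
refine (@measurable_fun_cvg _ _ _ setT g _ _ _); last first.
  move=> w _; rewrite /g.
  have := cf (X w, Y w); apply: cvg_comp.
  exact: (cvg_pair (@lattice_floor_cvg (X w)) (@lattice_floor_cvg (Y w))).
have mfloor (Z : T -> 'rV[R]_n) k z : (forall j, measurable_fun setT (fun w => Z w 0 j)) ->
    measurable [set w | lattice_floor k (Z w) = z].
  move=> mZ.
  have -> : [set w | lattice_floor k (Z w) = z] = \bigcap_(j in [set: 'I_n])
      ((fun w => Z w 0 j) @^-1` `[(z 0 j)%:~R / k.+1%:R, (z 0 j + 1)%:~R / k.+1%:R[).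
    apply/seteqP; split => [w /= <- j _|w /= H].
      rewrite /= in_itv/= mxE; have k0 : 0 < k.+1%:R :> R by rewrite ltr0n.
      rewrite ler_pdivrMr// ltr_pdivlMr//; exact: floor_itv.
    apply/rowP => j; rewrite mxE.
    have := H j I; rewrite /= in_itv/=.
    have k0 : 0 < k.+1%:R :> R by rewrite ltr0n.
    rewrite ler_pdivrMr// ltr_pdivlMr// => h; exact: floor_def.
  apply: fin_bigcap_measurable => [|j _]; first exact: finite_finset.
  by rewrite -[X in measurable X]setTI; apply: mZ.
move=> k _ A mA; rewrite setTI.
have -> : g k @^-1` A = \bigcup_(z : 'rV[int]_n * 'rV[int]_n)
    [set w | [/\ A (f (lattice k z.1, lattice k z.2)),
      lattice_floor k (X w) = z.1 & lattice_floor k (Y w) = z.2]].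
  apply/seteqP; split => [w /= Aw|w [z _ /= [Az xz yz]]].
    by exists (lattice_floor k (X w), lattice_floor k (Y w)).
  by rewrite /= /g xz yz.
apply: countable_bigcupT_measurable; first exact: countableP.
move=> z; have [Az|nAz] := pselect (A (f (lattice k z.1, lattice k z.2))); last first.
  by rewrite (_ : [set _ | _] = set0)//; apply/seteqP; split => // w [].
rewrite (_ : [set _ | _] = [set w | lattice_floor k (X w) = z.1] `&`
  [set w | lattice_floor k (Y w) = z.2]); last first.
  by apply/seteqP; split => [w []//|w []/=].
by apply: measurableI; exact: mfloor.
Qed.

End measurability.

Section product_integrals.
Context {dsp} {T : measurableType dsp} {R : realType}.
Variable m : {sigma_finite_measure set T -> \bar R}.
Variable w : T -> R.
Hypothesis mw : measurable_fun setT w.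
Hypothesis w_ge0 : forall a, 0 <= w a.
Hypothesis w_fin : (\int[m]_a (w a)%:E < +oo)%E.

(** An integrable majorant of product form, compatible with slicing one coordinate: w is 1 on the
    torus and 1 / (1 + a^2) in velocity. *)
Definition env n (t : n.-tuple T) : R := \prod_(i < n) w (tnth t i).

Lemma env_ge0 n (t : n.-tuple T) : 0 <= env t.
Proof. exact: prodr_ge0. Qed.

Lemma env_tcons n (p : T * n.-tuple T) : env (tcons p) = w p.1 * env p.2.
Proof.
rewrite /env big_ord_recl tnth0; congr (_ * _); apply: eq_bigr => i _.
by rewrite tnthS.
Qed.

Lemma measurable_env n : measurable_fun setT (@env n).
Proof.
apply: measurable_prod => i _; apply: measurableT_comp => //.
exact: measurable_tnth.
Qed.

Let measurable_EFin_env n : measurable_fun setT (fun t : n.-tuple T => (env t)%:E).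
Proof. by apply/measurable_EFinP; exact: measurable_env. Qed.

Lemma integral_mpowS n (g : n.+1.-tuple T -> \bar R) :
  measurable_fun setT g -> (forall t, 0 <= g t)%E ->
  (\int[mpow m n.+1]_t g t = \int[m]_a \int[mpow m n]_s g (tcons (a, s)))%E.
Proof.
move=> mg g0.
transitivity (\int[pushforward (m \x mpow m n) (@tcons _ _ n)]_t g t)%E => //.
rewrite ge0_integral_pushforward//; last exact: measurable_tcons.
rewrite preimage_setT fubini_tonelli1//; last first.
  by move=> x; exact: g0.
by apply: measurableT_comp => //; exact: measurable_tcons.
Qed.

Lemma env_lty n : (\int[mpow m n]_t (env t)%:E < +oo)%E.
Proof.
elim: n => [|n IH].
  rewrite integral_dirac//=; last exact: measurable_EFin_env.
  by rewrite diracT mul1e ltry.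
rewrite integral_mpowS; last by move=> t; rewrite lee_fin env_ge0.
  under eq_integral => a _.
    under eq_integral do rewrite env_tcons /= EFinM.
    rewrite ge0_integralZl//; [|exact: measurable_EFin_env|
      by move=> t _; rewrite lee_fin env_ge0|by rewrite lee_fin].
    over.
  rewrite ge0_integralZr//; [|exact/measurable_EFinP|
    by move=> a _; rewrite lee_fin|].
    by apply: lte_mul_pinfty => //; [apply: integral_ge0 => a _; rewrite lee_fin|
      rewrite ge0_fin_numE//; apply: integral_ge0 => a _; rewrite lee_fin].
  by apply: integral_ge0 => t _; rewrite lee_fin env_ge0.
exact: measurable_EFin_env.
Qed.

Lemma integrable_mpow n (g : n.-tuple T -> R) C : measurable_fun setT g ->
  (forall t, `|g t| <= C * env t) -> (mpow m n).-integrable setT (EFin \o g).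
Proof.
move=> mg gC.
apply: (@le_integrable _ _ _ _ _ measurableT _ (EFin \o (fun t => C * env t))).
- exact/measurable_EFinP.
- by move=> t _; rewrite lee_fin (le_trans (gC t))// ler_norm.
rewrite (_ : _ \o _ = fun t => (C%:E * (EFin \o @env n) t)%E); last by [].
apply: integrableZl => //; apply/integrableP; split.
  exact: measurable_EFin_env.
under eq_integral do rewrite /= ger0_norm ?env_ge0//.
exact: env_lty.
Qed.

Definition tset n (t : n.-tuple T) (i : 'I_n) (a : T) : n.-tuple T :=
  [tuple if j == i then a else tnth t j | j < n].

Lemma tset_head n a b (s : n.-tuple T) : tset (tcons (a, s)) ord0 b = tcons (b, s).
Proof.
apply: eq_from_tnth => j; rewrite tnth_mktuple.
by case: (unliftP ord0 j) => [k ->|->]; rewrite ?tnthS ?tnth0.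
Qed.

Lemma tset_lift n a b (s : n.-tuple T) i :
  tset (tcons (a, s)) (lift ord0 i) b = tcons (a, tset s i b).
Proof.
apply: eq_from_tnth => j; rewrite tnth_mktuple.
case: (unliftP ord0 j) => [k ->|->]; rewrite ?tnthS ?tnth0//.
by rewrite tnth_mktuple (inj_eq lift_inj).
Qed.

(* Integration by parts and translation invariance in one coordinate are both instances, with g
   a derivative, respectively the difference of a function and its translate. *)
Lemma integral_mpow_slice0 n (i : 'I_n) (g : n.-tuple T -> R) C :
  measurable_fun setT g -> (forall t, `|g t| <= C * env t) ->
  (forall t, \int[m]_a (g (tset t i a))%:E = 0)%E ->
  (\int[mpow m n]_t (g t)%:E = 0)%E.
Proof.
elim: n i g C => [[]//|n IH] i g C mg gC g0.
have ig := integrable_mpow mg gC.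
have mgt : measurable_fun setT (g \o @tcons _ _ n).
  by apply: measurableT_comp => //; exact: measurable_tcons.
have igt : (m \x mpow m n)%E.-integrable setT ((EFin \o g) \o @tcons _ _ n).
  apply/integrableP; split; first exact/measurable_EFinP.
  have /integrableP[_] := ig.
  rewrite -[X in (X < _)%E -> _]/(\int[pushforward (m \x mpow m n) (@tcons _ _ n)]_t `|(g t)%:E|)%E.
  rewrite ge0_integral_pushforward//; first exact: measurable_tcons.
  by apply/measurable_EFinP; exact: measurableT_comp.
transitivity (\int[pushforward (m \x mpow m n) (@tcons _ _ n)]_t (g t)%:E)%E => //.
rewrite integral_pushforward//; [|exact: measurable_tcons|exact/measurable_EFinP].
rewrite preimage_setT.
case: (unliftP ord0 i) g0 => [k ->|->] g0.
  rewrite -integral12_prod_meas1//; apply: integral0_eq => a _.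
  apply: (IH k (fun s => g (tcons (a, s))) (C * w a)).
  - exact: (measurable_fun_pair2 a mgt).
  - by move=> t; rewrite (le_trans (gC _))// env_tcons mulrA.
  - by move=> t; under eq_integral do rewrite -tset_lift; exact: g0.
rewrite -integral21_prod_meas1//; apply: integral0_eq => s _.
(* Any [a] serves as placeholder, since [tset] overwrites the head; if [T] is empty the integral is
   trivially 0. *)
have [[a]|na] := pselect (inhabited T).
  by rewrite -[RHS](g0 (tcons (a, s))); apply: eq_integral => b _; rewrite tset_head.
by apply: integral0_eq => a; case: na; exists.
Qed.

End product_integrals.

(** * Calculus on the real line *)

Section real_line.
Context {R : realType}.
Notation mu := (@lebesgue_measure R).
Implicit Types (f F : R -> R) (a b x : R).

Lemma is_derive_continuous F (f : R) x : is_derive x 1 F f -> {for x, continuous F}.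
Proof. by case=> dF _; apply: differentiable_continuous; apply/derivable1_diffP. Qed.

Lemma integral_derivative F f a b : a < b -> continuous f ->
  (forall x, a <= x <= b -> is_derive x 1 F (f x)) ->
  (\int[mu]_(x in `[a, b]) (f x)%:E = (F b - F a)%:E)%E.
Proof.
move=> ab cf dF; rewrite EFinB; apply: continuous_FTC2 => //.
- exact: continuous_subspaceT.
- split.
  + move=> x; rewrite in_itv/= => /andP[ax xb].
    by have [] : is_derive x 1 F (f x) by apply: dF; rewrite !ltW.
  + by apply: cvg_at_right_filter; apply: (is_derive_continuous (dF a _)); rewrite lexx ltW.
  + by apply: cvg_at_left_filter; apply: (is_derive_continuous (dF b _)); rewrite lexx ltW.
move=> x; rewrite in_itv/= => /andP[ax xb]; rewrite derive1E.
by have [] : is_derive x 1 F (f x) by apply: dF; rewrite !ltW.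
Qed.

(** The integral starts at - M - 1, strictly left of the interval, so that every point of [- M, M]
    is interior and the derivative two-sided. *)
Lemma local_primitive f M : 0 < M -> continuous f ->
  exists F, forall x, - M <= x <= M -> is_derive x 1 F (f x).
Proof.
move=> M0 cf.
pose F x := (\int[mu]_(t in [set` `[- M - 1, x]]) f t)%R.
exists F => x /andP[Mx xM].
have xM1 : x < M + 1 by rewrite (le_lt_trans xM)// ltrDl.
have [||dF F'E] := @continuous_FTC1 R f (BLeft (- M - 1)) x (M + 1) xM1
  (continuous_compact_integrable (@segment_compact _ _ _) (continuous_subspaceT cf)).
- by rewrite lte_fin; lra.
- exact: cf.
by apply: (DeriveDef dF); rewrite -derive1E; exact: F'E.
Qed.

(** Both integrals are increments over length 1 of a primitive F, and F (x + 1) - F x has derivative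
    0 by periodicity. [M] covers all the arguments met, which are at most |h| + 1 in absolute
    value. *)
Lemma integral_periodic_shift f h : continuous f -> (forall x, f (x + 1) = f x) ->
  (\int[mu]_(x in `[0%R, 1%R]) (f (x + h))%:E =
   \int[mu]_(x in `[0%R, 1%R]) (f x)%:E)%E.
Proof.
move=> cf per; pose M := `|h| + 2.
have M0 : 0 < M by rewrite ltr_wpDl.
have [F dF] := local_primitive M0 cf.
have hM : - `|h| <= h <= `|h| by rewrite -ler_norml.
have dFc t x : - M <= x + t <= M -> is_derive x 1 (fun x => F (x + t)) (f (x + t)).
  move=> /dF d1; rewrite -[f _]mulr1; apply: is_derive1_comp.
  exact: is_derive_shift.
have cfh t : continuous (fun x => f (x + t)).
  by move=> x; apply: continuous_comp; [by apply: cvgD; [exact: cvg_id|exact: cvg_cst]|exact: cf].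
have -> : (\int[mu]_(x in `[0%R, 1%R]) (f (x + h))%:E = (F (1 + h) - F (0 + h))%:E)%E.
  apply: (@integral_derivative (fun x => F (x + h)) (fun x => f (x + h))) => //.
  by move=> x /andP[x0 x1]; apply: dFc; rewrite /M; lra.
have -> : (\int[mu]_(x in `[0%R, 1%R]) (f x)%:E = (F 1 - F 0)%:E)%E.
  apply: (@integral_derivative F f) => //.
  by move=> x /andP[x0 x1]; apply: dF; rewrite /M; lra.
congr EFin.
pose G x := F (x + 1) - F x.
have dG x : - `|h| <= x <= `|h| -> is_derive x 1 G 0.
  move=> xh; rewrite -(subrr (f x)) -{1}(per x); apply: is_deriveB.
    by apply: dFc; rewrite /M; lra.
  by apply: dF; rewrite /M; lra.
suff : G h = G 0 by rewrite /G !add0r [h + 1]addrC.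
have cG a b : - `|h| <= a -> b <= `|h| -> {within `[a, b], continuous G}.
  move=> ha hb; apply: derivable_within_continuous => x.
  rewrite in_itv/= => /andP[ax xb].
  by have [] : is_derive x 1 G 0 by apply: dG; rewrite (le_trans ha)// (le_trans _ hb).
have mvt a b : - `|h| <= a -> b <= `|h| -> a <= b -> G b = G a.
  move=> ha hb ab.
  have H x : x \in `]a, b[%R -> is_derive x 1 G ((fun=> 0 : R) x).
    by rewrite in_itv/= => /andP[? ?]; apply: dG; lra.
  have [c _] := MVT_segment ab H (cG _ _ ha hb).
  by rewrite mul0r => /eqP; rewrite subr_eq0 => /eqP.
have [h0|h0] := leP 0 h; first by apply: mvt => //; lra.
by apply/esym; apply: mvt; lra.
Qed.

Lemma continuous_sqrDV : continuous (fun x : R => (1 + x ^+ 2)^-1).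
Proof. exact: continuous_oneDsqrV. Qed.

Lemma integral_sqrDV_lty : (\int[mu]_x ((1 + x ^+ 2)^-1)%:E < +oo)%E.
Proof.
rewrite ge0_symfun_integralT; last 3 first.
- by move=> x; rewrite invr_ge0 addr_ge0 ?sqr_ge0.
- exact: continuous_sqrDV.
- by move=> x /=; rewrite sqrrN.
rewrite -set_itvcy; have := @integral0y_oneDsqr R; rewrite /oneDsqr => ->.
by rewrite -EFinM ltry.
Qed.

(** On [- (n + 1), n + 1] the integral is a difference of boundary values of F, which tends to 0;
    dominated convergence passes to the whole line. *)
Lemma integral_derivative_decay F f C : continuous f ->
  (forall x, is_derive x 1 F (f x)) ->
  (forall x, `|f x| <= C * (1 + x ^+ 2)^-1) ->
  (forall x, `|F x| <= C * (1 + x ^+ 2)^-1) ->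
  (\int[mu]_x (f x)%:E = 0)%E.
Proof.
move=> cf dF fC FC.
have mf : measurable_fun setT f by exact: continuous_measurable_fun.
pose D n := `[(- n.+1%:R : R), n.+1%:R]%classic.
have h1 : (\int[mu]_x ((EFin \o f) \_ (D n)) x)%E @[n --> \oo] --> (\int[mu]_x (f x)%:E)%E.
  apply: (@dominated_cvg _ _ _ mu setT measurableT (fun n => (EFin \o f) \_ (D n))
    (EFin \o f) (fun x => (C * (1 + x ^+ 2)^-1)%:E)) => //.
  - move=> n; apply/(measurable_restrictT _ _).1 => //; first exact: measurable_itv.
    by apply/measurable_EFinP; exact: measurable_funTS.
  - move=> x _; apply: cvg_near_cst; near=> n; rewrite patchE ifT// inE /D/= in_itv/= -ler_norml.
    rewrite ltW// (lt_le_trans (_ : _ < n%:R))// ?ler_nat//.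
    by near: n; exact: nbhs_infty_gtr.
  - rewrite (_ : (fun _ => _) = fun x => (C%:E * ((1 + x ^+ 2)^-1)%:E)%E); last by [].
    apply: integrableZl => //; apply/integrableP; split.
      by apply/measurable_EFinP; apply: continuous_measurable_fun; exact: continuous_sqrDV.
    under eq_integral do rewrite gee0_abs ?lee_fin ?invr_ge0 ?addr_ge0 ?sqr_ge0//.
    exact: integral_sqrDV_lty.
  - move=> n x _; rewrite patchE; case: ifPn => _; first by rewrite lee_fin fC.
    by rewrite abse0 lee_fin (le_trans _ (fC x)).
have h2 : (\int[mu]_x ((EFin \o f) \_ (D n)) x)%E @[n --> \oo] --> 0%E.
  have -> : (fun n => \int[mu]_x ((EFin \o f) \_ (D n)) x)%E =
      (fun n => (F n.+1%:R - F (- n.+1%:R))%:E).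
    apply/funext => n; rewrite -integral_mkcond; apply: integral_derivative => //.
    by rewrite gtrN// ltr0n.
  apply: cvg_EFin; first by near=> n.
  have inv0 : (fun n : nat => C * n.+1%:R^-1 + C * n.+1%:R^-1) @ \oo --> (0 : R).
    rewrite -[0]addr0 -[in X in _ --> X](mulr0 C).
    by apply: cvgD; apply: cvgMr; exact: cvg_harmonic.
  apply/cvgr0Pnorm_le => e e0.
  have /cvgr0Pnorm_le/(_ _ e0) := inv0; apply: filterS => n /=.
  apply: le_trans; rewrite (le_trans (ler_normB _ _))//.
  have C0 : 0 <= C by have := le_trans (normr_ge0 _) (fC 0); rewrite expr0n addr0 invr1 mulr1.
  have n0 : 0 < n.+1%:R :> R by rewrite ltr0n.
  have hn : (1 + n.+1%:R ^+ 2)^-1 <= n.+1%:R^-1 :> R.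
    rewrite lef_pV2 ?posrE ?addr_gt0 ?exprn_gt0// expr2.
    have : 1 <= n.+1%:R :> R by rewrite ler1n.
    nra.
  rewrite [leRHS]ger0_norm ?addr_ge0 ?mulr_ge0 ?invr_ge0//.
  rewrite lerD// (le_trans (FC _))// ler_wpM2l// sqrrN//.
by rewrite -(cvg_lim _ h1)// (cvg_lim _ h2).
Unshelve. all: by end_near. Qed.

End real_line.

Section phase_integral.
Context {R : realType} (d : nat).
Notation lam := (@lebesgue_measure R).
Notation mI := (mfrestr (@measurable_unit_interval R) (@lebesgue_unit_interval_lty R)).
Notation tup := (d.-tuple (measurableTypeR R)).
Notation mux := (@torus_measure R d).
Notation muv := (@velocity_measure R d).
Notation mu := (mux \x muv)%E.
Notation phase := ('rV[R]_d * 'rV[R]_d)%type.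

Definition bracket (a : R) : R := (1 + a ^+ 2)^-1.

Lemma bracket_ge0 a : 0 <= bracket a.
Proof. by rewrite invr_ge0 addr_ge0 ?sqr_ge0. Qed.

Lemma measurable_bracket : measurable_fun setT (bracket : measurableTypeR R -> R).
Proof. by apply: continuous_measurable_fun; exact: continuous_sqrDV. Qed.

Definition env_unit := @env _ (measurableTypeR R) R (fun=> 1) d.
Definition env_bracket := @env _ (measurableTypeR R) R bracket d.

Lemma env_unitE t : env_unit t = 1. Proof. by rewrite /env_unit /env big1. Qed.

Lemma ge0_integral_mI (f : measurableTypeR R -> \bar R) :
  measurable_fun setT f -> (forall a, 0 <= f a)%E ->
  (\int[mI]_a f a = \int[lam]_(a in `[0%R, 1%R]) f a)%E.
Proof.
move=> mf f0; have mD := @measurable_unit_interval R.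
rewrite (@ge0_negligible_integral _ (measurableTypeR R) _ _ _
  (~` (`[0, 1]%classic : set (measurableTypeR R))))//=; last 2 first.
- exact: measurableC.
- by rewrite /mfrestr /mrestr setICl measure0.
rewrite setTD setCK; apply: eq_measure_integral => A mA AD.
by rewrite -[RHS](congr1 lam (setIidl AD)).
Qed.

Lemma integral_mI (f : measurableTypeR R -> \bar R) : measurable_fun setT f ->
  (\int[mI]_a f a = \int[lam]_(a in `[0%R, 1%R]) f a)%E.
Proof.
move=> mf; rewrite integralE [RHS]integralE; congr (_ - _)%E.
  by apply: ge0_integral_mI => //; exact: measurable_funepos.
by apply: ge0_integral_mI => //; exact: measurable_funeneg.
Qed.

Lemma unit_lty : (\int[mI]_a (1 : R)%:E < +oo)%E.
Proof.
rewrite integral_mI// integral_cst//.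
by rewrite mul1e; exact: lebesgue_unit_interval_lty.
Qed.

Lemma bracket_lty : (\int[lam]_a (bracket a)%:E < +oo)%E.
Proof. exact: integral_sqrDV_lty. Qed.

Section slices.
Variables (g : tup * tup -> R) (C : R).
Hypothesis mg : measurable_fun setT g.
Hypothesis gC : forall p, `|g p| <= C * env_bracket p.2.

Lemma integrable_phase : mu.-integrable setT (EFin \o g).
Proof.
apply: (@le_integrable _ _ _ _ _ measurableT _
  (fun p => C%:E * (env_bracket p.2)%:E)%E).
- exact/measurable_EFinP.
- by move=> p _; rewrite lee_fin (le_trans (gC p))// ler_norm.
have menv : measurable_fun setT (fun p : tup * tup => (env_bracket p.2)%:E).
  apply/measurable_EFinP; apply: measurableT_comp => //.
  exact: (measurable_env measurable_bracket).
apply: integrableZl => //; apply/integrableP; split => //.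
have env0 (s : tup) : 0 <= env_bracket s by exact: (env_ge0 bracket_ge0).
under eq_integral do rewrite /= ger0_norm//.
rewrite fubini_tonelli1//; last by move=> p; rewrite lee_fin.
rewrite /fubini_F /= integral_cst//.
apply: lte_mul_pinfty => //; first by apply: integral_ge0 => s _; rewrite lee_fin.
- rewrite ge0_fin_numE; last by apply: integral_ge0 => s _; rewrite lee_fin.
  exact: (env_lty measurable_bracket bracket_ge0 bracket_lty).
- have := env_lty (measurable_cst _) (fun=> ler01) unit_lty d.
  under eq_integral => t _ do rewrite -[env _ _]/(env_unit t) env_unitE.
  by rewrite integral_cst// mul1e.
Qed.

Lemma integral_phase_slicex (i : 'I_d) :
  (forall t s, \int[mI]_a (g (tset t i a, s))%:E = 0)%E ->
  (\int[mu]_p (g p)%:E = 0)%E.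
Proof.
move=> g0; rewrite -integral21_prod_meas1; last exact: integrable_phase.
apply: integral0_eq => s _; rewrite /fubini_G.
apply: (@integral_mpow_slice0 _ _ _ _ (fun=> 1) (measurable_cst _) (fun=> ler01) unit_lty
  d i (fun t => g (t, s)) (C * env_bracket s)).
- exact: measurable_fun_pair1.
- by move=> t; rewrite -/env_unit env_unitE mulr1.
- by move=> t; exact: g0.
Qed.

Lemma integral_phase_slicev (i : 'I_d) :
  (forall t s, \int[lam]_a (g (t, tset s i a))%:E = 0)%E ->
  (\int[mu]_p (g p)%:E = 0)%E.
Proof.
move=> g0; rewrite -integral12_prod_meas1; last exact: integrable_phase.
apply: integral0_eq => t _; rewrite /fubini_F.
refine (@integral_mpow_slice0 _ (measurableTypeR R) R (@lebesgue_measure R) bracket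
  measurable_bracket bracket_ge0 bracket_lty d i (fun s => g (t, s)) C _ _ _).
- exact: measurable_fun_pair2.
- by move=> s; exact: gC (t, s).
- by move=> s; exact: g0.
Qed.

End slices.

Lemma vec_tset (t : tup) i a :
  vec (tset t i a) = vec t - tnth t i *: delta_mx 0 i + a *: delta_mx 0 i.
Proof.
apply/rowP => j; rewrite !mxE tnth_mktuple eqxx/=.
by have [->|_] := eqVneq j i; rewrite ?mulr1 ?mulr0 ?subrr ?add0r ?subr0 ?addr0.
Qed.

Lemma is_derive_line (f g : phase -> R) v z a :
  is_derive (z + a *: v) v f (g (z + a *: v)) ->
  is_derive a 1 (fun a => f (z + a *: v)) (g (z + a *: v)).
Proof.
have E : (fun h : R => h^-1 *: (((fun a => f (z + a *: v)) \o shift a) (h *: 1) - f (z + a *: v)))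
    = (fun h => h^-1 *: ((f \o shift (z + a *: v)) (h *: v) - f (z + a *: v))).
  apply/funext => h /=; congr (_ *: (f _ - _)).
  by rewrite scalerDl addrCA /GRing.scale/= mulr1.
by case=> d1 d2; apply: DeriveDef; rewrite /derivable /derive E.
Qed.

End phase_integral.

(** * Periodic rapidly decreasing functions *)

Section nice_functions.
Context {R : realType} (d : nat).
Notation lam := (@lebesgue_measure R).
Notation mI := (mfrestr (@measurable_unit_interval R) (@lebesgue_unit_interval_lty R)).
Notation tup := (d.-tuple (measurableTypeR R)).
Notation mu := (@torus_measure R d \x @velocity_measure R d)%E.
Notation phase := ('rV[R]_d * 'rV[R]_d)%type.
Implicit Types (f g : phase -> R) (z : phase).

Definition weight z : R := 1 + enorm z.2 ^+ 2.

Lemma sqr_enorm n (w : 'rV[R]_n) : enorm w ^+ 2 = \sum_i w 0 i ^+ 2.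
Proof. by rewrite sqr_sqrtr// sumr_ge0// => i _; rewrite sqr_ge0. Qed.

Lemma weight_ge1 z : 1 <= weight z.
Proof. by rewrite lerDl sqr_ge0. Qed.

Lemma weight_gt0 z : 0 < weight z.
Proof. exact: lt_le_trans (weight_ge1 z). Qed.

Lemma coord_le_weight z i : 1 + z.2 0 i ^+ 2 <= weight z.
Proof.
by rewrite lerD2l sqr_enorm (bigD1 i)//= lerDl sumr_ge0// => j _; rewrite sqr_ge0.
Qed.

(** The carrier of [V]: only continuity is asked in x, so the class is stable under multiplication
    by a Lipschitz field, and the rapid decay allows the polynomial weights in v. *)
Definition nice f : Prop :=
  [/\ continuous f, (forall (k : 'rV[int]_d) x v, f (x + intvec k, v) = f (x, v)) &
      forall n, exists M, forall z, weight z ^+ n * `|f z| <= M].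

Lemma nice0 : nice (fun=> 0).
Proof.
split => //; first by move=> z; exact: cvg_cst.
by move=> n; exists 0 => z; rewrite normr0 mulr0.
Qed.

Lemma niceP (a : R) f g : nice f -> nice g -> nice (fun z => a * f z + g z).
Proof.
move=> [cf pf df] [cg pg dg]; split.
- by move=> z; apply: cvgD; [apply: cvgM; [exact: cvg_cst|exact: cf]|exact: cg].
- by move=> k x v; rewrite pf pg.
- move=> n; have [M1 h1] := df n; have [M2 h2] := dg n.
  exists (`|a| * M1 + M2) => z.
  have w0 : 0 <= weight z ^+ n by rewrite exprn_ge0// ltW// weight_gt0.
  apply: (le_trans (ler_wpM2l w0 (ler_normD _ _))).
  by rewrite mulrDr lerD// normrM mulrCA ler_wpM2l.
Qed.

Lemma nice_bounded f : nice f -> exists M, forall z, `|f z| <= M.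
Proof.
by move=> [_ _ /(_ 0)[M hM]]; exists M => z; have := hM z; rewrite expr0 mul1r.
Qed.

Lemma niceM f (g : phase -> R) C : nice f -> continuous g ->
  (forall (k : 'rV[int]_d) x v, g (x + intvec k, v) = g (x, v)) ->
  (forall z, `|g z| <= C * weight z) -> nice (fun z => g z * f z).
Proof.
move=> [cf pf df] cg pg gC; split.
- by move=> z; apply: cvgM; [exact: cg|exact: cf].
- by move=> k x v; rewrite pf pg.
- move=> n; have [M hM] := df n.+1; exists (C * M) => z.
  have w0 : 0 <= weight z ^+ n by rewrite exprn_ge0// ltW// weight_gt0.
  have C0 : 0 <= C.
    by have := le_trans (normr_ge0 _) (gC z); rewrite pmulr_lge0// weight_gt0.
  rewrite normrM mulrCA; apply: (@le_trans _ _ (C * weight z * (weight z ^+ n * `|f z|))).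
    by rewrite ler_wpM2r// mulr_ge0.
  by rewrite -mulrA ler_wpM2l// mulrA -exprS.
Qed.

Lemma nice_mul f g : nice f -> nice g -> nice (fun z => f z * g z).
Proof.
move=> nf ng; have [M hM] := nice_bounded nf; case: nf => cf pf _.
apply: (@niceM g f `|M|) => // z; rewrite (le_trans (hM z))//.
by rewrite (le_trans (ler_norm M))// ler_peMr// weight_ge1.
Qed.

Definition ph (p : tup * tup) : phase := (vec p.1, vec p.2).

Lemma measurable_nice f : continuous f -> measurable_fun setT (f \o ph).
Proof.
move=> cf; apply: (measurable_fun_continuous_phase (X := fun p => vec p.1)
  (Y := fun p => vec p.2)) => // j.
- rewrite (_ : (fun _ => _) = (fun p : tup * tup => tnth p.1 j)).
    exact: (measurableT_comp (measurable_tnth j) measurable_fst).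
  by apply/funext => p; rewrite mxE.
- rewrite (_ : (fun _ => _) = (fun p : tup * tup => tnth p.2 j)).
    exact: (measurableT_comp (measurable_tnth j) measurable_snd).
  by apply/funext => p; rewrite mxE.
Qed.

(** Each 1 + v_i^2 is at most the weight, so d powers of the weight pay for the whole product
    envelope. *)
Lemma nice_env f : nice f ->
  exists C, forall p, `|(f \o ph) p| <= C * env_bracket p.2.
Proof.
move=> [_ _ /(_ d)[M hM]]; exists M => p.
rewrite /= /env_bracket /env /bracket prodfV ler_pdivlMr.
  rewrite [leLHS]mulrC; apply: le_trans (hM (ph p)); apply: ler_wpM2r => //.
  apply: (@le_trans _ _ (\prod_(i < d) weight (ph p))); last first.
    by rewrite prodr_const card_ord.
  apply: ler_prod => i _; rewrite addr_ge0 ?sqr_ge0//=.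
  by have := coord_le_weight (ph p) i; rewrite mxE.
by apply: prodr_gt0 => i _; rewrite ltr_pwDl ?sqr_ge0.
Qed.

Lemma nice_integrable f : nice f -> mu.-integrable setT (EFin \o (f \o ph)).
Proof.
move=> nf; have [C hC] := nice_env nf; case: nf => cf _ _.
by apply: (@integrable_phase _ _ _ C) => //; exact: measurable_nice.
Qed.

Lemma nice_decay f : nice f -> exists C, forall z i, `|f z| <= C * bracket (z.2 0 i).
Proof.
move=> [_ _ /(_ 1)[M hM]]; exists M => z i.
have h0 : 0 < 1 + z.2 0 i ^+ 2 by rewrite ltr_pwDl ?sqr_ge0.
rewrite /bracket ler_pdivlMr// [leLHS]mulrC; apply: le_trans (hM z); rewrite expr1.
apply: ler_wpM2r => //; exact: coord_le_weight.
Qed.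

Lemma continuous_line (v z : phase) : continuous (fun a : R => z + a *: v).
Proof.
by move=> a; apply: cvgD; [exact: cvg_cst|apply: cvgZr_tmp; exact: cvg_id].
Qed.

Lemma continuous_slice f z v : continuous f -> continuous (fun a : R => f (z + a *: v)).
Proof.
by move=> cf a; apply: continuous_comp; [exact: continuous_line|exact: cf].
Qed.

Lemma intvec_delta i : intvec (delta_mx 0 i) = delta_mx 0 i :> 'rV[R]_d.
Proof. by apply/rowP => j; rewrite !mxE; case: (_ && _). Qed.

Definition base (p : tup * tup) (i : 'I_d + 'I_d) : phase :=
  match i with
  | inl j => (vec p.1 - tnth p.1 j *: delta_mx 0 j, vec p.2)
  | inr j => (vec p.1, vec p.2 - tnth p.2 j *: delta_mx 0 j)
  end.

Lemma ph_tset_l t s i a : ph (tset t i a, s) = base (t, s) (inl i) + a *: dir (inl i).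
Proof. by rewrite /ph /= vec_tset; congr (_, _); rewrite /= scaler0 addr0. Qed.

Lemma ph_tset_r t s i a : ph (t, tset s i a) = base (t, s) (inr i) + a *: dir (inr i).
Proof. by rewrite /ph /= vec_tset; congr (_, _); rewrite /= scaler0 addr0. Qed.

(** In position the primitive has equal values at both ends of [0, 1], because [dir (inl i)] is an
    integer vector and f is periodic; in velocity the boundary values vanish by decay. *)
Lemma integral_derive i f g : nice f -> nice g ->
  (forall z, is_derive z (dir i) f (g z)) -> (\int[mu]_p (g (ph p))%:E = 0)%E.
Proof.
move=> nf ng dfg; have [C gC] := nice_env ng.
have cf : continuous f by case: nf.
have cg : continuous g by case: ng.
have mg := measurable_nice cg.
have dline z (a : R) : is_derive a 1 (fun a => f (z + a *: dir i)) (g (z + a *: dir i)).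
  exact: is_derive_line.
case: i dfg dline => i dfg dline.
  apply: (@integral_phase_slicex _ _ (g \o ph) C mg gC i) => t s /=.
  under eq_integral do rewrite ph_tset_l.
  set z := base _ _.
  rewrite integral_mI; last first.
    by apply/measurable_EFinP; apply: continuous_measurable_fun; exact: continuous_slice.
  rewrite (@integral_derivative _ (fun a => f (z + a *: dir (inl i)))
     (fun a => g (z + a *: dir (inl i))))//; last exact: continuous_slice.
  rewrite scale1r scale0r addr0; have [_ per _] := nf.
  have -> : z + dir (inl i) = (z.1 + intvec (delta_mx 0 i), z.2).
    rewrite [z]surjective_pairing; congr (_, _) => /=; last by rewrite addr0.
    by rewrite intvec_delta.
  by rewrite per -surjective_pairing subrr.
apply: (@integral_phase_slicev _ _ (g \o ph) C mg gC i) => t s /=.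
under eq_integral do rewrite ph_tset_r.
set z := base _ _.
have zi a : (z + a *: dir (inr i)).2 0 i = a.
  by rewrite /z /= !mxE !eqxx mulr1 subrr add0r mulr1.
have [C1 hC1] := nice_decay nf; have [C2 hC2] := nice_decay ng.
apply: (@integral_derivative_decay _ (fun a => f (z + a *: dir (inr i))) _ (`|C1| + `|C2|)) => //.
- exact: continuous_slice.
- move=> a; rewrite (le_trans (hC2 _ i))// zi ler_wpM2r ?bracket_ge0//.
  by rewrite (le_trans (ler_norm _))// lerDr.
- move=> a; rewrite (le_trans (hC1 _ i))// zi ler_wpM2r ?bracket_ge0//.
  by rewrite (le_trans (ler_norm _))// lerDl.
Qed.

Lemma nice_shift f (y : 'rV[R]_d) : nice f -> nice (fun z => f (z.1 + y, z.2)).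
Proof.
move=> [cf pf df]; split.
- move=> z; apply: continuous_comp; last exact: cf.
  have -> : (fun z : phase => (z.1 + y, z.2)) = (fun z => z + (y, 0)).
    by apply/funext => -[x v]; congr (_, _); rewrite /= addr0.
  by apply: cvgD; [exact: cvg_id|exact: cvg_cst].
- by move=> k x v /=; rewrite addrAC pf.
- by move=> n; have [M hM] := df n; exists M => z; exact: (hM (z.1 + y, z.2)).
Qed.

Lemma integral_shift f (i : 'I_d) h : nice f ->
  (\int[mu]_p (f (vec p.1 + h *: delta_mx 0 i, vec p.2))%:E =
   \int[mu]_p (f (ph p))%:E)%E.
Proof.
move=> nf; pose fh z := f (z.1 + h *: delta_mx 0 i, z.2).
have nfh : nice fh by exact: nice_shift.
have cf : continuous f by case: nf.
have cfh : continuous fh by case: nfh.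
pose g z := -1 * f z + fh z.
have ng : nice g by exact: niceP.
have [C gC] := nice_env ng.
have mg : measurable_fun setT (g \o ph) by apply: measurable_nice; case: ng.
have : (\int[mu]_p (g (ph p))%:E = 0)%E.
  apply: (@integral_phase_slicex _ _ (g \o ph) C mg gC i) => t s /=.
  under eq_integral do rewrite ph_tset_l.
  set z := base _ _; have cg : continuous g by case: ng.
  rewrite integral_mI; last first.
    by apply/measurable_EFinP; apply: continuous_measurable_fun; exact: continuous_slice.
  pose F a := f (z + a *: dir (inl i)).
  have cF : continuous F by exact: continuous_slice.
  have cFh : continuous (fun a => F (a + h)).
    move=> a; apply: continuous_comp; last exact: cF.
    by apply: cvgD; [exact: cvg_id|exact: cvg_cst].
  have gE a : g (z + a *: dir (inl i)) = F (a + h) - F a.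
    rewrite /g mulN1r addrC /F; congr (_ - _); rewrite /fh; congr f.
    rewrite [RHS]surjective_pairing; congr (_, _) => /=.
      by rewrite scalerDl addrA.
    by rewrite !scaler0.
  transitivity (\int[lam]_(a in `[0%R, 1%R]) ((F (a + h))%:E - (F a)%:E))%E.
    by apply: eq_integral => a _; rewrite gE EFinB.
  rewrite integralB//=; last 2 first.
  - exact: (continuous_compact_integrable (@segment_compact _ _ _) (continuous_subspaceT cFh)).
  - exact: (continuous_compact_integrable (@segment_compact _ _ _) (continuous_subspaceT cF)).
  rewrite integral_periodic_shift//; last first.
    move=> a; rewrite /F scalerDl scale1r addrA; have [_ per _] := nf.
    set y := z + _; have -> : y + dir (inl i) = (y.1 + intvec (delta_mx 0 i), y.2).
      rewrite [y]surjective_pairing; congr (_, _) => /=; last by rewrite addr0.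
      by rewrite intvec_delta.
    by rewrite per -surjective_pairing.
  rewrite subee//; apply: integrable_fin_num => //.
  exact: (continuous_compact_integrable (@segment_compact _ _ _) (continuous_subspaceT cF)).
under eq_integral do rewrite /g mulN1r addrC EFinB.
rewrite integralB//=; [|exact: (nice_integrable nfh)|exact: (nice_integrable nf)].
move/eqP; rewrite sube_eq ?add0e; [move/eqP => //| |].
  by apply: integrable_fin_num => //; exact: (nice_integrable nfh).
by apply: fin_num_adde_defl; apply: integrable_fin_num => //; exact: (nice_integrable nf).
Qed.

End nice_functions.

(** * Symmetry of mixed derivatives *)

Section clairaut.
Context {R : realType} (d : nat).
Notation phase := ('rV[R]_d * 'rV[R]_d)%type.
Implicit Types (f g : phase -> R) (a b z : phase).

Lemma is_derive_line0 f g v : (forall z, is_derive z v f (g z)) ->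
  forall z (s : R), is_derive s 1 (fun s => f (z + s *: v)) (g (z + s *: v)).
Proof. by move=> H z s; exact: is_derive_line. Qed.

Lemma MVT_line f g v z (h : R) : 0 <= h -> (forall z, is_derive z v f (g z)) ->
  exists2 s, 0 <= s <= h & f (z + h *: v) - f z = g (z + s *: v) * h.
Proof.
move=> h0 H; have dl := is_derive_line0 H z.
have cl : {within `[0, h], continuous (fun s : R => f (z + s *: v))}.
  by apply: derivable_within_continuous => s _; have [] := dl s.
have [s] := MVT_segment h0 (fun s _ => dl s) cl.
by rewrite in_itv/= scale0r addr0 subr0 => sh E; exists s.
Qed.

Lemma mixed_difference f fa fab a b z (h : R) : 0 <= h ->
  (forall z, is_derive z a f (fa z)) -> (forall z, is_derive z b fa (fab z)) ->
  exists s t : R, [/\ 0 <= s <= h, 0 <= t <= h &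
    f (z + h *: b + h *: a) - f (z + h *: a) - (f (z + h *: b) - f z) =
    fab (z + s *: a + t *: b) * h ^+ 2].
Proof.
move=> h0 dfa dfab.
pose phi z := f (z + h *: b) - f z; pose dphi z := fa (z + h *: b) - fa z.
have dphiP z' : is_derive z' a phi (dphi z').
  apply: is_deriveB.
  have [d1 d2] := dfa (z' + h *: b).
  have E : (fun k : R => k^-1 *: (((fun z => f (z + h *: b)) \o shift z') (k *: a) - f (z' + h *: b)))
      = (fun k => k^-1 *: ((f \o shift (z' + h *: b)) (k *: a) - f (z' + h *: b))).
    by apply/funext => k /=; rewrite addrA.
  by apply: DeriveDef; rewrite /derivable /derive E.
have [s sh E] := MVT_line z h0 dphiP.
have [t th E'] := MVT_line (z + s *: a) h0 dfab.
exists s, t; split => //.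
by rewrite expr2 mulrA -E' -E /phi [z + h *: b + _]addrAC.
Qed.

(** One and the same second difference equals h^2 [fab] at a point near z and h^2 [fba] at another,
    by the mean value theorem in the two orders. Continuity at z concludes, from directional
    derivatives alone. *)
Lemma mixed_derivatives f fa fb fab fba a b :
  (forall z, is_derive z a f (fa z)) -> (forall z, is_derive z b fa (fab z)) ->
  (forall z, is_derive z b f (fb z)) -> (forall z, is_derive z a fb (fba z)) ->
  continuous fab -> continuous fba -> fab =1 fba.
Proof.
move=> dfa dfab dfb dfba cab cba z.
apply/eqP; rewrite -subr_eq0 -normr_le0; apply/ler_addgt0Pr => e e0; rewrite add0r.
have e20 : 0 < e / 2 by rewrite divr_gt0.
have /cvgrPdist_le/(_ _ e20)/nbhs_ballP[r1 /= r10 h1] := cab z.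
have /cvgrPdist_le/(_ _ e20)/nbhs_ballP[r2 /= r20 h2] := cba z.
(* The parallelogram at z with sides h a and h b then lies in both balls; the 1 keeps the
   denominator positive. *)
pose h := Num.min r1 r2 / 2 / (`|a| + `|b| + 1).
have r0 : 0 < Num.min r1 r2 by rewrite lt_min r10.
have ab0 : 0 < `|a| + `|b| + 1 by rewrite ltr_wpDl// addr_ge0.
have h0 : 0 < h by rewrite !divr_gt0.
have hab s t : 0 <= s <= h -> 0 <= t <= h -> `|s *: a + t *: b| < Num.min r1 r2.
  move=> /andP[s0 sh] /andP[t0 th]; rewrite (le_lt_trans (ler_normD _ _))// !normrZ !ger0_norm//.
  have h3 : s * `|a| + t * `|b| <= h * (`|a| + `|b| + 1).
    rewrite mulrDr mulrDr mulr1 -[leLHS]addr0; apply: lerD; last exact: ltW.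
    by apply: lerD; apply: ler_wpM2r.
  by apply: (le_lt_trans h3); rewrite /h divfK ?gt_eqF// ltr_pdivrMr// ltr_pMr// ltr1n.
have [s [t [sh th E1]]] := mixed_difference z (ltW h0) dfa dfab.
have [s' [t' [sh' th' E2]]] := mixed_difference z (ltW h0) dfb dfba.
have E : fab (z + s *: a + t *: b) = fba (z + s' *: b + t' *: a).
  apply: (@mulIf _ (h ^+ 2)); first by rewrite expf_neq0// gt_eqF.
  by rewrite -E1 -E2 [z + h *: b + _]addrAC; lra.
have b1 : `|fab z - fab (z + s *: a + t *: b)| <= e / 2.
  apply: h1; rewrite -ball_normE/= -addrA opprD addNKr normrN.
  by rewrite (lt_le_trans (hab _ _ sh th))// ge_min lexx.
have b2 : `|fba z - fba (z + s' *: b + t' *: a)| <= e / 2.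
  apply: h2; rewrite -ball_normE/= -addrA opprD addNKr normrN addrC.
  by rewrite (lt_le_trans (hab _ _ th' sh'))// ge_min lexx orbT.
rewrite E in b1.
rewrite (_ : fab z - fba z = (fab z - fba (z + s' *: b + t' *: a)) -
   (fba z - fba (z + s' *: b + t' *: a))); last by ring.
by rewrite (le_trans (ler_normB _ _))// (le_trans (lerD b1 b2))// -splitr.
Qed.

End clairaut.

Section smooth_functions.
Context {R : realType} (d : nat).
Notation phase := ('rV[R]_d * 'rV[R]_d)%type.
Implicit Types (f g : phase -> R) (z : phase) (i : 'I_d + 'I_d).

Definition pdr i f z : R := 'D_(dir i) f z.

(** Counting the derivatives lets stability under sums, [mulv] and translations be proved by
    induction on m; [smooth_nice] then takes all m. *)
Fixpoint nice_upto m f : Prop :=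
  nice f /\ if m is m'.+1 then
    forall i, (forall z, derivable f z (dir i)) /\ nice_upto m' (pdr i f)
  else True.

Definition smooth_nice f := forall m, nice_upto m f.

Lemma smooth_niceW f : smooth_nice f -> nice f.
Proof. by move=> /(_ 0)[]. Qed.

Lemma smooth_derive f i z : smooth_nice f -> is_derive z (dir i) f (pdr i f z).
Proof. by move=> /(_ 1)[_ /(_ i)[H _]]; exact: derivableP. Qed.

Lemma nice_uptoW m f : nice_upto m.+1 f -> nice_upto m f.
Proof.
elim: m f => [|m IH] f [nf hf]; split => // i.
by have [df sf] := hf i; split => //; exact: IH.
Qed.

Lemma smooth_pdr f i : smooth_nice f -> smooth_nice (pdr i f).
Proof. by move=> H m; have [_ /(_ i)[]] := H m.+1. Qed.

Lemma nice_upto0 m : nice_upto m (fun=> 0).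
Proof.
elim: m => [|m IH]; split => //; try exact: nice0.
move=> i; split; first by move=> z; exact: derivable_cst.
by rewrite (_ : pdr i _ = fun=> 0)//; apply/funext => z; rewrite /pdr derive_cst.
Qed.

Lemma is_derive_lin (c : R) f g (df dg : R) z v : is_derive z v f df -> is_derive z v g dg ->
  is_derive z v (fun z => c * f z + g z) (c * df + dg).
Proof. by move=> hf hg; exact: (is_deriveD (is_deriveZ c hf) hg). Qed.

Lemma nice_uptoP m (c : R) f g : nice_upto m f -> nice_upto m g ->
  nice_upto m (fun z => c * f z + g z).
Proof.
elim: m f g => [|m IH] f g [nf hf] [ng hg]; split => //; try exact: niceP.
move=> i; have [df sf] := hf i; have [dg sg] := hg i.
have dfg z := is_derive_lin c (derivableP (df z)) (derivableP (dg z)).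
split; first by move=> z; have [] := dfg z.
rewrite (_ : pdr i _ = fun z => c * pdr i f z + pdr i g z); first exact: IH.
by apply/funext => z; have [_] := dfg z.
Qed.

Lemma is_derive_coord (j : 'I_d) z v : is_derive z v (fun z : phase => z.2 0 j) (v.2 0 j).
Proof.
have E : (fun h : R => h^-1 *: (((fun z : phase => z.2 0 j) \o shift z) (h *: v) - z.2 0 j))
    = fun h => h^-1 * (h * v.2 0 j).
  by apply/funext => h /=; rewrite !mxE addrK.
have H : (fun h : R => h^-1 * (h * v.2 0 j)) @ (0 : R)^' --> v.2 0 j.
  apply: cvg_near_cst; near=> h; rewrite mulKf//.
  by near: h; exact: nbhs_dnbhs_neq.
apply: DeriveDef; rewrite /derivable /derive E.
  by apply/cvg_ex; exists (v.2 0 j).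
exact: cvg_lim.
Unshelve. all: by end_near. Qed.

Definition mulv (j : 'I_d) f z : R := z.2 0 j * f z.

Lemma continuous_coord (j : 'I_d) : continuous (fun z : phase => z.2 0 j).
Proof.
move=> z; apply: (@continuous_comp _ _ _ (fun z : phase => z.2) (fun v : 'rV[R]_d => v 0 j)).
  exact: cvg_snd.
exact: coord_continuous.
Qed.

Lemma nice_mulv j f : nice f -> nice (mulv j f).
Proof.
move=> nf; apply: (@niceM _ _ f _ 1) => //; first exact: continuous_coord.
move=> z; rewrite mul1r; have := coord_le_weight z j.
have : 0 <= (`|z.2 0 j| - 1) ^+ 2 by rewrite sqr_ge0.
have : `|z.2 0 j| ^+ 2 = z.2 0 j ^+ 2 by rewrite real_normK// num_real.
have := normr_ge0 (z.2 0 j); rewrite sqrrB1; lra.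
Qed.

Lemma is_derive_mulv (j : 'I_d) f df z v : is_derive z v f df ->
  is_derive z v (mulv j f) (v.2 0 j * f z + z.2 0 j * df).
Proof.
move=> hf; have [d1 d2] := is_deriveM (is_derive_coord j z v) hf.
apply: (DeriveDef (d1 : derivable (mulv j f) z v)); apply: (etrans d2).
by rewrite addrC /GRing.scale/= [f z * _]mulrC.
Qed.

Lemma nice_upto_mulv m j f : nice_upto m f -> nice_upto m (mulv j f).
Proof.
elim: m f => [|m IH] f [nf hf]; split => //; try exact: nice_mulv.
move=> i; have [df sf] := hf i.
have dj z := is_derive_mulv j (derivableP (df z)).
split; first by move=> z; have [] := dj z.
rewrite (_ : pdr i _ = fun z => (dir i : phase).2 0 j * f z + mulv j (pdr i f) z).
  apply: nice_uptoP; last exact: IH.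
  exact: (@nice_uptoW m f (conj nf hf)).
by apply/funext => z; have [_] := dj z.
Qed.

Definition shiftx (y : 'rV[R]_d) f z : R := f (z.1 + y, z.2).

Lemma is_derive_shiftx y f df z v : is_derive (z.1 + y, z.2) v f df ->
  is_derive z v (shiftx y f) df.
Proof.
have E : (fun h : R => h^-1 *: ((shiftx y f \o shift z) (h *: v) - shiftx y f z)) =
    (fun h => h^-1 *: ((f \o shift (z.1 + y, z.2)) (h *: v) - f (z.1 + y, z.2))).
  apply/funext => h /=; rewrite /shiftx /=; congr (_ *: (f (_, _) - _)).
  by rewrite addrA.
by case=> d1 d2; apply: DeriveDef; rewrite /derivable /derive E.
Qed.

Lemma pdr_shiftx y f i : (forall z, derivable f z (dir i)) ->
  pdr i (shiftx y f) = shiftx y (pdr i f).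
Proof.
move=> df; apply/funext => z.
by have [_] := is_derive_shiftx (derivableP (df (z.1 + y, z.2))).
Qed.

Lemma nice_upto_shiftx m y f : nice_upto m f -> nice_upto m (shiftx y f).
Proof.
elim: m f => [|m IH] f [nf hf]; split => //; try exact: nice_shift.
move=> i; have [df sf] := hf i; split.
  by move=> z; have [] := is_derive_shiftx (derivableP (df (z.1 + y, z.2))).
by rewrite pdr_shiftx//; exact: IH.
Qed.

Lemma pdrC f i j : smooth_nice f -> pdr i (pdr j f) = pdr j (pdr i f).
Proof.
move=> sf; apply/funext; apply: (mixed_derivatives
  (fun z => smooth_derive j z sf) (fun z => smooth_derive i z (smooth_pdr j sf))
  (fun z => smooth_derive i z sf) (fun z => smooth_derive j z (smooth_pdr i sf))).
- by case: (smooth_niceW (smooth_pdr i (smooth_pdr j sf))).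
- by case: (smooth_niceW (smooth_pdr j (smooth_pdr i sf))).
Qed.

Lemma pdr_mulv f i j : smooth_nice f ->
  pdr i (mulv j f) = fun z => (dir i : phase).2 0 j * f z + mulv j (pdr i f) z.
Proof.
by move=> sf; apply/funext => z; have [_] := is_derive_mulv j (smooth_derive i z sf).
Qed.

Lemma pdrP (c : R) f g i : smooth_nice f -> smooth_nice g ->
  pdr i (fun z => c * f z + g z) = fun z => c * pdr i f z + pdr i g z.
Proof.
move=> sf sg; apply/funext => z.
by have [_] := is_derive_lin c (smooth_derive i z sf) (smooth_derive i z sg).
Qed.

End smooth_functions.

(** * Sets of functions as modules *)

Section function_space.
Context {R : realType} {T : Type}.

(** The single rule a f + g, with 0, yields sum, opposite and scaling at once; proof irrelevance
    makes equality in [elt] pointwise. *)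
Record linset := Linset {
  lpred :> (T -> R) -> Prop;
  lpred0 : lpred (fun=> 0);
  lpredP : forall a f g, lpred f -> lpred g -> lpred (fun t => a * f t + g t) }.

Record elt (P : linset) := Elt { efun :> T -> R; eltP : P efun }.

Variable P : linset.

Lemma elt_eq (f g : elt P) : f =1 g -> f = g.
Proof.
case: f g => [f Pf] [g Pg] /= /funext fg; subst g.
by rewrite (Prop_irrelevance Pf Pg).
Qed.

HB.instance Definition _ := gen_eqMixin (elt P).
HB.instance Definition _ := gen_choiceMixin (elt P).

Definition elt_lin (a : R) (f g : elt P) : elt P :=
  Elt (lpredP a (eltP f) (eltP g)).
Definition elt0 : elt P := Elt (lpred0 P).
Definition eltD (f g : elt P) := elt_lin 1 f g.
Definition eltN (f : elt P) := elt_lin (- 1) f elt0.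
Definition eltZ a (f : elt P) := elt_lin a f elt0.

Let addA : associative eltD.
Proof. by move=> f g h; apply: elt_eq => t /=; rewrite !mul1r addrA. Qed.
Let addC : commutative eltD.
Proof. by move=> f g; apply: elt_eq => t /=; rewrite !mul1r addrC. Qed.
Let add0 : left_id elt0 eltD.
Proof. by move=> f; apply: elt_eq => t /=; rewrite mulr0 add0r. Qed.
Let addN : left_inverse elt0 eltN eltD.
Proof. by move=> f; apply: elt_eq => t /=; rewrite mul1r addr0 mulN1r addNr. Qed.

HB.instance Definition _ := GRing.isZmodule.Build (elt P) addA addC add0 addN.

Let scaleA a b (f : elt P) : eltZ a (eltZ b f) = eltZ (a * b) f.
Proof. by apply: elt_eq => t /=; rewrite !addr0 mulrA. Qed.
Let scale1 : left_id 1 eltZ.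
Proof. by move=> f; apply: elt_eq => t /=; rewrite mul1r addr0. Qed.
Let scaleDr : right_distributive eltZ +%R.
Proof. by move=> a f g; apply: elt_eq => t /=; rewrite !mul1r !addr0 mulrDr. Qed.
Let scaleDl (f : elt P) : {morph eltZ^~ f : a b / a + b}.
Proof. by move=> a b; apply: elt_eq => t /=; rewrite mul1r !addr0 mulrDl. Qed.

HB.instance Definition _ :=
  GRing.Zmodule_isLmodule.Build R (elt P) scaleA scale1 scaleDr scaleDl.

Lemma eltDE (f g : elt P) t : (f + g) t = f t + g t.
Proof. by rewrite /= mul1r. Qed.
Lemma eltZE a (f : elt P) t : (a *: f) t = a * f t.
Proof. by rewrite /= addr0. Qed.
Lemma eltNE (f : elt P) t : (- f) t = - f t.
Proof. by rewrite /= mulN1r addr0. Qed.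
Lemma elt_sumE (I : Type) (r : seq I) (p : pred I) (F : I -> elt P) t :
  (\sum_(i <- r | p i) F i) t = \sum_(i <- r | p i) F i t.
Proof. by elim/big_rec2: _ => // i y x _ <-; rewrite eltDE. Qed.

End function_space.

Section lift.
Context {R : realType} {T : Type} (P Q : @linset R T).
Variable phi : (T -> R) -> T -> R.
Hypothesis PQ : forall f, P f -> Q (phi f).
Hypothesis phi_lin : forall a f g, P f -> P g ->
  phi (fun t => a * f t + g t) = fun t => a * phi f t + phi g t.

Definition lift_fun (f : elt P) : elt Q := Elt (PQ (eltP f)).

Lemma lift_fun_linear : linear lift_fun.
Proof.
move=> a f g; apply: elt_eq => t; rewrite eltDE eltZE.
change (phi (efun (a *: f + g)) t = a * phi f t + phi g t).
have -> : efun (a *: f + g) = fun t => a * f t + g t.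
  by apply/funext => s; rewrite eltDE eltZE.
by rewrite phi_lin//; exact: eltP.
Qed.

HB.instance Definition _ := GRing.isLinear.Build R (elt P) (elt Q) _ lift_fun lift_fun_linear.

Definition lift : {linear elt P -> elt Q} := lift_fun.

End lift.

(** * The real-valued model *)

Section model.
Context {R : realType} (d : nat).
Notation tup := (d.-tuple (measurableTypeR R)).
Notation mu := (@torus_measure R d \x @velocity_measure R d)%E.
Notation phase := ('rV[R]_d * 'rV[R]_d)%type.

Definition nice_linset : @linset R phase := @Linset R phase (@nice R d) (@nice0 R d) (@niceP R d).

Definition smooth_linset : @linset R phase :=
  @Linset R phase (@smooth_nice R d) (fun m => @nice_upto0 R d m)
    (fun a f g sf sg m => nice_uptoP a (sf m) (sg m)).

Notation V := (elt nice_linset).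
Notation S := (elt smooth_linset).

Definition inj : {linear S -> V} :=
  @lift R phase smooth_linset nice_linset id (@smooth_niceW R d) (fun _ _ _ _ _ => erefl).

Definition pdS (i : 'I_d + 'I_d) : {linear S -> S} :=
  @lift R phase smooth_linset smooth_linset (pdr i) (fun f sf => smooth_pdr i sf)
    (fun a f g sf sg => pdrP a i sf sg).

Definition mulS (j : 'I_d) : {linear S -> S}.
Proof.
apply: (@lift R phase smooth_linset smooth_linset (mulv j)).
  by move=> f sf m; apply: nice_upto_mulv; exact: sf.
by move=> a f g _ _; apply/funext => z; rewrite /mulv; ring.
Defined.

Definition shV (y : 'rV[R]_d) : {linear V -> V} :=
  @lift R phase nice_linset nice_linset (shiftx y) (fun f nf => nice_shift y nf)
    (fun _ _ _ _ _ => erefl).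

Definition shS (y : 'rV[R]_d) : {linear S -> S} :=
  @lift R phase smooth_linset smooth_linset (shiftx y)
    (fun f sf m => nice_upto_shiftx y (sf m)) (fun _ _ _ _ _ => erefl).

(** On [nice] functions the integral is finite and [fine] loses nothing. *)
Definition Iint (f : phase -> R) : R := fine (\int[mu]_p (f (ph p))%:E).

Lemma Iint_lin a f g : nice f -> nice g ->
  Iint (fun z => a * f z + g z) = a * Iint f + Iint g.
Proof.
move=> nf ng; rewrite /Iint.
have ff := integrable_fin_num measurableT (nice_integrable nf).
have fg := integrable_fin_num measurableT (nice_integrable ng).
under eq_integral do rewrite EFinD EFinM.
rewrite integralD//=; [|apply: integrableZl => //; exact: (nice_integrable nf)|
  exact: (nice_integrable ng)].
rewrite integralZl//; last exact: (nice_integrable nf).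
by rewrite fineD ?fin_numM// fineM.
Qed.

Lemma Iint_ge0 f : (forall z, 0 <= f z) -> 0 <= Iint f.
Proof. by move=> f0; apply/fine_ge0/integral_ge0 => p _; rewrite lee_fin. Qed.

Lemma Iint_le f g : nice f -> nice g -> (forall z, f z <= g z) -> Iint f <= Iint g.
Proof.
move=> nf ng fg; rewrite -subr_ge0 addrC -mulN1r -Iint_lin//.
by apply: Iint_ge0 => z; rewrite mulN1r addrC subr_ge0.
Qed.

Lemma eq_Iint f g : f =1 g -> Iint f = Iint g.
Proof. by move=> /funext ->. Qed.

Let ipf (f g : V) := Iint (fun z => f z * g z).

Let ipfC f g : ipf f g = ipf g f.
Proof. by apply: eq_Iint => z; rewrite mulrC. Qed.

Let ipfDl f g h : ipf (f + g) h = ipf f h + ipf g h.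
Proof.
rewrite -[ipf f h]mul1r -Iint_lin; [|exact: nice_mul (eltP f) (eltP h)|
  exact: nice_mul (eltP g) (eltP h)].
by apply: eq_Iint => z; rewrite eltDE; ring.
Qed.

Let ipfZl a f g : ipf (a *: f) g = a * ipf f g.
Proof.
rewrite -[RHS]addr0 -[X in _ = _ + X](_ : Iint (fun=> 0) = 0); last first.
  by rewrite /Iint integral0.
rewrite -Iint_lin; [|exact: nice_mul (eltP f) (eltP g)|exact: nice0].
by apply: eq_Iint => z; rewrite eltZE; ring.
Qed.

Let ipf_ge0 f : 0 <= ipf f f.
Proof. by apply: Iint_ge0 => z; rewrite -expr2 sqr_ge0. Qed.

Definition dotV : semi_inner V := SemiInner ipfC ipfDl ipfZl ipf_ge0.

Definition dotS : semi_inner S := pullback dotV inj.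

Lemma dotVE (f g : V) : dotV f g = Iint (fun z => f z * g z). Proof. by []. Qed.

Lemma nrm_le_pointwise (c : R) (f g : V) : 0 <= c ->
  (forall z, `|f z| <= c * `|g z|) -> nrm dotV f <= c * nrm dotV g.
Proof.
move=> c0 fg; rewrite /nrm -[X in X * _](ger0_norm c0) -sqrtr_sqr -sqrtrM ?sqr_ge0//.
rewrite ler_wsqrtr// !dotVE -[leRHS]addr0 -[X in _ <= _ + X](_ : Iint (fun=> 0) = 0); last first.
  by rewrite /Iint integral0.
rewrite -Iint_lin; [|exact: nice_mul (eltP g) (eltP g)|exact: nice0].
apply: Iint_le; first exact: nice_mul (eltP f) (eltP f).
  by apply: niceP; [exact: nice_mul (eltP g) (eltP g)|exact: nice0].
move=> z; rewrite addr0 -!expr2 -exprMn -[leLHS]real_normK ?num_real//.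
rewrite -[leRHS]real_normK ?num_real// normrM (ger0_norm c0).
by rewrite lerXn2r ?nnegrE ?mulr_ge0.
Qed.

Definition flowV (i : 'I_d) : flow dotV.
Proof.
apply: (@Flow _ _ _ (fun s => shV (s *: delta_mx 0 i))).
- move=> s t u; apply: elt_eq => z /=.
  by rewrite /shiftx /= scalerDl addrA.
- by move=> u; apply: elt_eq => -[x v]; rewrite /= /shiftx /= scale0r addr0.
- move=> s u w; rewrite !dotVE.
  by congr fine; exact: (integral_shift i s (nice_mul (eltP u) (eltP w))).
Defined.

Definition flowS (i : 'I_d) : flow dotS.
Proof.
apply: (@Flow _ _ _ (fun s => shS (s *: delta_mx 0 i))).
- move=> s t u; apply: elt_eq => z /=.
  by rewrite /shiftx /= scalerDl addrA.
- by move=> u; apply: elt_eq => -[x v]; rewrite /= /shiftx /= scale0r addr0.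
- move=> s u w; exact: (fl_iso (flowV i) s (inj u) (inj w)).
Defined.

Notation dX i := (pdS (inl i)).
Notation dV i := (pdS (inr i)).

Lemma inj_fl i s u : inj (flowS i s u) = flowV i s (inj u).
Proof. exact: elt_eq. Qed.

Lemma dir_inr2 (i j : 'I_d) : (dir (inr i) : phase).2 0 j = (i == j)%:R.
Proof. by rewrite mxE eqxx eq_sym. Qed.

Lemma dir_inl2 (i j : 'I_d) : (dir (inl i) : phase).2 0 j = 0.
Proof. by rewrite mxE. Qed.

Lemma pdS_mulS i j u z :
  pdS i (mulS j u) z = mulS j (pdS i u) z + (dir i : phase).2 0 j * u z.
Proof.
change (pdr i (mulv j u) z = mulv j (pdr i u) z + (dir i : phase).2 0 j * u z).
by rewrite pdr_mulv 1?addrC//; exact: (eltP u).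
Qed.

Lemma DM i j u : dV i (mulS j u) = mulS j (dV i u) + (i == j)%:R *: u.
Proof. by apply: elt_eq => z; rewrite pdS_mulS dir_inr2 eltDE eltZE. Qed.

Lemma XMC i j u : dX i (mulS j u) = mulS j (dX i u).
Proof. by apply: elt_eq => z; rewrite pdS_mulS dir_inl2 mul0r addr0. Qed.

Lemma MMC i j u : mulS i (mulS j u) = mulS j (mulS i u).
Proof. by apply: elt_eq => z; rewrite /= /mulv; ring. Qed.

Lemma pdSC i j u : pdS i (pdS j u) = pdS j (pdS i u).
Proof.
apply: elt_eq => z; change (pdr i (pdr j u) z = pdr j (pdr i u) z).
by rewrite pdrC//; exact: (eltP u).
Qed.

Lemma M_adj i u w : dotS (mulS i u) w = dotS u (mulS i w).
Proof. by apply: eq_Iint => z; rewrite /= /mulv; ring. Qed.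

Lemma pdS_adj i u w : dotS (pdS i u) w = - dotS u (pdS i w).
Proof.
apply/eqP; rewrite -addr_eq0 -[X in X + _]mul1r; apply/eqP.
have nuw := nice_mul (smooth_niceW (eltP (pdS i u))) (smooth_niceW (eltP w)).
have nwu := nice_mul (smooth_niceW (eltP u)) (smooth_niceW (eltP (pdS i w))).
pose g z := 1 * (pdS i u z * w z) + u z * pdS i w z.
transitivity (Iint g); first by rewrite /g Iint_lin.
have ng : nice g by exact: niceP.
have nf : nice (fun z => u z * w z).
  exact: nice_mul (smooth_niceW (eltP u)) (smooth_niceW (eltP w)).
suff H z : is_derive z (dir i) (fun z => u z * w z) (g z).
  by rewrite /Iint (integral_derive nf ng H).
have [d1 d2] := is_deriveM (smooth_derive i z (eltP u)) (smooth_derive i z (eltP w)).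
apply: (DeriveDef (d1 : derivable (fun z => u z * w z) z (dir i))); apply: (etrans d2).
by rewrite /g /GRing.scale/= mul1r addrC [w z * _]mulrC.
Qed.

Lemma fl_pdS i s j u : flowS i s (pdS j u) = pdS j (flowS i s u).
Proof.
apply: elt_eq => z.
change (shiftx (s *: delta_mx 0 i) (pdr j u) z = pdr j (shiftx (s *: delta_mx 0 i) u) z).
by rewrite pdr_shiftx// => z'; have [] := smooth_derive j z' (eltP u).
Qed.

Lemma fl_mulS i s j u : flowS i s (mulS j u) = mulS j (flowS i s u).
Proof. exact: elt_eq. Qed.

Lemma flV_per i u : flowV i 1 u = u.
Proof.
apply: elt_eq => -[x v]; change (u (x + 1 *: delta_mx 0 i, v) = u (x, v)).
by rewrite scale1r -intvec_delta; case: (eltP u) => _ ->.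
Qed.

End model.

Section difference_quotient.
Context {R : realType} (d : nat).
Notation tup := (d.-tuple (measurableTypeR R)).
Notation mu := (@torus_measure R d \x @velocity_measure R d)%E.
Notation phase := ('rV[R]_d * 'rV[R]_d)%type.
Notation V := (elt (@nice_linset R d)).
Notation S := (elt (@smooth_linset R d)).

Lemma weight_env (p : tup * tup) : weight (ph p) ^- d <= env_bracket p.2.
Proof.
rewrite /env_bracket /env /bracket prodfV lef_pV2 ?posrE ?exprn_gt0 ?weight_gt0//; last first.
  by apply: prodr_gt0 => i _; rewrite ltr_pwDl ?sqr_ge0.
apply: (@le_trans _ _ (\prod_(i < d) weight (ph p))); last first.
  by rewrite prodr_const card_ord.
apply: ler_prod => i _; rewrite addr_ge0 ?sqr_ge0//=.
by have := coord_le_weight (ph p) i; rewrite mxE.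
Qed.

Lemma integrable_env_bracket :
  mu.-integrable setT (fun p : tup * tup => (env_bracket p.2)%:E).
Proof.
apply: (@integrable_phase _ _ (fun p => env_bracket p.2) 1).
  by apply: measurableT_comp => //; exact: (measurable_env (@measurable_bracket R)).
move=> p; rewrite mul1r ger0_norm//; exact: (env_ge0 (@bracket_ge0 R)).
Qed.

Definition env_mass : R := fine (\int[mu]_p (env_bracket p.2)%:E).

Lemma nrm_le_weight (f : V) (K : R) : 0 <= K ->
  (forall z, (f z) ^+ 2 <= K ^+ 2 * weight z ^- d) ->
  nrm (@dotV R d) f <= K * Num.sqrt env_mass.
Proof.
move=> K0 fK; rewrite /nrm -[X in X * _](ger0_norm K0) -sqrtr_sqr -sqrtrM ?sqr_ge0//.
rewrite ler_wsqrtr// dotVE /Iint -lee_fin.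
have nff := nice_mul (eltP f) (eltP f).
have i1 := integrable_fin_num measurableT (nice_integrable nff).
have i2 := integrable_fin_num measurableT integrable_env_bracket.
rewrite EFinM fineK// fineK// -integralZl//; last exact: integrable_env_bracket.
apply: le_integral => //.
- exact: (nice_integrable nff).
- by apply: integrableZl => //; exact: integrable_env_bracket.
- move=> p _; rewrite lee_fin -expr2 (le_trans (fK _))// ler_wpM2l ?sqr_ge0//.
  exact: weight_env.
Qed.

(** Two mean value steps turn the error into a second x-derivative of u times a number at most 2^-n.
    The weight depends on v only, so the unknown intermediate point does not spoil the decay. *)
Lemma X_quotient (i : 'I_d) (u : S) : exists c : R, forall n,
  nrm (@dotS R d) (2 ^+ n *: dl (@flowS R d i) n u - @pdS R d (inl i) u) <= c * 2 ^- n.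
Proof.
pose u1 := @pdS R d (inl i) u; pose u2 := @pdS R d (inl i) u1.
have n2 := smooth_niceW (eltP u2).
have [_ _ /(_ d)[M1 hM1]] := n2; have [M2 hM2] := nice_bounded n2.
have M10 : 0 <= M1.
  by apply: le_trans (hM1 (0, 0)); rewrite mulr_ge0// exprn_ge0// ltW// weight_gt0.
have M20 : 0 <= M2 by apply: le_trans (hM2 (0, 0)).
(* In the square of the second derivative one factor supplies the decay, by [M1], and the other is
   merely bounded, by [M2]. *)
pose K := Num.sqrt (M1 * M2).
have K2 : K ^+ 2 = M1 * M2 by rewrite sqr_sqrtr// mulr_ge0.
exists (K * Num.sqrt env_mass) => n.
have h0 : 0 < hs R n by rewrite invr_gt0 exprn_gt0.
pose f := (@inj R d) (2 ^+ n *: dl (@flowS R d i) n u - u1).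
rewrite -[leLHS]/(nrm (@dotV R d) f) mulrAC; apply: nrm_le_weight.
  by rewrite mulr_ge0 ?sqrtr_ge0// ltW.
move=> z.
have fE : f z = 2 ^+ n * (u (z + hs R n *: dir (inl i)) - u z) - u1 z.
  rewrite -[f z]/((2 ^+ n *: dl (@flowS R d i) n u - u1) z) eltDE eltNE eltZE.
  rewrite /dl eltDE eltNE; congr (_ * (efun u _ - _) - _).
  by congr (_, _); rewrite /= scaler0 addr0.
have [s /andP[s0 sh] E1] := MVT_line z (ltW h0) (fun z => smooth_derive (inl i) z (eltP u)).
have [t _ E2] := MVT_line z s0 (fun z => smooth_derive (inl i) z (eltP u1)).
have {}fE : f z = u2 (z + t *: dir (inl i)) * s.
  rewrite fE E1 mulrCA /hs mulfV ?mulr1; first exact: E2.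
  by rewrite expf_neq0// pnatr_eq0.
have wE : weight (z + t *: dir (inl i)) = weight z.
  by rewrite /weight /= scaler0 addr0.
have h1 := hM1 (z + t *: dir (inl i)); have h2 := hM2 (z + t *: dir (inl i)).
rewrite fE !exprMn K2 [leRHS]mulrAC; apply: ler_pM; rewrite ?sqr_ge0//; last first.
  by rewrite lerXn2r ?nnegrE// ltW.
rewrite wE in h1.
have w0 : 0 < weight z ^+ d by rewrite exprn_gt0// weight_gt0.
rewrite ler_pdivlMr// -real_normK ?num_real// expr2 mulrAC [_ * weight z ^+ d]mulrC.
by apply: ler_pM => //; rewrite mulr_ge0// ltW.
Qed.

(** The coefficient is to be a component of the field, which may fail to be differentiable in x but
    is constant along velocity directions. *)
Lemma is_derive_cstM (c f : phase -> R) (df : R) z v :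
  (forall h : R, c (h *: v + z) = c z) -> is_derive z v f df ->
  is_derive z v (fun z => c z * f z) (c z * df).
Proof.
move=> cc [d1 d2].
have E : (fun h : R => h^-1 *: (((fun z => c z * f z) \o shift z) (h *: v) - c z * f z)) =
    fun h => c z * (h^-1 *: ((f \o shift z) (h *: v) - f z)).
  by apply/funext => h /=; rewrite cc -mulrBr /GRing.scale/= mulrCA.
have H : (fun h : R => h^-1 *: (((fun z => c z * f z) \o shift z) (h *: v) - c z * f z))
    @ (0 : R)^' --> c z * df.
  by rewrite E -d2; apply: cvgM; [exact: cvg_cst|exact: d1].
apply: DeriveDef; last exact: cvg_lim.
by apply/cvg_ex; exists (c z * df).
Qed.

End difference_quotient.

Section magnetic.
Context {R : realType} (d : nat).
Notation phase := ('rV[R]_d * 'rV[R]_d)%type.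
Notation V := (elt (@nice_linset R d)).
Notation S := (elt (@smooth_linset R d)).
Variable beta : 'I_d -> 'I_d -> 'rV[R]_d -> R.
Variable B0 : R.
Hypothesis beta_cont : forall i j, continuous (beta i j).
Hypothesis beta_per : forall i j (k : 'rV[int]_d) x, beta i j (x + intvec k) = beta i j x.
Hypothesis beta_bd : forall i j x, `|beta i j x| <= B0.
Hypothesis beta_anti : forall i j x, beta j i x = - beta i j x.
Hypothesis beta_lip : forall i j k x (s : R), 0 <= s ->
  `|beta i j (x + s *: delta_mx 0 k) - beta i j x| <= B0 * s.
Hypothesis B0_ge0 : 0 <= B0.

Let beta_nice i j (f : phase -> R) : nice f -> nice (fun z => beta i j z.1 * f z).
Proof.
move=> nf; apply: (@niceM _ _ f (fun z => beta i j z.1) B0) => //.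
- by move=> z; apply: (@continuous_comp _ _ _ fst (beta i j)); [exact: cvg_fst|exact: beta_cont].
- by move=> k x v /=; rewrite beta_per.
- by move=> z; rewrite (le_trans (beta_bd _ _ _))// ler_peMr// weight_ge1.
Qed.

Definition mulb (i j : 'I_d) : {linear V -> V}.
Proof.
apply: (@lift R phase (@nice_linset R d) (@nice_linset R d)
  (fun f z => beta i j z.1 * f z) (@beta_nice i j)).
by move=> a f g _ _; apply/funext => z; ring.
Defined.

Lemma mulbE i j f z : mulb i j f z = beta i j z.1 * f z.
Proof. by []. Qed.

Lemma mulb_anti i j f : mulb j i f = - mulb i j f.
Proof. by apply: elt_eq => z; rewrite eltNE !mulbE beta_anti mulNr. Qed.

Lemma mulb_adj i j f g : (@dotV R d) (mulb i j f) g = (@dotV R d) f (mulb i j g).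
Proof. by apply: eq_Iint => z; rewrite !mulbE; ring. Qed.

Lemma mulb_M i j k (u w : S) :
  (@dotV R d) (mulb i j ((@inj R d) (@mulS R d k u))) ((@inj R d) w) =
  (@dotV R d) (mulb i j ((@inj R d) u)) ((@inj R d) (@mulS R d k w)).
Proof. by apply: eq_Iint => z; rewrite !mulbE /= /mulv; ring. Qed.

Lemma mulb_D i j k (u w : S) :
  (@dotV R d) (mulb i j ((@inj R d) (@pdS R d (inr k) u))) ((@inj R d) w) =
  - (@dotV R d) (mulb i j ((@inj R d) u)) ((@inj R d) (@pdS R d (inr k) w)).
Proof.
apply/eqP; rewrite -addr_eq0 -[X in X + _]mul1r; apply/eqP; rewrite !dotVE.
have nuw := nice_mul (eltP (mulb i j ((@inj R d) (@pdS R d (inr k) u)))) (smooth_niceW (eltP w)).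
have nwu := nice_mul (eltP (mulb i j ((@inj R d) u))) (smooth_niceW (eltP (@pdS R d (inr k) w))).
pose g z := 1 * (mulb i j ((@inj R d) (@pdS R d (inr k) u)) z * w z) +
  mulb i j ((@inj R d) u) z * @pdS R d (inr k) w z.
transitivity (Iint g); first by rewrite /g Iint_lin.
have ng : nice g by exact: niceP.
have nf : nice (fun z => beta i j z.1 * (u z * w z)).
  by apply: beta_nice; exact: nice_mul (smooth_niceW (eltP u)) (smooth_niceW (eltP w)).
suff dg z : is_derive z (dir (inr k)) (fun z => beta i j z.1 * (u z * w z)) (g z).
  by rewrite /Iint (integral_derive nf ng dg).
have [d1 d2] := is_deriveM (smooth_derive (inr k) z (eltP u)) (smooth_derive (inr k) z (eltP w)).
have -> : g z = beta i j z.1 * (u z *: pdr (inr k) w z + w z *: pdr (inr k) u z).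
  by rewrite /g !mulbE /GRing.scale/=; ring.
apply: (@is_derive_cstM _ _ (fun z => beta i j z.1) (fun z => u z * w z)).
  by move=> h; rewrite /= scaler0 add0r.
by apply: (DeriveDef (d1 : derivable (fun z => u z * w z) z (dir (inr k)))); apply: (etrans d2).
Qed.

Lemma nrm_mulb i j f : nrm (@dotV R d) (mulb i j f) <= B0 * nrm (@dotV R d) f.
Proof.
by apply: nrm_le_pointwise => // z; rewrite mulbE normrM ler_wpM2r.
Qed.

Lemma mulb_lip k s i j f : 0 <= s <= 1 ->
  nrm (@dotV R d) (@flowV R d k s (mulb i j f) - mulb i j (@flowV R d k s f)) <=
  B0 * s * nrm (@dotV R d) f.
Proof.
move=> /andP[s0 _]; rewrite -(nrm_fl (@flowV R d k) s f).
apply: nrm_le_pointwise => [|z]; first exact: mulr_ge0.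
rewrite eltDE eltNE mulbE -[@flowV R d k s (mulb i j f) z]/(beta i j (z.1 + s *: delta_mx 0 k) *
  (@flowV R d k s f z)) -mulrBl normrM ler_wpM2r//.
exact: beta_lip.
Qed.

Notation dX := (fun i => @pdS R d (inl i)).
Notation dV := (fun i => @pdS R d (inr i)).
Notation M := (@mulS R d).
Notation H := (oscillator dV M).

Lemma model_oscillator_bound (u : S) (K q C : R) : 0 < K ->
  nrm (@dotV R d) (kinetic (@inj R d) dX dV M mulb u) + nrm (@dotS R d) u <= K ->
  1 < q -> q ^+ 3 = 2 ->
  (forall e : R, 0 < e -> exists n, (q / 2) ^+ n <= e) ->
  (forall (h K : R) (a e : 'I_d -> R), 0 <= h -> 0 < K ->
    (forall i, [/\ 0 <= a i, 0 <= e i,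
       e i ^+ 2 <= direction_cst d B0 q * (K * (a i + (h + K))) &
       a i ^+ 2 <= direction_cst d B0 q * ((h + K) * e i) + K ^+ 2]) ->
    h ^+ 2 <= (1 + 2 * d%:R) * K ^+ 2 + \sum_i a i * e i ->
    h + K <= C * K) ->
  nrm (@dotS R d) (H u) + K <= C * K.
Proof.
move=> K0 uK q1 q3 arch close.
apply: (@oscillator_bound R d S V (@dotV R d) (@dotS R d) (@inj R d) (fun _ _ => erefl)
  dX dV M (@flowV R d) (@flowS R d) mulb B0 (@inj_fl R d) (@DM R d) (@MMC R d)
  (fun i j u => pdSC (inr i) (inr j) u) (fun i j u => pdSC (inr i) (inl j) u)
  (@XMC R d) (fun i u w => pdS_adj (inr i) u w) (fun i u w => pdS_adj (inl i) u w)
  (@M_adj R d) (fun i s j u => fl_pdS i s (inr j) u) (fun i s j u => fl_pdS i s (inl j) u)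
  (@fl_mulS R d) mulb_anti mulb_adj mulb_D mulb_M B0_ge0 nrm_mulb mulb_lip
  (@flV_per R d) (@X_quotient R d) u K K0 uK q C q1 q3 arch close).
Qed.

End magnetic.

(** * The maximal estimate for real functions *)

Section real_estimate.
Context {R : realType}.

Lemma cube_root_two : exists2 q : R, 1 < q & q ^+ 3 = 2.
Proof.
have q3 : (2 `^ 3%:R^-1) ^+ 3 = 2 :> R.
  by rewrite -powR_mulrn ?powR_ge0// -powRrM mulVf ?pnatr_eq0// powRr1.
exists (2 `^ 3%:R^-1) => //; rewrite ltNge; apply/negP => q1.
have : (2 `^ 3%:R^-1) ^+ 3 <= 1 :> R by rewrite exprn_ile1 ?powR_ge0.
by rewrite q3; lra.
Qed.

Lemma geometric_small (r : R) : 0 <= r < 1 ->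
  forall e : R, 0 < e -> exists n, r ^+ n <= e.
Proof.
move=> /andP[r0 r1] e e0.
have /cvgr0Pnorm_le/(_ _ e0)[n _ hn] : (fun n => r ^+ n) @ \oo --> (0 : R).
  by apply: cvg_expr; rewrite ger0_norm.
exists n; have := hn n (leqnn n); rewrite /= ger0_norm//; exact: exprn_ge0.
Qed.

Variables (d : nat) (B0 : R).
Notation phase := ('rV[R]_d * 'rV[R]_d)%type.
Notation V := (elt (@nice_linset R d)).
Notation S := (elt (@smooth_linset R d)).
Notation dX := (fun i => @pdS R d (inl i)).
Notation dV := (fun i => @pdS R d (inr i)).
Notation M := (@mulS R d).
Notation nV := (nrm (@dotV R d)).
Notation nS := (nrm (@dotS R d)).

Record field_bound (beta : 'I_d -> 'I_d -> 'rV[R]_d -> R) := FieldBound {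
  fb_cont : forall i j, continuous (beta i j);
  fb_per : forall i j (k : 'rV[int]_d) x, beta i j (x + intvec k) = beta i j x;
  fb_bd : forall i j x, `|beta i j x| <= B0;
  fb_anti : forall i j x, beta j i x = - beta i j x;
  fb_lip : forall i j k x (s : R), 0 <= s ->
    `|beta i j (x + s *: delta_mx 0 k) - beta i j x| <= B0 * s }.

Hypothesis B0_ge0 : 0 <= B0.

Notation mb fb := (mulb (fb_cont fb) (fb_per fb) (fb_bd fb) B0_ge0).

Definition real_transport beta (fb : field_bound beta) (u : S) : V :=
  @inj R d (free_transport dX M u) - rotation (@inj R d) dV M (mb fb) u.

Definition real_fp beta (fb : field_bound beta) (u : S) : V :=
  kinetic (@inj R d) dX dV M (mb fb) u - (d%:R / 2) *: @inj R d u.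

Lemma real_estimate : exists2 C : R, 1 <= C &
  forall beta (fb : field_bound beta) (u : S) (Q := nV (real_fp fb u) + nS u),
    [/\ nV (real_transport fb u) <= C * Q,
        (forall i j, nS (dV i (dV j u)) <= C * Q),
        (forall i j, nS (M i (M j u)) <= C * Q),
        (forall i j, nS (M i (dV j u)) <= C * Q) &
        (forall i, nS (dV i u) <= C * Q) /\ (forall i, nS (M i u) <= C * Q)].
Proof.
have [q q1 q3] := cube_root_two.
have q0 : 0 < q by exact: lt_trans q1.
have q2 : 0 <= q / 2 < 1.
  rewrite divr_ge0 ?(ltW q0)//= ltr_pdivrMr// mul1r ltNge; apply/negP => h.
  have : 2 ^+ 3 <= q ^+ 3 by rewrite lerXn2r ?nnegrE// ltW.
  by rewrite q3; lra.
have arch := geometric_small q2.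
have qi : 0 <= (1 - q^-1)^-1 by rewrite invr_ge0 subr_ge0 invf_le1// ltW.
have c1_ge0 : 0 <= rotation_cst R d by rewrite /rotation_cst !mulr_ge0// addr_ge0.
have L1 : 1 <= direction_cst d B0 q.
  rewrite /direction_cst -!addrA lerDl !addr_ge0 ?sqrtr_ge0//.
    by repeat apply: mulr_ge0 => //.
  by repeat apply: mulr_ge0 => //; rewrite ?sqrtr_ge0 ?addr_ge0// mulr_ge0.
have [C0 C00 close] := @closing_bound R d _ L1.
have d0 : 0 <= d%:R :> R by [].
(* [D] pays for the shift d / 2 between [real_fp] and [kinetic]; [E] is such that E^2 exceeds 16
   (C0^2 + d / 2) + 4 C0, the constant met in [bound]. *)
pose E := 4 * (C0 + d%:R + 1); pose D := d%:R / 2 + 1 : R.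
have D1 : 1 <= D by rewrite lerDr divr_ge0.
exists (E * D); first by rewrite mulr_ege1// /E; lra.
move=> beta fb u Q.
have u0 : 0 <= nS u by exact: nrm_ge0.
have w0 : 0 <= nV (real_fp fb u) by exact: nrm_ge0.
have Q0 : 0 <= Q by exact: addr_ge0.
pose K := D * Q; have K0 : 0 <= K by apply: mulr_ge0 => //; lra.
have kinE : kinetic (@inj R d) dX dV M (mb fb) u = real_fp fb u + (d%:R / 2) *: @inj R d u.
  by rewrite /real_fp subrK.
have uK : nV (kinetic (@inj R d) dX dV M (mb fb) u) + nS u <= K.
  have h1 : nV (kinetic (@inj R d) dX dV M (mb fb) u) <= nV (real_fp fb u) + d%:R / 2 * nS u.
    rewrite kinE (le_trans (ler_nrmD _ _ _))// nrmZ ger0_norm ?divr_ge0//.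
  have h2 : 0 <= d%:R / 2 * nV (real_fp fb u) by rewrite mulr_ge0// divr_ge0.
  by rewrite /K /D /Q; lra.
pose h := nS (oscillator dV M u).
have h0 : 0 <= h by exact: nrm_ge0.
have hK : h + K <= C0 * K.
  (* [K] may be 0 while the abstract bound wants a positive majorant: it is applied to K + e / C0,
     with e arbitrary. *)
  apply/ler_addgt0Pr => e e0.
  pose eta := e / C0; have eta0 : 0 < eta by rewrite divr_gt0.
  have K'0 : 0 < K + eta by rewrite ltr_wpDl.
  have uK' : nV (kinetic (@inj R d) dX dV M (mb fb) u) + nS u <= K + eta.
    by rewrite (le_trans uK)// lerDl ltW.
  have := model_oscillator_bound (fb_anti fb) (fb_lip fb) K'0 uK' q1 q3 arch close.
  rewrite -/h mulrDr [C0 * eta]mulrC divfK ?gt_eqF// => hh.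
  by apply: le_trans hh; rewrite lerD2l lerDl ltW.
have uK2 : nS u <= K by apply: le_trans uK; rewrite lerDr nrm_ge0.
have E0 : 0 <= E * K by apply: mulr_ge0 => //; rewrite /E; lra.
have hC : h <= C0 * K by apply: le_trans hK; rewrite lerDl.
have h2 : h ^+ 2 <= C0 ^+ 2 * K ^+ 2 by rewrite -exprMn lerXn2r// nnegrE mulr_ge0// ltW.
have u2 : nS u ^+ 2 <= K ^+ 2 by rewrite lerXn2r ?nnegrE.
have hu : h * nS u <= C0 * K ^+ 2.
  by rewrite expr2 mulrA; apply: ler_pM.
have K2 : 0 <= K ^+ 2 by rewrite sqr_ge0.
(* 16 and 4 undo the coefficients 16^-1 of the M M u in [second_order_identity] and 4^-1 of the M u
   in [dot_oscillator]; this one form serves all five families of norms. *)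
have bound x : 0 <= x -> x ^+ 2 <= 16 * (C0 ^+ 2 * K ^+ 2 + d%:R / 2 * K ^+ 2) +
    4 * (C0 * K ^+ 2) -> x <= E * D * Q.
  move=> x0 hx; rewrite -mulrA -/K -(@ler_pXn2r _ 2) ?nnegrE// (le_trans hx)//.
  have -> : 16 * (C0 ^+ 2 * K ^+ 2 + d%:R / 2 * K ^+ 2) + 4 * (C0 * K ^+ 2) =
    (16 * (C0 ^+ 2 + d%:R / 2) + 4 * C0) * K ^+ 2 by ring.
  rewrite [(E * K) ^+ 2]exprMn ler_wpM2r// /E.
  have : 0 <= C0 * d%:R by rewrite mulr_ge0// ltW.
  have : 0 <= d%:R ^+ 2 :> R by rewrite sqr_ge0.
  nra.
have CK : 0 <= C0 * K ^+ 2 by rewrite mulr_ge0// ltW.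
have so : h ^+ 2 + d%:R / 2 * nS u ^+ 2 <= C0 ^+ 2 * K ^+ 2 + d%:R / 2 * K ^+ 2.
  by rewrite lerD// ler_wpM2l// divr_ge0.
have id2 := @second_order_identity R d S (@dotS R d) dV M (@DM R d) (@MMC R d)
  (fun i j u => pdSC (inr i) (inr j) u) (fun i u w => pdS_adj (inr i) u w) (@M_adj R d) u.
rewrite -/h in id2.
have id1 := @dot_oscillator R d S (@dotS R d) dV M
  (fun i u w => pdS_adj (inr i) u w) (@M_adj R d) u.
have dd (F : 'I_d -> 'I_d -> R) i j : (forall i j, 0 <= F i j) -> F i j <= \sum_i \sum_j F i j.
  move=> F0; apply: (le_trans (@ler_sum1 _ _ (F i) j (F0 i))).
  by apply: (@ler_sum1 _ _ (fun i => \sum_j F i j) i) => k; exact: sumr_ge0.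
have pos2 (F : 'I_d -> 'I_d -> S) : 0 <= \sum_i \sum_j nS (F i j) ^+ 2.
  by apply: sumr_ge0 => i _; apply: sumr_ge0 => j _; rewrite sqr_ge0.
have pos1 (F : 'I_d -> S) : 0 <= \sum_i nS (F i) ^+ 2.
  by apply: sumr_ge0 => i _; rewrite sqr_ge0.
have p1 := pos2 (fun i j => dV i (dV j u)); have p2 := pos2 (fun i j => M i (M j u)).
have p3 := pos2 (fun i j => M j (dV i u)).
have p4 := pos1 (fun i => dV i u); have p5 := pos1 (fun i => M i u).
have cs : @dotS R d (oscillator dV M u) u <= h * nS u by exact: ip_le.
split.
- have T := @nrm_transport_le R d S V (@dotV R d) (@dotS R d) (@inj R d) (fun _ _ => erefl) _ _ _ _ _ _ uK.
  rewrite -mulrA -/K (le_trans T)//.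
  rewrite -/h (le_trans hK)// ler_wpM2r// /E; lra.
- move=> i j; apply: bound; first exact: nrm_ge0.
  have := dd (fun i j => nS (dV i (dV j u)) ^+ 2) i j (fun _ _ => sqr_ge0 _); lra.
- move=> i j; apply: bound; first exact: nrm_ge0.
  have := dd (fun i j => nS (M i (M j u)) ^+ 2) i j (fun _ _ => sqr_ge0 _); lra.
- move=> i j; apply: bound; first exact: nrm_ge0.
  have := dd (fun i j => nS (M j (dV i u)) ^+ 2) j i (fun _ _ => sqr_ge0 _); lra.
- split => i; apply: bound; try exact: nrm_ge0.
    have := @ler_sum1 _ _ (fun i => nS (dV i u) ^+ 2) i (fun _ => sqr_ge0 _); nra.
  have := @ler_sum1 _ _ (fun i => nS (M i u) ^+ 2) i (fun _ => sqr_ge0 _); nra.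
Qed.

End real_estimate.

(** * Lipschitz magnetic fields *)

Section mpow_total_mass.
Context dsp (T : measurableType dsp) (R : realType).
Variable m : {sigma_finite_measure set T -> \bar R}.

Lemma mpow_setT_gt0 n : (0 < m setT)%E -> (0 < mpow m n setT)%E.
Proof.
move=> m0; elim: n => [|n IH]; first by rewrite /= diracT lte01.
rewrite /= /mpow_step /pushforward preimage_setT -setXTT product_measure1E//.
by rewrite mule_gt0.
Qed.

End mpow_total_mass.

Section lipschitz_field.
Context {R : realType}.

Lemma enorm_ge0 n (w : 'rV[R]_n) : 0 <= enorm w.
Proof. exact: sqrtr_ge0. Qed.

Lemma coord_le_enorm n (w : 'rV[R]_n) i : `|w 0 i| <= enorm w.
Proof.
rewrite /enorm -sqrtr_sqr ler_wsqrtr// (bigD1 i)//= lerDl.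
by rewrite sumr_ge0// => j _; rewrite sqr_ge0.
Qed.

Lemma enorm_le n (w : 'rV[R]_n) a : 0 <= a -> (forall i, `|w 0 i| <= a) ->
  enorm w <= Num.sqrt n%:R * a.
Proof.
move=> a0 wa; rewrite -[X in _ * X](ger0_norm a0) -sqrtr_sqr -sqrtrM// ler_wsqrtr//.
rewrite mulr_natl -[n in leRHS]card_ord -sumr_const ler_sum// => i _.
by rewrite -[leLHS]real_normK ?num_real// lerXn2r ?nnegrE.
Qed.

Lemma enormZ_delta n (k : 'I_n) (s : R) : 0 <= s -> enorm (s *: delta_mx 0 k : 'rV[R]_n) = s.
Proof.
move=> s0; rewrite /enorm (bigD1 k)//= big1 => [|i ik].
  by rewrite addr0 !mxE !eqxx mulr1 sqrtr_sqr ger0_norm.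
by rewrite !mxE (negPf ik) andbF mulr0 expr0n.
Qed.

Lemma torus_dist_le d (x y : 'rV[R]_d) k : torus_dist x y <= enorm (x - y + intvec k).
Proof.
apply: ge_inf; last by exists k.
by exists 0 => _ [j _ <-]; exact: enorm_ge0.
Qed.

Lemma torus_dist_ge0 d (x y : 'rV[R]_d) : 0 <= torus_dist x y.
Proof.
by apply: lb_le_inf; [exists (enorm (x - y + intvec 0)), 0|move=> _ [j _ <-]; exact: enorm_ge0].
Qed.

Lemma torus_dist_le_diam d (x y : 'rV[R]_d) : torus_dist x y <= Num.sqrt d%:R.
Proof.
(* This integer translation brings [x - y] into the unit cube. *)
apply: (le_trans (torus_dist_le _ _ (\row_i - Num.floor ((x - y) 0 i)))).
rewrite -[leRHS]mulr1; apply: enorm_le => // i.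
rewrite !mxE rmorphN/=; have /andP[h1 h2] := floor_itv (x 0 i - y 0 i).
by move: h2; rewrite intrD ler_norml => h2; apply/andP; split; lra.
Qed.

(** Two distinct points make the set of slopes nonempty, so that its supremum is nonnegative rather
    than [-oo]. Equality modulo integers would mean - 1 = 2 k. *)
Lemma torus_neq_half d (i : 'I_d) :
  torus_neq (0 : 'rV[R]_d) ((2^-1 : R) *: delta_mx 0 i).
Proof.
move=> k /matrixP /(_ 0 i); rewrite !mxE !eqxx mulr1 => h.
have : ((- 1)%:~R : R) = (k 0 i * 2)%:~R by rewrite rmorphM/= -h rmorphN1; lra.
by move=> /intr_inj; case: (k 0 i) => n; lia.
Qed.

Lemma torus_measure_setT_gt0 d : (0 < @torus_measure R d setT)%E.
Proof.
apply: mpow_setT_gt0; rewrite /= /mfrestr /mrestr setTI.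
by rewrite [X in (_ < X)%E]lebesgue_measure_itv /= lte01 sube0 lte01.
Qed.

Variables (d n : nat) (w : 'rV[R]_d -> 'rV[R]_n) (C1 : R).
Hypotheses (d_gt0 : (0 < d)%N) (lw : lipsch w) (nw : (lipsch_norm w <= C1%:E)%E).

Let slopes := [set e : \bar R | exists x y, torus_neq x y /\
  e = (enorm (w x - w y) / torus_dist x y)%:E].

Let slopes_ge0 : (0 <= ereal_sup slopes)%E.
Proof.
pose x : 'rV[R]_d := 0; pose y : 'rV[R]_d := 2^-1 *: delta_mx 0 (Ordinal d_gt0).
apply: (@le_trans _ _ (enorm (w x - w y) / torus_dist x y)%:E).
  by rewrite lee_fin divr_ge0 ?enorm_ge0 ?torus_dist_ge0.
by apply: ereal_sup_ubound; exists x, y; split => //; exact: torus_neq_half.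
Qed.

(** At distance 0 the slope is a division by zero and says nothing; there the unspecified constant
    of [lipsch] does the work. Points congruent modulo the lattice are not among the slopes and are
    settled by periodicity. *)
Lemma lipsch_sub x y : enorm (w x - w y) <= C1 * torus_dist x y.
Proof.
have [pw [K hK]] := lw.
have [d0|d0] := eqVneq (torus_dist x y) 0.
  by have := hK x y; rewrite d0 !mulr0.
have dxy : 0 < torus_dist x y by rewrite lt_def d0 torus_dist_ge0.
rewrite -ler_pdivrMr// -lee_fin.
have le_slopes : (ereal_sup slopes <= C1%:E)%E.
  by apply: le_trans nw; rewrite /lipsch_norm leeDr// Lnorm_ge0.
have [xy|] := pselect (torus_neq x y).
  by apply: le_trans le_slopes; apply: ereal_sup_ubound; exists x, y.
move=> /existsNP[k /contrapT xy].
have -> : w x = w y by rewrite -(subrK y x) xy addrC pw.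
rewrite subrr /enorm big1 ?sqrtr0 ?mul0r => [|i _]; last by rewrite mxE expr0n.
exact: le_trans slopes_ge0 le_slopes.
Qed.

(** If |w| exceeded [C1] everywhere, the null set outside which the essential bound holds would be
    the whole space, against its positive mass. *)
Lemma lipsch_norm_bound : exists x, enorm (w x) <= C1.
Proof.
apply: contrapT => /forallNP h.
have /ess_supP : (ess_sup (torus_measure d)
    (abse \o fun t : d.-tuple (measurableTypeR R) => (enorm (w (vec t)))%:E) <= C1%:E)%E.
  have := torus_measure_setT_gt0 d.
  (* The norm of exponent [+oo] is defined by cases on the total mass; [mu0] selects the essential
     supremum. *)
  move: nw; rewrite /lipsch_norm unlock/= => hn mu0; rewrite mu0 in hn.
  by apply: le_trans hn; rewrite leeDl.
move=> [A [mA A0 hA]]; have := torus_measure_setT_gt0 d.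
have -> : setT = A; last by move: A0 => /= ->; rewrite ltxx.
apply/esym/seteqP; split => // t _; apply: hA => /=.
by rewrite lee_fin ger0_norm ?enorm_ge0//; exact: h.
Qed.

Lemma lipsch_cst_ge0 : 0 <= C1.
Proof. by have [x] := lipsch_norm_bound; apply: le_trans; exact: enorm_ge0. Qed.

Lemma lipsch_coord_bound x i : `|w x 0 i| <= C1 * (1 + Num.sqrt d%:R).
Proof.
have [y hy] := lipsch_norm_bound.
have h1 : `|(w x - w y) 0 i| <= C1 * Num.sqrt d%:R.
  apply: (le_trans (coord_le_enorm _ _)); apply: (le_trans (lipsch_sub _ _)).
  by rewrite ler_wpM2l ?lipsch_cst_ge0// torus_dist_le_diam.
have h2 := le_trans (coord_le_enorm (w y) i) hy.
rewrite mulrDr mulr1 -(subrK (w y 0 i) (w x 0 i)) addrC (le_trans (ler_normD _ _))//.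
by rewrite lerD//; move: h1; rewrite !mxE.
Qed.

Lemma lipsch_coord_sub x y i : `|w x 0 i - w y 0 i| <= C1 * enorm (x - y).
Proof.
have h : `|(w x - w y) 0 i| <= C1 * enorm (x - y).
  apply: (le_trans (coord_le_enorm _ _)); apply: (le_trans (lipsch_sub _ _)).
  rewrite ler_wpM2l ?lipsch_cst_ge0// (le_trans (torus_dist_le _ _ 0))//.
  by rewrite /intvec map_mx0 addr0.
by move: h; rewrite !mxE.
Qed.

Lemma continuous_lipsch_coord i : continuous (fun x => w x 0 i).
Proof.
move=> x; apply/(@cvgrPdist_lt _ _ _ (nbhs x) (nbhs_filter x)) => e e0.
pose c := C1 * Num.sqrt d%:R + 1.
have c0 : 0 < c by rewrite ltr_wpDl// mulr_ge0// lipsch_cst_ge0.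
near=> y; apply: (le_lt_trans (lipsch_coord_sub _ _ _)).
apply: (@le_lt_trans _ _ (c * `|x - y|)).
  apply: (@le_trans _ _ (C1 * (Num.sqrt d%:R * `|x - y|))).
    rewrite ler_wpM2l ?lipsch_cst_ge0//; apply: enorm_le => // j.
    rewrite [leRHS]mx_normrE.
    exact: (le_bigmax 0 (fun i => `|(x - y) i.1 i.2|) (0, j)).
  by rewrite mulrA ler_wpM2r// lerDl.
rewrite mulrC -ltr_pdivlMr//; near: y.
have r0 : 0 < e / c by rewrite divr_gt0.
by have := (@nbhsx_ballx _ 'rV[R]_d x _ r0); rewrite mx_norm_ball.
Unshelve. all: by end_near.
Qed.

End lipschitz_field.

Section field_matrix.
Context {R : realType} (d n : nat) (p : 'I_d -> 'I_d -> 'I_n -> bool).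

(* [p i j l] is meant to hold for the positively oriented triples: the matrix is then that of
   v |-> v /\ B. *)
Definition field_matrix (B : 'rV[R]_d -> 'rV[R]_n) (i j : 'I_d) (x : 'rV[R]_d) : R :=
  \sum_l ((p i j l)%:R - (p j i l)%:R) * B x 0 l.

Let sign_le1 i j l : `|(p i j l)%:R - (p j i l)%:R| <= 1 :> R.
Proof. by case: (p i j l); case: (p j i l); rewrite ?subrr ?subr0 ?sub0r ?normrN ?normr1 ?normr0. Qed.

(** An entry is a signed sum of at most n components, each bounded as in [lipsch_coord_bound]; as
    that bound is at least [C1], it also covers the slopes. *)
Definition field_cst (C1 : R) : R := n%:R * (C1 * (1 + Num.sqrt d%:R)).

Lemma field_bound_matrix B C1 : (0 < d)%N -> lipsch B -> (lipsch_norm B <= C1%:E)%E ->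
  field_bound (field_cst C1) (field_matrix B).
Proof.
move=> d0 lB nB; have C10 := lipsch_cst_ge0 d0 nB.
have bd (F : 'I_n -> R) a i j : (forall l, `|F l| <= a) ->
    `|\sum_l ((p i j l)%:R - (p j i l)%:R) * F l| <= n%:R * a.
  move=> Fa; apply: (le_trans (ler_norm_sum _ _ _)).
  rewrite mulr_natl -[n in leRHS]card_ord -sumr_const ler_sum// => l _.
  by rewrite normrM -[leRHS]mul1r ler_pM.
split.
- move=> i j.
  have := @continuous_big R _ +%R 0 xpredT (@add_continuous _) 'rV[R]_d (index_enum _)
    (fun l x => ((p i j l)%:R - (p j i l)%:R) * B x 0 l). 
  apply => l _ x.
  apply: (@continuousM R 'rV[R]_d (fun=> _) (fun x => B x 0 l) x).
    exact: (@cst_continuous _ _ _ x).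
  exact: (continuous_lipsch_coord d0 lB nB).
- by move=> i j k x; rewrite /field_matrix (proj1 lB).
- by move=> i j x; apply: bd => l; exact: (lipsch_coord_bound d0 lB nB).
- by move=> i j x; rewrite /field_matrix -sumrN; apply: eq_bigr => l _; ring.
- move=> i j k x s s0.
  rewrite /field_matrix -sumrB.
  under eq_bigr do rewrite -mulrBr.
  rewrite /field_cst -!mulrA; apply: bd => l.
  apply: (le_trans (lipsch_coord_sub d0 lB nB _ _ _)).
  rewrite addrAC subrr add0r enormZ_delta// ler_wpM2l// mulrDl mul1r lerDl.
  by rewrite mulr_ge0.
Qed.

End field_matrix.

(** * Complex-valued functions and the norms *)

Section complex_functions.
Context {R : realType} (d : nat).
Notation phase := ('rV[R]_d * 'rV[R]_d)%type.
Notation V := (elt (@nice_linset R d)).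
Notation S := (elt (@smooth_linset R d)).
Notation nV := (nrm (@dotV R d)).
Notation nS := (nrm (@dotS R d)).
Implicit Types (u : phase -> R[i]) (z : phase).

Definition cplx (f g : phase -> R) : phase -> R[i] := fun z => (f z +i* g z)%C.

Lemma sum_cplx (I : Type) (r : seq I) (x y : I -> R) :
  \sum_(k <- r) (x k +i* y k)%C = ((\sum_(k <- r) x k) +i* (\sum_(k <- r) y k))%C.
Proof.
elim: r => [|k r IH]; first by rewrite !big_nil.
by rewrite !big_cons IH; simpc.
Qed.

Lemma pds_periodic u s (k : 'rV[int]_d) x v :
  (forall x v, u (x + intvec k, v) = u (x, v)) ->
  pds s u (x + intvec k, v) = pds s u (x, v).
Proof.
move=> pu; elim: s x v => [|i s IH] x v /=; first exact: pu.
suff D (f : phase -> R) : (forall x v, f (x + intvec k, v) = f (x, v)) ->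
    'D_(dir i) f (x + intvec k, v) = 'D_(dir i) f (x, v).
  have pR y w : (@complex.Re R \o pds s u) (y + intvec k, w) = (@complex.Re R \o pds s u) (y, w).
    by rewrite /= IH.
  have pI y w : (@complex.Im R \o pds s u) (y + intvec k, w) = (@complex.Im R \o pds s u) (y, w).
    by rewrite /= IH.
  by rewrite /pd (D _ pR) (D _ pI).
move=> pf; have E : (fun h : R => h^-1 *: ((f \o shift (x + intvec k, v)) (h *: (dir i : phase)) -
      f (x + intvec k, v))) =
    (fun h => h^-1 *: ((f \o shift (x, v)) (h *: (dir i : phase)) - f (x, v))).
  apply/funext => h /=; rewrite pf; congr (_ *: (_ - _)).
  case: (dir i) => a b; rewrite -[RHS]pf; congr (f (_, _)).
  by rewrite /= addrA.
by rewrite /derive E.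
Qed.

Lemma Re_le_normc (c : R[i]) : `|complex.Re c| <= Normc.normc c.
Proof. by case: c => a b /=; rewrite -sqrtr_sqr ler_wsqrtr// lerDl sqr_ge0. Qed.

Lemma Im_le_normc (c : R[i]) : `|complex.Im c| <= Normc.normc c.
Proof. by case: c => a b /=; rewrite -sqrtr_sqr ler_wsqrtr// lerDr sqr_ge0. Qed.

Lemma expr_1D_le n (a : R) : 0 <= a -> (1 + a) ^+ n <= 2 ^+ n * (1 + a ^+ n).
Proof.
move=> a0; have an : 0 <= a ^+ n by rewrite exprn_ge0.
have [a1|/ltW a1] := leP a 1.
  apply: (@le_trans _ _ (2 ^+ n)); last by rewrite ler_peMr ?exprn_ge0// lerDl.
  by rewrite lerXn2r ?nnegrE ?addr_ge0//; lra.
apply: (@le_trans _ _ (2 ^+ n * a ^+ n)); last by rewrite ler_wpM2l ?exprn_ge0// lerDr.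
by rewrite -exprMn lerXn2r ?nnegrE ?mulr_ge0 ?addr_ge0//; lra.
Qed.

Lemma schwartz_decay u s n : schwartz u ->
  exists M, forall z, weight z ^+ n * Normc.normc (pds s u z) <= M.
Proof.
move=> [_ _ dec]; have [M0 h0] := dec s 0%N; have [M1 h1] := dec s (2 * n)%N.
exists (2 ^+ n * (M0 + M1)) => z.
apply: (@le_trans _ _ (2 ^+ n * (1 + (enorm z.2 ^+ 2) ^+ n) * Normc.normc (pds s u z))).
  rewrite ler_wpM2r ?expr_1D_le ?sqr_ge0//.
  by case: (pds s u z) => a b; exact: sqrtr_ge0.
rewrite -mulrA ler_wpM2l ?exprn_ge0// mulrDl lerD//.
  by have := h0 z; rewrite expr0.
by rewrite -exprM.
Qed.

Lemma schwartz_nice_upto u m s : schwartz u ->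
  nice_upto m (@complex.Re R \o pds s u) /\ nice_upto m (@complex.Im R \o pds s u).
Proof.
move=> su; elim: m s => [|m IH] s; have [pu smu _] := su; have [cR cI dRI] := smu s.
  split; split => //; split => //; do ?[by move=> k x v /=; rewrite pds_periodic];
    move=> n; have [M hM] := schwartz_decay s n su; exists M => z;
    apply: (le_trans _ (hM z)); rewrite ler_wpM2l ?exprn_ge0 ?(ltW (weight_gt0 _))//.
    exact: Re_le_normc.
  exact: Im_le_normc.
have [[nR _] [nI _]] : nice_upto 0 (@complex.Re R \o pds s u) /\
    nice_upto 0 (@complex.Im R \o pds s u).
  by have [] := IH s; case: (m) => // m' [? _] [? _].
split; split => // i; split; try by move=> z; have [] := dRI i z.
  exact: (proj1 (IH (i :: s))).
exact: (proj2 (IH (i :: s))).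
Qed.

Lemma schwartz_cplx u : schwartz u -> exists f g : S, u = cplx f g.
Proof.
move=> su.
have sR : smooth_nice (@complex.Re R \o u) by move=> m; exact: (proj1 (schwartz_nice_upto m [::] su)).
have sI : smooth_nice (@complex.Im R \o u) by move=> m; exact: (proj2 (schwartz_nice_upto m [::] su)).
exists (@Elt _ _ (smooth_linset d) _ sR), (@Elt _ _ (smooth_linset d) _ sI).
by apply/funext => z; rewrite /cplx /=; case: (u z).
Qed.

Lemma L2norm_cplx (f g : V) :
  L2norm (cplx f g) = (Num.sqrt (nV f ^+ 2 + nV g ^+ 2))%:E.
Proof.
have nfg := niceP 1 (nice_mul (eltP f) (eltP f)) (nice_mul (eltP g) (eltP g)).
rewrite /L2norm unlock -powR12_sqrt ?addr_ge0 ?sqr_ge0// -poweR_EFin; congr (_ `^ _)%E.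
rewrite !sqr_nrm !dotVE -[X in (X + _)%:E]mul1r -Iint_lin; [|exact: nice_mul (eltP f) (eltP f)|
  exact: nice_mul (eltP g) (eltP g)].
rewrite /Iint fineK; last exact: (integrable_fin_num measurableT (nice_integrable nfg)).
apply: eq_integral => p _ /=.
rewrite mul1r ger0_norm ?sqrtr_ge0// powR_mulrn ?sqrtr_ge0// sqr_sqrtr ?addr_ge0 ?sqr_ge0//.
Qed.

Lemma L2norm_le (f g : V) (K : R) : nV f <= K -> nV g <= K ->
  (L2norm (cplx f g) <= (2 * K)%:E)%E.
Proof.
move=> fK gK; have f0 := nrm_ge0 (@dotV R d) f; have g0 := nrm_ge0 (@dotV R d) g.
have K0 : 0 <= K by exact: le_trans fK.
rewrite L2norm_cplx lee_fin -[leRHS]ger0_norm ?mulr_ge0// -sqrtr_sqr ler_wsqrtr//.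
have : nV f ^+ 2 <= K ^+ 2 by rewrite lerXn2r ?nnegrE.
have : nV g ^+ 2 <= K ^+ 2 by rewrite lerXn2r ?nnegrE.
have : 0 <= K ^+ 2 by rewrite sqr_ge0.
by rewrite exprMn; lra.
Qed.

Lemma le_L2norm (f g : V) : [/\ nV f <= fine (L2norm (cplx f g)),
  nV g <= fine (L2norm (cplx f g)) &
  L2norm (cplx f g) = (fine (L2norm (cplx f g)))%:E].
Proof.
have f0 := nrm_ge0 (@dotV R d) f; have g0 := nrm_ge0 (@dotV R d) g.
rewrite L2norm_cplx/=; split => //.
  by rewrite -[leLHS]ger0_norm// -sqrtr_sqr ler_wsqrtr// lerDl sqr_ge0.
by rewrite -[leLHS]ger0_norm// -sqrtr_sqr ler_wsqrtr// lerDr sqr_ge0.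
Qed.

Lemma pd_cplx i (f g : S) z : pd i (cplx f g) z = (pdS i f z +i* pdS i g z)%C.
Proof. by []. Qed.

Lemma sum_pd (I : finType) (c : I -> R) (k : I -> 'I_d + 'I_d) (f g : S) z :
  \sum_i ((c i)%:C * pd (k i) (cplx f g) z)%C =
  ((\sum_i c i * pdS (k i) f z) +i* (\sum_i c i * pdS (k i) g z))%C.
Proof. by rewrite -sum_cplx; apply: eq_bigr => i _; rewrite pd_cplx; simpc. Qed.

Lemma foldr_iter (A : Type) (F : 'I_d -> A -> A) (c : 'I_d -> nat) x s :
  foldr (fun i => iter (c i) (F i)) x s = foldr F x (flatten [seq nseq (c i) i | i <- s]).
Proof.
elim: s => //= i s ->; rewrite foldr_cat.
by elim: (c i) => //= k ->.
Qed.

(** Spelling a multi-index as a list of letters turns |a| + |b| <= 2 into a case distinction on two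
    lengths, made in [word_bound]. *)
Definition word (c : {ffun 'I_d -> 'I_3}) : seq 'I_d :=
  flatten [seq nseq (c i) i | i <- enum 'I_d].

Lemma size_word c : size (word c) = (\sum_i c i)%N.
Proof.
rewrite size_flatten /shape -map_comp sumnE big_map big_enum/=.
by apply: eq_bigr => i _; rewrite size_nseq.
Qed.

Lemma B2_term (a b : {ffun 'I_d -> 'I_3}) (f g : S)
    (A := fun w : S => foldr (fun i => @mulS R d i)
      (foldr (fun i => @pdS R d (inr i)) w (word b)) (word a)) :
  (fun z => ((vmon a z.2)%:C)%C * dvs b (cplx f g) z) = cplx (A f) (A g).
Proof.
have -> : dvs b (cplx f g) = cplx (foldr (fun i => @pdS R d (inr i)) f (word b))
    (foldr (fun i => @pdS R d (inr i)) g (word b)).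
  by rewrite /dvs foldr_iter -/(word b); elim: (word b) => //= i s ->.
have vE (w : S) z : foldr (fun i => @mulS R d i) w (word a) z = vmon a z.2 * w z.
  have -> : vmon a z.2 = foldr (fun i => *%R (z.2 0 i)) 1 (word a).
    rewrite /word -foldr_iter /vmon -big_enum/=.
    elim: (enum _) => [|i s IH]; first by rewrite big_nil.
    by rewrite big_cons IH/= iter_mulr.
  by elim: (word a) => [|i s IH] /=; rewrite ?mul1r// /mulv IH mulrA.
by apply/funext => z; rewrite /cplx /A !vE; simpc.
Qed.

Lemma word_bound (F G : 'I_d -> S -> S) (w : S) (K : R) (s t : seq 'I_d) :
  (size s + size t <= 2)%N -> nS w <= K ->
  (forall i, nS (F i w) <= K) -> (forall i, nS (G i w) <= K) ->
  (forall i j, nS (F i (F j w)) <= K) -> (forall i j, nS (F i (G j w)) <= K) ->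
  (forall i j, nS (G i (G j w)) <= K) ->
  nS (foldr F (foldr G w t) s) <= K.
Proof.
by case: s => [|? [|? [|? ?]]]; case: t => [|? [|? [|? ?]]] //= *; auto.
Qed.

End complex_functions.

(** * Evaluation in coordinates and assembly of the estimate *)

Section final_estimate.
Context {R : realType}.

Section evaluation.
Variables (d : nat) (B0 : R).
Hypothesis B0_ge0 : 0 <= B0.
Variables (beta : 'I_d -> 'I_d -> 'rV[R]_d -> R) (fb : field_bound B0 beta).
Notation S := (elt (@smooth_linset R d)).

Lemma injE (f : S) z : @inj R d f z = f z. Proof. by []. Qed.

Lemma real_transportE (f : S) z : real_transport B0_ge0 fb f z =
  \sum_i z.2 0 i * pdS (inl i) f z -
  \sum_i \sum_j beta i j z.1 * z.2 0 i * pdS (inr j) f z.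
Proof.
rewrite /real_transport eltDE eltNE; congr (_ - _).
  by rewrite -[LHS]/((free_transport _ _ _ : S) z) /free_transport elt_sumE.
rewrite /rotation elt_sumE; apply: eq_bigr => i _; rewrite elt_sumE.
by apply: eq_bigr => j _; rewrite mulbE /= /mulv mulrA.
Qed.

Lemma real_fpE (f : S) z : real_fp B0_ge0 fb f z =
  real_transport B0_ge0 fb f z - \sum_i pdS (inr i) (pdS (inr i) f) z +
  (enorm z.2 ^+ 2 / 4 - d%:R / 2) * f z.
Proof.
rewrite /real_fp /kinetic -/(real_transport B0_ge0 fb f).
rewrite eltDE eltNE eltZE [(real_transport _ _ _ + _) z]eltDE !injE sqr_enorm.
have -> : (oscillator (fun i => pdS (inr i)) (@mulS R d) f : S) z =
    - (\sum_i pdS (inr i) (pdS (inr i) f) z) + 4^-1 * \sum_i mulS i (mulS i f) z.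
  by rewrite /oscillator eltDE eltNE eltZE !elt_sumE.
have -> : \sum_i mulS i (mulS i f) z = (\sum_i z.2 0 i ^+ 2) * f z.
  by rewrite mulr_suml; apply: eq_bigr => i _; rewrite /= /mulv expr2 mulrA.
by field.
Qed.

End evaluation.

Section wedge.

Definition cyclic2 (i j : 'I_2) (l : 'I_1) : bool := (i == 0) && (j == 1).

(** The triples on which the Levi-Civita symbol is +1. *)
Definition cyclic3 (i j l : 'I_3) : bool :=
  match nat_of_ord i, nat_of_ord j, nat_of_ord l with
  | 0, 1, 2 | 1, 2, 0 | 2, 0, 1 => true
  | _, _, _ => false
  end%N.

Definition wedge_matrix d (p : 'I_d -> 'I_d -> 'I_((d * (d - 1))./2) -> bool) :=
  forall (B : @magnetic_field R d) u z, wedge_grad B u z =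
    \sum_i \sum_j ((field_matrix p B i j z.1 * z.2 0 i)%:C * pd (inr j) u z)%C.

Lemma wedge_matrix2 : @wedge_matrix 2 cyclic2.
Proof.
have sum2 (V : nmodType) (F : 'I_2 -> V) : \sum_i F i = F 0 + F 1.
  by rewrite !big_ord_recl big_ord0 addr0; congr (_ + F _); exact: val_inj.
move=> B u z; rewrite /= /wedge_grad2 /= !sum2.
have E i j : field_matrix cyclic2 B i j z.1 =
    ((cyclic2 i j 0)%:R - (cyclic2 j i 0)%:R) * B z.1 0 0.
  by rewrite /field_matrix (@big_ord_recl _ _ _ 0) big_ord0 addr0.
rewrite !E /cyclic2 /= {E}.
move: (B z.1 0 0) (z.2 0 0) (z.2 0 1) (pd (inr 0) u z) (pd (inr 1) u z).
move=> b v0 v1 [a0 b0] [a1 b1] {B u z}; simpc.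
by congr (_ +i* _)%C; ring.
Qed.

Lemma wedge_matrix3 : @wedge_matrix 3 cyclic3.
Proof.
have sum3 (V : nmodType) (F : 'I_3 -> V) : \sum_i F i = F 0 + F 1 + F 2%:R.
  rewrite !big_ord_recl big_ord0 addr0 addrA.
  by congr (_ + F _ + F _); exact: val_inj.
move=> B u z; rewrite /= /wedge_grad3 /= !sum3.
have E i j : field_matrix cyclic3 B i j z.1 =
    ((cyclic3 i j 0)%:R - (cyclic3 j i 0)%:R) * B z.1 0 0 +
    ((cyclic3 i j 1)%:R - (cyclic3 j i 1)%:R) * B z.1 0 1 +
    ((cyclic3 i j 2%:R)%:R - (cyclic3 j i 2%:R)%:R) * B z.1 0 2%:R.
  exact: sum3.
rewrite !E /cyclic3.
have -> : nat_of_ord (0 : 'I_3) = 0%N by [].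
have -> : nat_of_ord (1 : 'I_3) = 1%N by [].
have -> : nat_of_ord (2%:R : 'I_3) = 2%N by [].
move: (B z.1 0 0) (B z.1 0 1) (B z.1 0 2%:R) (z.2 0 0) (z.2 0 1) (z.2 0 2%:R)
  (pd (inr 0) u z) (pd (inr 1) u z) (pd (inr 2%:R) u z) => b0 b1 b2 v0 v1 v2.
move=> [x0 y0] [x1 y1] [x2 y2] {B u z E} /=; simpc.
by congr (_ +i* _)%C; ring.
Qed.

End wedge.

End final_estimate.

Section final_estimate.
Context {R : realType}.

Lemma maximal_estimate (d : nat) (p : 'I_d -> 'I_d -> 'I_((d * (d - 1))./2) -> bool) (C1 : R) :
  (0 < d)%N -> @wedge_matrix R d p -> 0 < C1 ->
  exists2 C : R, 0 < C & forall (B : @magnetic_field R d) u,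
    lipsch B -> (lipsch_norm B <= C1%:E)%E -> schwartz u ->
    (L2norm (transport B u) + B2norm u <=
     C%:E * (L2norm (fokker_planck B u) + L2norm u))%E.
Proof.
move=> d0 wp C10.
have B0_ge0 : 0 <= field_cst d (d * (d - 1))./2 C1.
  by rewrite /field_cst !mulr_ge0 ?addr_ge0// ltW.
have [C C_ge1 est] := @real_estimate R d _ B0_ge0.
have C0 : 0 < C by exact: lt_le_trans C_ge1.
pose N : R := #|[the finType of ({ffun 'I_d -> 'I_3} * {ffun 'I_d -> 'I_3})%type]|%:R.
(* The 2 joins real and imaginary parts. [N] counts all pairs of multi-indices, more than the terms
   of [B2norm], and N + 1 majorises the square root of N. *)
exists (2 * C + (N + 1) * (2 * C)); first by rewrite addr_gt0 ?mulr_gt0 ?ltr_wpDl.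
move=> B u lB nB su.
have fb := field_bound_matrix p d0 lB nB.
have [f [g ufg]] := schwartz_cplx su; rewrite {su u}ufg.
have TE : transport B (cplx f g) =
    cplx (real_transport B0_ge0 fb f) (real_transport B0_ge0 fb g).
  apply/funext => z; rewrite /transport wp [X in X - _]sum_pd.
  under [X in _ - X]eq_bigr do rewrite sum_pd.
  by rewrite sum_cplx /cplx !real_transportE; simpc.
have FE : fokker_planck B (cplx f g) =
    cplx (real_fp B0_ge0 fb f) (real_fp B0_ge0 fb g).
  apply/funext => z; rewrite /fokker_planck TE /cplx !real_fpE.
  have -> : \sum_i pd (inr i) (pd (inr i) (cplx f g)) z =
      ((\sum_i pdS (inr i) (pdS (inr i) f) z) +i* (\sum_i pdS (inr i) (pdS (inr i) g) z))%C.
    exact: sum_cplx.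
  have E (a b c e k x y : R) :
      ((a +i* b) - (c +i* e) + k%:C * (x +i* y) = (a - c + k * x) +i* (b - e + k * y))%C.
    by simpc.
  exact: E.
have [uf ug uE] := le_L2norm (@inj R d f) (@inj R d g).
have [wf wg wE] := le_L2norm (real_fp B0_ge0 fb f) (real_fp B0_ge0 fb g).
set lu := fine _ in uf ug uE; set lw := fine _ in wf wg wE.
have [tf ddf mmf mdf [df mf]] := est _ fb f.
have [tg ddg mmg mdg [dg mg]] := est _ fb g.
pose K := C * (lw + lu).
have uEE : L2norm (cplx f g) = lu%:E by exact: uE.
rewrite FE wE uEE TE.
have Kf x : x <= C * (nrm (@dotV R d) (real_fp B0_ge0 fb f) + nrm (@dotS R d) f) -> x <= K.
  by move=> h; apply: (le_trans h); rewrite ler_pM2l// lerD.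
have Kg x : x <= C * (nrm (@dotV R d) (real_fp B0_ge0 fb g) + nrm (@dotS R d) g) -> x <= K.
  by move=> h; apply: (le_trans h); rewrite ler_pM2l// lerD.
have lu0 : 0 <= lu by apply: le_trans uf; exact: nrm_ge0.
have lw0 : 0 <= lw by apply: le_trans wf; exact: nrm_ge0.
have K0 : 0 <= K by rewrite mulr_ge0 ?addr_ge0// ltW.
have uK : lu <= K.
  by rewrite /K -[leLHS]mul1r ler_pM// lerDr.
rewrite -EFinD -EFinM mulrDl EFinD leeD//.
  by rewrite -mulrA; apply: L2norm_le; [exact: Kf|exact: Kg].
rewrite -[X in (_ <= X)%E]/(((N + 1) * (2 * C) * (lw + lu))%:E) -!mulrA -/K.
have term (ab : {ffun 'I_d -> 'I_3} * {ffun 'I_d -> 'I_3}) :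
    (\sum_i ab.1 i + \sum_i ab.2 i <= 2)%N ->
    (L2norm (fun z => ((vmon ab.1 z.2)%:C)%C * dvs ab.2 (cplx f g) z)%R <= (2 * K)%:E)%E.
  rewrite -!size_word B2_term => ab2.
  apply: (@L2norm_le R d (@inj R d _) (@inj R d _));
    (apply: word_bound => // *; [exact: le_trans uK|..]).
  - exact/Kf/mf.
  - exact/Kf/df.
  - exact/Kf/mmf.
  - exact/Kf/mdf.
  - exact/Kf/ddf.
  - exact/Kg/mg.
  - exact/Kg/dg.
  - exact/Kg/mmg.
  - exact/Kg/mdg.
  - exact/Kg/ddg.
have K4 : 0 <= 4 * K ^+ 2 by apply: mulr_ge0 => //; exact: sqr_ge0.
have normE (ab : {ffun 'I_d -> 'I_3} * {ffun 'I_d -> 'I_3}) :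
    (\sum_i ab.1 i + \sum_i ab.2 i <= 2)%N ->
    (L2norm (fun z => ((vmon ab.1 z.2)%:C)%C * dvs ab.2 (cplx f g) z)%R ^+ 2 <=
     (4 * K ^+ 2)%:E)%E.
  move=> /term h; have -> : 4 * K ^+ 2 = (2 * K) ^+ 2 by ring.
  by rewrite EFin_expe !expe2; apply: lee_pmul => //; exact: Lnorm_ge0.
rewrite /B2norm.
set s := (\sum_(ab | _) _)%E.
have sN : (s <= (N * (4 * K ^+ 2))%:E)%E.
  apply: (le_trans (@lee_sum _ _ _ _ (index_enum _) _ normE)).
  rewrite sumEFin lee_fin sumr_const [leRHS]mulr_natl ler_wpMn2l//.
  exact: max_card.
have s0 : (0 <= s)%E by apply: sume_ge0 => ab _; rewrite expe_ge0// Lnorm_ge0.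
have NK : 0 <= N * (4 * K ^+ 2) by exact: mulr_ge0.
have half0 : 0 <= 2^-1 :> R by rewrite invr_ge0.
apply: (@le_trans _ _ ((N * (4 * K ^+ 2))%:E `^ 2^-1)%E).
  by apply: gt0_ler_poweR => //; rewrite in_itv/= leey andbT.
rewrite poweR_EFin lee_fin powR12_sqrt// -[leRHS]ger0_norm ?mulr_ge0 ?addr_ge0//; last exact: ltW.
rewrite -sqrtr_sqr ler_wsqrtr//.
have N0 : 0 <= N by [].
have -> : ((N + 1) * (2 * K)) ^+ 2 = (N + 1) ^+ 2 * (4 * K ^+ 2) by ring.
have N2 := sqr_ge0 N; rewrite ler_wpM2r//; lra.
Qed.

End final_estimate.

Theorem theorem1p3 (R : realType) (d : nat) (hd : d = 2%N \/ d = 3%N)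
    (C1 : R) (hC1 : 0 < C1) :
  exists2 C : R, 0 < C &
    forall (B : 'rV[R]_d -> 'rV[R]_((d * (d - 1))./2))
           (u : 'rV[R]_d * 'rV[R]_d -> R[i]),
      lipsch B -> (lipsch_norm B <= C1%:E)%E -> schwartz u ->
      (L2norm (transport B u) + B2norm u <=
       C%:E * (L2norm (fokker_planck B u) + L2norm u))%E.
Proof.
case: hd => ->.
  exact: maximal_estimate (@wedge_matrix2 R) hC1.
exact: maximal_estimate (@wedge_matrix3 R) hC1.
Qed.
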